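(* Let $\alpha\in(0,1)$ and let $\beta=[0;a_1,a_2,\dots]\in(0,1]$ be an irrational number of intermediate $\alpha$-type with $\lim_{n\to\infty}a_n=+\infty$ (so that $\Omega_1(\beta)=\{1/n:n\in\mathbb N\}\cup\{0\}$). Fix $k\in\mathbb{N}$, let $l=l(k)=\min\{i\in\mathbb{N}: a_m\ge k\text{ for all }m\ge i\}$, for each $j\ge l$ let $n_{k,j}\in\mathbb{N}$ be the unique integer with $T_1^{n_{k,j}}(\beta)=[0;k,a_{j+1},a_{j+2},\dots]$, and set $$\mathscr{S}_{k,j}=\frac{(a_{j+1})^{\alpha}\ln(n_{k,j})}{(q_j)^{2(1-\alpha)}}.$$ If $\limsup_{j\to\infty}\mathscr{S}_{k,j}=0$, then $\lim_{n\to\infty}\ln(n)\,\mathcal{P}_1^n(v_{\beta,\alpha})(1/k)=\big(\int v_{\beta,\alpha}\,\mathrm{d}\lambda\big)h_1(1/k)$. Otherwise, $$\liminf_{n\to\infty}\ln(n)\,\mathcal{P}_1^n(v_{\beta,\alpha})(1/k)=\Big(\int v_{\beta,\alpha}\,\mathrm{d}\lambda\Big)h_1(1/k)\quad\text{and}\quad \limsup_{n\to\infty}\ln(n)\,\mathcal{P}_1^n(v_{\beta,\alpha})(1/k)>\int v_{\beta,\alpha}\,\mathrm{d}\lambda.$$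
   Context: $T_1$ is the Farey map: $T_1(x)=\frac{x}{1-x}$ for $0\le x\le1/2$, $T_1(x)=\frac{1-x}{x}$ for $1/2<x\le1$, inverse branches $f_{1,0}(x)=\frac x{1+x}$, $f_{1,1}(x)=\frac1{1+x}$; $\mathcal{P}_1(f)=|f_{1,0}'|\,f\circ f_{1,0}+|f_{1,1}'|\,f\circ f_{1,1}$; $h_1(x)=1/x$; $\lambda$ Lebesgue measure; $v_{\beta,\alpha}(x)=|\beta-x|^{-\alpha}$. $\Omega_1(\beta)$ is the $\omega$-limit set of $\beta$ under $T_1$. Continued fraction convergent denominators: $q_{-1}=0$, $q_0=1$, $q_n=a_nq_{n-1}+q_{n-2}$. For irrational $\beta=[0;a_1,a_2,\dots]$, with $s_{n,j}/t_{n,j}=[0;a_1,\dots,a_{n-1},j]$ in lowest terms ($1\le j\le a_n$), $\beta$ is of intermediate $\alpha$-type if $\sum_{n\ge1}\sum_{j=1}^{a_n}t_{n,j}^{-2(1-\alpha)+\epsilon}<\infty$ for some $\epsilon>0$. *)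

(* Defs.v *)
From Stdlib Require Import Reals Lra Lia List.
Import ListNotations.
Open Scope R_scope.

Definition T1 (x : R) : R :=
  if Rle_dec x (1/2) then x / (1 - x) else (1 - x) / x.

Definition f10 (x : R) : R := x / (1 + x).
Definition f11 (x : R) : R := 1 / (1 + x).

(* Transfer operator P_1: |f_{1,0}'(x)| = |f_{1,1}'(x)| = 1/(1+x)^2. *)
Definition P1 (f : R -> R) (x : R) : R :=
  Rabs (1 / (1 + x) ^ 2) * f (f10 x) + Rabs (- (1 / (1 + x) ^ 2)) * f (f11 x).

Definition P1n (n : nat) (f : R -> R) : R -> R := Nat.iter n P1 f.

Definition h1 (x : R) : R := 1 / x.

Definition v (beta alpha : R) (x : R) : R := Rpower (Rabs (beta - x)) (- alpha).

Definition cf_fin (l : list nat) : R :=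
  fold_right (fun b x => 1 / (INR b + x)) 0 l.

Definition digits (a : nat -> nat) (start m : nat) : list nat := map a (seq start m).

(* Pair (q_{n-1}, q_n) of convergent denominators, q_{-1}=0, q_0=1,
   q_n = a_n q_{n-1} + q_{n-2}. *)
Fixpoint qpair (a : nat -> nat) (n : nat) : nat * nat :=
  match n with
  | O => (0%nat, 1%nat)
  | S m => let (qm1, qm) := qpair a m in (qm, (a (S m) * qm + qm1)%nat)
  end.
Definition q (a : nat -> nat) (n : nat) : nat := snd (qpair a n).

Definition is_lowest_denom (x : R) (t : nat) : Prop :=
  (0 < t)%nat /\ (exists s : Z, x = IZR s / INR t) /\
  (forall t' : nat, (0 < t')%nat -> (exists s : Z, x = IZR s / INR t') -> (t <= t')%nat).

Definition intermediate_type (a : nat -> nat) (alpha : R) : Prop :=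
  exists eps : R, 0 < eps /\
  exists t : nat -> nat -> nat,
    (forall n j : nat, (1 <= n)%nat -> (1 <= j <= a n)%nat ->
       is_lowest_denom (cf_fin (digits a 1 (n - 1) ++ [j])) (t n j)) /\
    exists L : R,
      Un_cv (fun N => sum_f 1 N
               (fun n => sum_f 1 (a n)
                  (fun j => Rpower (INR (t n j)) (-2 * (1 - alpha) + eps)))) L.

Definition is_limsup (u : nat -> R) (L : R) : Prop :=
  (forall e, 0 < e -> exists N, forall n, (N <= n)%nat -> u n < L + e) /\
  (forall e, 0 < e -> forall N, exists n, (N <= n)%nat /\ L - e < u n).

Definition is_liminf (u : nat -> R) (L : R) : Prop :=
  (forall e, 0 < e -> exists N, forall n, (N <= n)%nat -> L - e < u n) /\
  (forall e, 0 < e -> forall N, exists n, (N <= n)%nat /\ u n < L + e).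

(* I is the (improper Riemann) integral over [0,1] of f, which is
   continuous except at the singular point c in (0,1). *)
Definition improper_int01 (f : R -> R) (c I : R) : Prop :=
  forall e, 0 < e -> exists d, 0 < d /\
    forall eps, 0 < eps < d ->
      exists (pr1 : Riemann_integrable f 0 (c - eps))
             (pr2 : Riemann_integrable f (c + eps) 1),
        Rabs (RiemannInt pr1 + RiemannInt pr2 - I) < e.

(* Main.v *)
Require Import Defs.
From Stdlib Require Import ZArith Reals Lra Lia List Classical.
From Coquelicot Require Import Coquelicot.
Import ListNotations.
Open Scope R_scope.

(** Conjugating by the invariant density [1/x] turns [x f(x) = u(x)] into
    [(1 - s) u(s) + s u(1 - s)] with [s = x / (1 + x)], an operation that preserves the
    nondecreasing concave functions [u].  For such [f] the values [P1n n f 1] are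
    nonincreasing in [n], so the renewal identity for the mass of [f] yields
    [ln n * P1n n f (1 / k) -> k * int f] without any spectral theory.  This applies to
    [vreg = ((x - beta)^2 + delta)^(-alpha/2)], a difference of two such functions.

    The error [v - vreg] is split along the Farey cylinders shrinking to [beta].  The part
    sitting at level [m] is dominated by explicit functions of the same cone, and after
    multiplication by [ln n] it is bounded, uniformly in [n], by a power of the
    intermediate denominators that is summable since [beta] is of intermediate type.  The
    only summands that escape are those where the branch following [beta] sends [1 / k]
    next to [beta]; this happens at the times [n_{k,j}] and contributes a quantity
    comparable to [S_{k,j}]. *)

(** The difficulty is an exchange of limits. As [delta] tends to 0, [vreg] tends to [v] in mass, but
    the error is multiplied by [ln n] before [n] grows, and closeness in mass controls nothing at
    the single point [1 / k]. Membership in the cone turns mass into pointwise information: [x * P1n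
    n f x <= P1n n f 1 <= int f / ln (n + 1)] for every [n >= 1], not only in the limit. A piece
    that leaves the branch of [beta] at level [m] therefore only has to lie below a cone function of
    controlled mass: with [N] steps left it is [O(1 / ln N)], and replacing [ln N] by [ln n] costs a
    factor logarithmic in [m]. The spare [eps] in the intermediate type pays for these logarithms.
    The sum over large [m] is then small uniformly in [n] and [delta], while the finitely many first
    levels, whose pieces stay away from [beta], are made small by the choice of [delta]. From below,
    [vreg <= v] off [beta] suffices, and the summand of [v] along the branch can be kept as a gain;
    at the times [n_{k,j}] this gain produces the excess in the limsup. *)

Fixpoint bsum (f : nat -> R) (n : nat) : R :=
  match n with O => 0 | S m => bsum f m + f m end.

Lemma bsum_ext f g n :
  (forall m, (m < n)%nat -> f m = g m) -> bsum f n = bsum g n.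
Proof.
  induction n as [|n IH]; intros H; simpl; [reflexivity|].
  rewrite IH, H by (intros; try apply H; lia). reflexivity.
Qed.

Lemma bsum_le f g n :
  (forall m, (m < n)%nat -> f m <= g m) -> bsum f n <= bsum g n.
Proof.
  induction n as [|n IH]; intros H; simpl; [lra|].
  apply Rplus_le_compat; [apply IH; intros; apply H; lia | apply H; lia].
Qed.

Lemma bsum_nonneg f n : (forall m, (m < n)%nat -> 0 <= f m) -> 0 <= bsum f n.
Proof.
  induction n as [|n IH]; intros H; simpl; [lra|].
  apply Rplus_le_le_0_compat; [apply IH; intros; apply H; lia | apply H; lia].
Qed.

Lemma bsum_scal c f n : bsum (fun m => c * f m) n = c * bsum f n.
Proof. induction n as [|n IH]; simpl; [|rewrite IH]; ring. Qed.

Lemma bsum_plus f g n : bsum (fun m => f m + g m) n = bsum f n + bsum g n.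
Proof. induction n as [|n IH]; simpl; [|rewrite IH]; ring. Qed.

Lemma bsum_split f N M :
  bsum f (N + M) = bsum f N + bsum (fun m => f (N + m)%nat) M.
Proof.
  induction M as [|M IH]; [rewrite Nat.add_0_r; simpl; ring|].
  rewrite Nat.add_succ_r; simpl. rewrite IH. ring.
Qed.

Lemma bsum_mono_r f N M :
  (forall m, 0 <= f m) -> (N <= M)%nat -> bsum f N <= bsum f M.
Proof.
  intros Hf H. replace M with (N + (M - N))%nat by lia. rewrite bsum_split.
  pose proof (bsum_nonneg (fun m => f (N + m)%nat) (M - N) (fun m _ => Hf _)). lra.
Qed.

(** * The cone of functions with [x * f x] nondecreasing and concave *)

Definition incr01 (u : R -> R) : Prop :=
  forall x y, 0 <= x -> x <= y -> y <= 1 -> u x <= u y.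

Definition concave01 (u : R -> R) : Prop :=
  forall x y t, 0 <= x <= 1 -> 0 <= y <= 1 -> 0 <= t <= 1 ->
    t * u x + (1 - t) * u y <= u (t * x + (1 - t) * y).

Definition cone (f : R -> R) : Prop :=
  incr01 (fun x => x * f x) /\ concave01 (fun x => x * f x).

(** The range [-1 < x] contains a neighbourhood of [[0, 1]], as continuity of [P1 f] at the endpoint
    0 requires. *)
Lemma P1_eq f x : -1 < x -> P1 f x = / (1 + x) ^ 2 * (f (f10 x) + f (f11 x)).
Proof.
  intros Hx. unfold P1. rewrite Rabs_Ropp.
  assert (0 < (1 + x) ^ 2) by (apply pow_lt; lra).
  replace (1 / (1 + x) ^ 2) with (/ (1 + x) ^ 2) by (field; lra).
  rewrite Rabs_right; [ring|].
  apply Rle_ge, Rlt_le, Rinv_0_lt_compat; assumption.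
Qed.

Lemma P1n_S n f x : P1n (S n) f x = P1 (P1n n f) x.
Proof. reflexivity. Qed.

Lemma P1n_S_in n f : P1n (S n) f = P1n n (P1 f).
Proof.
  unfold P1n. induction n as [|n IH]; [reflexivity|].
  simpl in *. rewrite IH. reflexivity.
Qed.

Lemma f10_half x : 0 <= x <= 1 -> 0 <= f10 x <= 1 / 2.
Proof.
  intros Hx. unfold f10. split.
  - apply Rmult_le_pos; [lra|]. apply Rlt_le, Rinv_0_lt_compat; lra.
  - apply Rmult_le_reg_r with (1 + x); [lra|]. field_simplify; lra.
Qed.

Lemma f11_f10 x : 0 <= x -> f11 x = 1 - f10 x.
Proof. intros; unfold f10, f11; field; lra. Qed.

Lemma f10_range x : 0 < x <= 1 -> 0 < f10 x <= 1.
Proof.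
  intros Hx. split; [|pose proof (f10_half x); lra].
  unfold f10. apply Rdiv_lt_0_compat; lra.
Qed.

Lemma f11_range x : 0 < x <= 1 -> 0 < f11 x <= 1.
Proof.
  intros Hx. rewrite f11_f10 by lra. pose proof (f10_half x).
  pose proof (f10_range x). lra.
Qed.

Definition symmetrize (u : R -> R) (s : R) : R := (1 - s) * u s + s * u (1 - s).

(** With [s = f10 x] one has [1 - s = f11 x = 1 / (1 + x)], so the common factor [x / (1 + x)^2] is
    [s (1 - s)], and each branch takes one of the two factors into its [z * f z]. *)
Lemma P1_symmetrize f x : 0 <= x <= 1 ->
  x * P1 f x = symmetrize (fun z => z * f z) (f10 x).
Proof.
  intros Hx. rewrite P1_eq by lra. unfold symmetrize.
  rewrite <- (f11_f10 x) by lra.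
  replace (1 - f10 x) with (f11 x) by (rewrite f11_f10; lra).
  generalize (f (f10 x)) (f (f11 x)); intros A B.
  unfold f10, f11. field. lra.
Qed.

(** For [(1 - s) * u s] the product rule for concavity leaves the cross term
    [t (1 - t) (y - x) (u y - u x)], nonnegative because [u] is nondecreasing. The other summand is
    its reflection in 1/2. *)
Lemma symmetrize_concave u : incr01 u -> concave01 u -> concave01 (symmetrize u).
Proof.
  intros Hi Hc.
  assert (K : concave01 (fun s => (1 - s) * u s)).
  { intros x y t Hx Hy Ht.
    assert (Hm : 0 <= t * (1 - t) * ((y - x) * (u y - u x))).
    { apply Rmult_le_pos; [apply Rmult_le_pos; lra|].
      destruct (Rle_dec x y) as [H|H].
      - apply Rmult_le_pos; [lra|]. pose proof (Hi x y). lra.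
      - replace ((y - x) * (u y - u x)) with ((x - y) * (u x - u y)) by ring.
        apply Rmult_le_pos; [lra|]. pose proof (Hi y x). lra. }
    pose proof (Hc x y t Hx Hy Ht).
    assert (0 <= 1 - (t * x + (1 - t) * y)) by nra.
    apply Rle_trans with ((1 - (t * x + (1 - t) * y)) * (t * u x + (1 - t) * u y)).
    - lra.
    - apply Rmult_le_compat_l; assumption. }
  intros x y t Hx Hy Ht. unfold symmetrize.
  pose proof (K x y t Hx Hy Ht) as K1.
  pose proof (K (1 - x) (1 - y) t ltac:(lra) ltac:(lra) Ht) as K2. simpl in K1, K2.
  replace (t * (1 - x) + (1 - t) * (1 - y)) with (1 - (t * x + (1 - t) * y)) in K2 by ring.
  replace (1 - (1 - (t * x + (1 - t) * y))) with (t * x + (1 - t) * y) in K2 by ring.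
  replace (1 - (1 - x)) with x in K2 by ring.
  replace (1 - (1 - y)) with y in K2 by ring.
  lra.
Qed.

Lemma symmetrize_sym u s : symmetrize u (1 - s) = symmetrize u s.
Proof. unfold symmetrize. replace (1 - (1 - s)) with s by ring. ring. Qed.

(* A concave function symmetric about 1/2 increases up to 1/2. *)
Lemma symmetrize_incr u s s' : incr01 u -> concave01 u ->
  0 <= s -> s <= s' -> s' <= 1 / 2 -> symmetrize u s <= symmetrize u s'.
Proof.
  intros Hi Hc H0 H1 H2.
  destruct (Req_dec s (1 / 2)) as [->|Hne].
  - replace s' with (1 / 2) by lra. lra.
  (* This weight writes [s'] as a convex combination of [s] and [1 - s], where [symmetrize u] takes
     equal values. *)
  - pose proof (symmetrize_concave u Hi Hc s (1 - s) ((1 - s - s') / (1 - 2 * s))) as K.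
    rewrite symmetrize_sym in K.
    replace ((1 - s - s') / (1 - 2 * s) * s + (1 - (1 - s - s') / (1 - 2 * s)) * (1 - s))
      with s' in K by (field; lra).
    enough (0 <= (1 - s - s') / (1 - 2 * s) <= 1).
    { specialize (K ltac:(lra) ltac:(lra) ltac:(lra)). lra. }
    split.
    + apply Rmult_le_pos; [lra|]. apply Rlt_le, Rinv_0_lt_compat; lra.
    + apply Rmult_le_reg_r with (1 - 2 * s); [lra|]. field_simplify; lra.
Qed.

Lemma f10_incr x y : 0 <= x -> x <= y -> f10 x <= f10 y.
Proof.
  intros Hx Hy. unfold f10.
  apply Rmult_le_reg_r with ((1 + x) * (1 + y)); [nra|].
  field_simplify; nra.
Qed.

Lemma f10_concave : concave01 f10.
Proof.
  intros x y t Hx Hy Ht. unfold f10.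
  set (z := t * x + (1 - t) * y). assert (Hz : 0 <= z) by (unfold z; nra).
  assert (E : z / (1 + z) - (t * (x / (1 + x)) + (1 - t) * (y / (1 + y)))
    = t * (1 - t) * (x - y) ^ 2 / ((1 + x) * (1 + y) * (1 + z))).
  { unfold z in *. field. repeat split; lra. }
  enough (0 <= t * (1 - t) * (x - y) ^ 2 / ((1 + x) * (1 + y) * (1 + z))) by lra.
  apply Rmult_le_pos.
  - apply Rmult_le_pos; [nra | apply pow2_ge_0].
  - apply Rlt_le, Rinv_0_lt_compat. repeat apply Rmult_lt_0_compat; lra.
Qed.

(** [symmetrize u] increases only up to 1/2, but [f10] maps [[0, 1]] into [[0, 1 / 2]]; there a
    concave increasing function is composed with the concave increasing [f10]. *)
Lemma cone_P1 f : cone f -> cone (P1 f).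
Proof.
  intros [Hi Hc]. split.
  - intros x y H0 H1 H2. rewrite !P1_symmetrize by lra.
    pose proof (f10_half x). pose proof (f10_half y).
    apply symmetrize_incr; auto; try lra. apply f10_incr; lra.
  - intros x y t Hx Hy Ht.
    assert (0 <= t * x + (1 - t) * y <= 1) by nra.
    rewrite !P1_symmetrize by lra.
    pose proof (f10_half x Hx). pose proof (f10_half y Hy).
    eapply Rle_trans; [apply symmetrize_concave; auto; lra|].
    apply symmetrize_incr; auto; [nra | apply f10_concave; auto|].
    apply f10_half. assumption.
Qed.

Lemma cone_P1n n f : cone f -> cone (P1n n f).
Proof. intros H. induction n; [exact H|]. exact (cone_P1 _ IHn). Qed.

Lemma cone_nonneg f x : cone f -> 0 < x <= 1 -> 0 <= f x.
Proof.
  intros [Hi _] Hx. pose proof (Hi 0 x ltac:(lra) ltac:(lra) ltac:(lra)) as H.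
  simpl in H. nra.
Qed.

Lemma P1n_le n f g :
  (forall x, 0 < x <= 1 -> f x <= g x) ->
  forall x, 0 < x <= 1 -> P1n n f x <= P1n n g x.
Proof.
  intros H. induction n as [|n IH]; [exact H|]. intros x Hx.
  rewrite !P1n_S, !P1_eq by lra.
  apply Rmult_le_compat_l.
  - apply Rlt_le, Rinv_0_lt_compat, pow_lt; lra.
  - apply Rplus_le_compat; apply IH; [apply f10_range|apply f11_range]; auto.
Qed.

Lemma P1n_ext n f g :
  (forall x, 0 < x <= 1 -> f x = g x) ->
  forall x, 0 < x <= 1 -> P1n n f x = P1n n g x.
Proof.
  intros H x Hx. apply Rle_antisym; apply P1n_le; auto; intros; right; auto; symmetry; auto.
Qed.

Lemma P1n_scal n c f x : P1n n (fun z => c * f z) x = c * P1n n f x.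
Proof.
  revert x. induction n as [|n IH]; intros x; [reflexivity|].
  rewrite !P1n_S. unfold P1. rewrite !IH. ring.
Qed.

Lemma P1n_plus n f g x : P1n n (fun z => f z + g z) x = P1n n f x + P1n n g x.
Proof.
  revert x. induction n as [|n IH]; intros x; [reflexivity|].
  rewrite !P1n_S. unfold P1. rewrite !IH. ring.
Qed.

Lemma P1n_minus n f g x : P1n n (fun z => f z - g z) x = P1n n f x - P1n n g x.
Proof.
  revert x. induction n as [|n IH]; intros x; [reflexivity|].
  rewrite !P1n_S. unfold P1. rewrite !IH. ring.
Qed.

(** * Invariance of Lebesgue mass *)

Definition cont01 (f : R -> R) : Prop := forall x, 0 <= x <= 1 -> continuous f x.

Lemma f10_derive x : -1 < x -> is_derive f10 x (/ (1 + x) ^ 2).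
Proof. intros. unfold f10. auto_derive; [lra|]. field. lra. Qed.

Lemma f11_derive x : -1 < x -> is_derive f11 x (- / (1 + x) ^ 2).
Proof. intros. unfold f11. auto_derive; [lra|]. field. lra. Qed.

Lemma inv_sq_cont x : -1 < x -> continuous (fun y => / (1 + y) ^ 2) x.
Proof. intros. apply (ex_derive_continuous (fun y => / (1 + y) ^ 2)). auto_derive.
  apply Rgt_not_eq, Rlt_gt, Rmult_lt_0_compat; lra. Qed.

Lemma cont01_P1 f : cont01 f -> cont01 (P1 f).
Proof.
  intros Hf x Hx.
  assert (C0 : continuous f10 x)
    by (apply (ex_derive_continuous f10); eexists; apply f10_derive; lra).
  assert (C1 : continuous f11 x)
    by (apply (ex_derive_continuous f11); eexists; apply f11_derive; lra).
  pose proof (f10_half x Hx).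
  apply continuous_ext_loc with (fun y => / (1 + y) ^ 2 * (f (f10 y) + f (f11 y))).
  - exists (mkposreal 1 Rlt_0_1). intros y Hy.
    unfold ball in Hy; simpl in Hy; unfold AbsRing_ball, abs, minus, plus, opp in Hy; simpl in Hy.
    apply Rabs_def2 in Hy.
    symmetry. apply P1_eq. lra.
  - apply (continuous_mult (fun y => / (1 + y) ^ 2)).
    + apply inv_sq_cont; lra.
    + apply (continuous_plus (fun y => f (f10 y))); apply continuous_comp; auto.
      * apply Hf. lra.
      * apply Hf. rewrite f11_f10; lra.
Qed.

Lemma cont01_P1n n f : cont01 f -> cont01 (P1n n f).
Proof. intros H. induction n; [exact H|]. exact (cont01_P1 _ IHn). Qed.

Lemma cont01_ex_RInt f a b : cont01 f -> 0 <= a <= 1 -> 0 <= b <= 1 -> ex_RInt f a b.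
Proof.
  intros Hf Ha Hb. apply (ex_RInt_continuous (V := R_CompleteNormedModule)).
  intros z Hz. apply Hf. revert Hz.
  unfold Rmin, Rmax; destruct Rle_dec; lra.
Qed.

Lemma RInt_P1 f a b : cont01 f -> 0 <= a -> a <= b -> b <= 1 ->
  RInt (P1 f) a b = RInt f (f10 a) (f10 b) + RInt f (f11 b) (f11 a).
Proof.
  intros Hf Ha Hab Hb.
  assert (Hz : forall z, Rmin a b <= z <= Rmax a b -> 0 <= z <= 1)
    by (intros z; rewrite Rmin_left, Rmax_right by lra; lra).
  assert (E0 : is_RInt (fun y => scal (/ (1 + y) ^ 2) (f (f10 y))) a b
                       (RInt f (f10 a) (f10 b))).
  { apply (is_RInt_comp f f10 (fun y => / (1 + y) ^ 2)).
    - intros z H. apply Hf. pose proof (f10_half z (Hz z H)). lra.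
    - intros z H. specialize (Hz z H). split; [apply f10_derive | apply inv_sq_cont]; lra. }
  assert (E1 : is_RInt (fun y => scal (- / (1 + y) ^ 2) (f (f11 y))) a b
                       (RInt f (f11 a) (f11 b))).
  { apply (is_RInt_comp f f11 (fun y => - / (1 + y) ^ 2)).
    - intros z H. apply Hf. specialize (Hz z H). pose proof (f10_half z Hz).
      rewrite f11_f10; lra.
    - intros z H. specialize (Hz z H). split; [apply f11_derive; lra|].
      apply (continuous_opp (fun y => / (1 + y) ^ 2)). apply inv_sq_cont; lra. }
  rewrite <- (opp_RInt_swap f (f11 a) (f11 b)).
  2:{ pose proof (f10_half a). pose proof (f10_half b).
      apply cont01_ex_RInt; auto; rewrite f11_f10; lra. }
  apply is_RInt_unique.
  pose proof (is_RInt_minus _ _ _ _ _ _ E0 E1) as E.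
  eapply is_RInt_ext; [|exact E].
  intros z H. rewrite Rmin_left, Rmax_right in H by lra.
  rewrite P1_eq by lra.
  unfold minus, plus, opp, scal; simpl; unfold mult; simpl. ring.
Qed.

(** * Decay at the point 1 through renewal *)

Lemma P1n_S_at_1 n f : P1n (S n) f 1 = 1 / 2 * P1n n f (1 / 2).
Proof.
  rewrite P1n_S, P1_eq by lra.
  replace (f10 1) with (1 / 2) by (unfold f10; field).
  replace (f11 1) with (1 / 2) by (unfold f11; field). field.
Qed.

(** Both inverse branches send 1 to 1/2, so the next value at 1 is [x * P1n n f x] taken at 1/2,
    which monotonicity compares with its value at 1. *)
Lemma cone_at_1_decr n m f : cone f -> (n <= m)%nat -> P1n m f 1 <= P1n n f 1.
Proof.
  intros Hf. induction 1 as [|m H IH]; [lra|].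
  rewrite P1n_S_at_1. destruct (cone_P1n m f Hf) as [Hi _].
  pose proof (Hi (1 / 2) 1 ltac:(lra) ltac:(lra) ltac:(lra)) as K. simpl in K. lra.
Qed.

Lemma cone_upper_half n f x : cone f -> 1 / 2 <= x <= 1 ->
  P1n (S n) f 1 <= x * P1n n f x <= P1n n f 1.
Proof.
  intros Hf Hx. rewrite P1n_S_at_1. destruct (cone_P1n n f Hf) as [Hi _].
  pose proof (Hi (1 / 2) x ltac:(lra) ltac:(lra) ltac:(lra)) as K. simpl in K.
  pose proof (Hi x 1 ltac:(lra) ltac:(lra) ltac:(lra)) as K'. simpl in K'. lra.
Qed.

Lemma cone_le_at_1 n f x : cone f -> 0 < x <= 1 -> x * P1n n f x <= P1n n f 1.
Proof.
  intros Hf Hx. destruct (cone_P1n n f Hf) as [Hi _].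
  pose proof (Hi x 1 ltac:(lra) ltac:(lra) ltac:(lra)) as K'. simpl in K'. lra.
Qed.

Lemma RInt_inv c a : 0 < a <= 1 -> is_RInt (fun x => c / x) a 1 (c * (- ln a)).
Proof.
  intros Ha.
  replace (c * - ln a) with (minus (c * ln 1) (c * ln a))
    by (rewrite ln_1; unfold minus, plus, opp; simpl; ring).
  apply (is_RInt_derive (fun x => c * ln x) (fun x => c / x)).
  - intros x Hx. rewrite Rmin_left, Rmax_right in Hx by lra.
    auto_derive; [lra|]. field. lra.
  - intros x Hx. rewrite Rmin_left, Rmax_right in Hx by lra.
    apply (ex_derive_continuous (fun x => c / x)). auto_derive. lra.
Qed.

(** The preimage of [[0, 1 / i]] under [T1] consists of [[0, 1 / (i + 1)]] and [[i / (i + 1), 1]].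
    The first is of the same kind; the second lies in the upper half, where [cone_upper_half]
    controls the density. *)
Definition low_mass (f : R -> R) (m i : nat) : R := RInt (P1n m f) 0 (/ INR i).
Definition top_mass (f : R -> R) (m i : nat) : R := RInt (P1n m f) (INR i / INR (S i)) 1.

Lemma INR_ge_1 i : (1 <= i)%nat -> 1 <= INR i.
Proof. intros H. apply (le_INR 1). exact H. Qed.

Lemma inv_INR_range i : (1 <= i)%nat -> 0 < / INR i <= 1.
Proof.
  intros H. pose proof (INR_ge_1 i H). split.
  - apply Rinv_0_lt_compat; lra.
  - rewrite <- Rinv_1. apply Rinv_le_contravar; lra.
Qed.

Lemma top_point_range i : (1 <= i)%nat -> 1 / 2 <= INR i / INR (S i) <= 1.
Proof.
  intros H. pose proof (INR_ge_1 i H). rewrite S_INR. split.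
  - apply Rmult_le_reg_r with (INR i + 1); [lra|]. field_simplify; lra.
  - apply Rmult_le_reg_r with (INR i + 1); [lra|]. field_simplify; lra.
Qed.

Lemma low_mass_rec f m i : cont01 f -> (1 <= i)%nat ->
  low_mass f (S m) i = low_mass f m (S i) + top_mass f m i.
Proof.
  intros Hf Hi. unfold low_mass, top_mass.
  pose proof (inv_INR_range i Hi). pose proof (INR_ge_1 i Hi).
  transitivity (RInt (P1 (P1n m f)) 0 (/ INR i)); [reflexivity|].
  rewrite RInt_P1; try lra; [|apply cont01_P1n; assumption].
  f_equal; f_equal; unfold f10, f11; rewrite ?S_INR; field; lra.
Qed.

Lemma low_mass_unfold f n i : cont01 f -> (1 <= i)%nat ->
  low_mass f n i
  = low_mass f 0 (i + n) + bsum (fun m => top_mass f m (i + n - 1 - m)) n.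
Proof.
  intros Hf. revert i. induction n as [|n IH]; intros i Hi.
  - rewrite Nat.add_0_r. simpl. ring.
  - rewrite low_mass_rec, IH by (auto; lia). cbn [bsum].
    replace (S i + n)%nat with (i + S n)%nat by lia.
    replace (i + S n - 1 - n)%nat with i by lia. ring.
Qed.

(** At [i = 1] the two preimages [[0, 1 / 2]] and [[1 / 2, 1]] tile the unit interval, so the
    recursion becomes conservation of mass. *)
Lemma low_mass_total f n : cont01 f -> low_mass f n 1 = RInt f 0 1.
Proof.
  intros Hf. induction n as [|n IH].
  - unfold low_mass. simpl. rewrite Rinv_1. reflexivity.
  - rewrite low_mass_rec, <- IH by auto. unfold low_mass, top_mass.
    replace (INR 1 / INR 2) with (/ INR 2) by (simpl; field).
    pose proof (RInt_Chasles (P1n n f) 0 (/ INR 2) 1) as E.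
    unfold plus in E; simpl in E. simpl. rewrite Rinv_1.
    apply E; apply cont01_ex_RInt; try (apply cont01_P1n; assumption); lra.
Qed.

(** On this interval the density lies between [P1n (S m) f 1 / x] and [P1n m f 1 / x], and [1 / x]
    integrates to the increment of the logarithm. *)
Lemma top_mass_bounds f m i : cone f -> cont01 f -> (1 <= i)%nat ->
  P1n (S m) f 1 * (ln (INR (S i)) - ln (INR i)) <= top_mass f m i
  <= P1n m f 1 * (ln (INR (S i)) - ln (INR i)).
Proof.
  intros Hc Hf Hi. pose proof (INR_ge_1 i Hi). pose proof (top_point_range i Hi) as Hr.
  pose proof (INR_ge_1 (S i) ltac:(lia)).
  unfold top_mass. set (a := INR i / INR (S i)) in *.
  assert (E : ln (INR (S i)) - ln (INR i) = - ln a).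
  { unfold a. unfold Rdiv. rewrite ln_mult, ln_Rinv by (try apply Rinv_0_lt_compat; lra). ring. }
  rewrite E.
  pose proof (cont01_P1n m f Hf) as Hfm.
  split.
  - rewrite <- (is_RInt_unique _ _ _ _ (RInt_inv (P1n (S m) f 1) a ltac:(lra))).
    apply RInt_le; [lra | eexists; apply RInt_inv; lra | apply cont01_ex_RInt; auto; lra |].
    intros x Hx. pose proof (cone_upper_half m f x Hc ltac:(lra)) as K.
    apply Rmult_le_reg_r with x; [lra|]. field_simplify; lra.
  - rewrite <- (is_RInt_unique _ _ _ _ (RInt_inv (P1n m f 1) a ltac:(lra))).
    apply RInt_le; [lra | apply cont01_ex_RInt; auto; lra | eexists; apply RInt_inv; lra |].
    intros x Hx. pose proof (cone_upper_half m f x Hc ltac:(lra)) as K.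
    apply Rmult_le_reg_r with x; [lra|]. field_simplify; lra.
Qed.

Lemma bsum_telescope (g : nat -> R) N n : (N <= n)%nat ->
  bsum (fun m => g (S (n - (N + m))) - g (n - (N + m))%nat) (n - N) = g (S (n - N)) - g 1%nat.
Proof.
  intros H. remember (n - N)%nat as d eqn:Hd. revert N H Hd.
  (* The argument of [g] runs downwards, so the last summand is the one at [e + 1]; the free offset
     [e] absorbs it in the induction on the length. *)
  enough (forall e d, bsum (fun m => g (S (e + d - m)) - g (e + d - m)%nat) d
                    = g (S (e + d)) - g (S e)) as K.
  { intros N H Hd. rewrite <- (K 0%nat d : _ = g (S d) - g 1%nat). apply bsum_ext. intros m Hm.
    replace (n - (N + m))%nat with (0 + d - m)%nat by lia. reflexivity. }
  clear. intros e d. revert e. induction d as [|d IH]; intros e.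
  - simpl. rewrite Nat.add_0_r. ring.
  - cbn [bsum]. replace (e + S d)%nat with (S e + d)%nat by lia. rewrite IH.
    replace (S e + d - d)%nat with (S e) by lia. ring.
Qed.

Lemma low_mass_nonneg f i : cone f -> cont01 f -> (1 <= i)%nat -> 0 <= low_mass f 0 i.
Proof.
  intros Hc Hf Hi. pose proof (inv_INR_range i Hi). unfold low_mass.
  apply RInt_ge_0; [lra | apply cont01_ex_RInt; auto; lra |].
  intros x Hx. apply (cone_nonneg f); auto. lra.
Qed.

Lemma ln_S_step i : (1 <= i)%nat -> 0 <= ln (INR (S i)) - ln (INR i) <= / INR i.
Proof.
  intros Hi. pose proof (INR_ge_1 i Hi). rewrite S_INR. split.
  - pose proof (ln_le (INR i) (INR i + 1) ltac:(lra) ltac:(lra)). lra.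
  - replace (ln (INR i + 1) - ln (INR i)) with (ln (1 + / INR i)).
    + pose proof (exp_ineq1_le (/ INR i)) as K.
      pose proof (inv_INR_range i Hi).
      apply ln_le in K; [|lra]. rewrite ln_exp in K. exact K.
    + rewrite <- ln_div by lra. f_equal. field. lra.
Qed.

(* The renewal identity for the mass, with [P1n m f 1] nonincreasing in [m], gives the
   sharp constant at once. *)
Lemma cone_decay_at_1 f n : cone f -> cont01 f ->
  P1n n f 1 * ln (INR (S n)) <= RInt f 0 1.
Proof.
  intros Hc Hf. rewrite <- (low_mass_total f n Hf), low_mass_unfold by auto.
  pose proof (low_mass_nonneg f (1 + n) Hc Hf ltac:(lia)).
  enough (P1n n f 1 * ln (INR (S n)) <= bsum (fun m => top_mass f m (1 + n - 1 - m)) n) by lra.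
  replace (ln (INR (S n))) with
    (bsum (fun m => ln (INR (S (n - (0 + m)))) - ln (INR (n - (0 + m)))) n).
  2:{ pose proof (bsum_telescope (fun i => ln (INR i)) 0 n ltac:(lia)) as E.
      rewrite Nat.sub_0_r in E. rewrite E. simpl (INR 1). rewrite ln_1. ring. }
  rewrite <- bsum_scal. apply bsum_le. intros m Hm.
  replace (1 + n - 1 - m)%nat with (n - (0 + m))%nat by lia.
  eapply Rle_trans; [|apply top_mass_bounds; auto; lia].
  apply Rmult_le_compat_r; [apply ln_S_step; lia|].
  apply cone_at_1_decr; auto.
Qed.

Lemma P1n_at_1_nonneg f n : cone f -> 0 <= P1n n f 1.
Proof. intros Hc. apply (cone_nonneg (P1n n f)); [apply cone_P1n; assumption | lra]. Qed.

(** The renewal identity is run for [2 N] steps and cut in the middle. For [m >= N] the values at 1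
    are at most the one at time [N], and the logarithmic increments telescope to [ln (N + 1)]. For
    [m < N] the interval index exceeds [N], so each increment is at most [1 / N] and a Cesaro mean
    remains. *)
Lemma cone_growth_at_1 f N : cone f -> cont01 f -> (1 <= N)%nat ->
  RInt f 0 1 <= low_mass f 0 (2 * N + 1) + P1n N f 1 * ln (INR (S N))
              + bsum (fun m => P1n m f 1) N / INR N.
Proof.
  intros Hc Hf HN. rewrite <- (low_mass_total f (2 * N) Hf), low_mass_unfold by auto.
  replace (1 + 2 * N)%nat with (2 * N + 1)%nat by lia.
  rewrite Rplus_assoc. apply Rplus_le_compat_l.
  replace (bsum _ (2 * N)) with (bsum (fun m => top_mass f m (2 * N - m)) (N + N)).
  2:{ replace (N + N)%nat with (2 * N)%nat by lia. apply bsum_ext. intros; f_equal; lia. }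
  rewrite bsum_split, Rplus_comm. apply Rplus_le_compat.
  - replace (ln (INR (S N))) with
      (bsum (fun m => ln (INR (S (2 * N - (N + m)))) - ln (INR (2 * N - (N + m)))) N).
    2:{ pose proof (bsum_telescope (fun i => ln (INR i)) N (2 * N) ltac:(lia)) as E.
        replace (2 * N - N)%nat with N in E by lia. rewrite E. simpl (INR 1).
        rewrite ln_1. ring. }
    rewrite <- bsum_scal. apply bsum_le. intros m Hm.
    eapply Rle_trans; [apply top_mass_bounds; auto; lia|].
    apply Rmult_le_compat_r; [apply ln_S_step; lia|].
    apply cone_at_1_decr; auto; lia.
  - unfold Rdiv. rewrite Rmult_comm, <- bsum_scal. apply bsum_le. intros m Hm.
    eapply Rle_trans; [apply top_mass_bounds; auto; lia|].
    rewrite Rmult_comm. apply Rmult_le_compat_r; [apply P1n_at_1_nonneg; auto|].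
    eapply Rle_trans; [apply ln_S_step; lia|].
    apply Rinv_le_contravar; [pose proof (INR_ge_1 N HN); lra|]. apply le_INR. lia.
Qed.

Lemma is_lim_seq_ln_S : is_lim_seq (fun n => ln (INR (S n))) p_infty.
Proof.
  apply (filterlim_comp _ _ _ (fun n => INR (S n)) ln _ (Rbar_locally p_infty)).
  - apply (is_lim_seq_incr_1 INR). apply is_lim_seq_INR.
  - apply is_lim_ln_p.
Qed.

Lemma is_lim_seq_inv_ln_S c : is_lim_seq (fun n => c / ln (INR (S n))) 0.
Proof.
  apply is_lim_seq_ext with (fun n => c * / ln (INR (S n))); [reflexivity|].
  replace (Finite 0) with (Rbar_mult c 0) by (simpl; f_equal; ring).
  apply is_lim_seq_scal_l. apply (is_lim_seq_inv _ p_infty); [apply is_lim_seq_ln_S | easy].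
Qed.

Lemma is_lim_seq_inv_S c : is_lim_seq (fun n => c / INR (S n)) 0.
Proof.
  apply is_lim_seq_ext with (fun n => c * / INR (S n)); [reflexivity|].
  replace (Finite 0) with (Rbar_mult c 0) by (simpl; f_equal; ring).
  apply is_lim_seq_scal_l. apply (is_lim_seq_inv _ p_infty); [|easy].
  apply (is_lim_seq_incr_1 INR). apply is_lim_seq_INR.
Qed.

Lemma ln_S_pos n : (1 <= n)%nat -> 0 < ln (INR (S n)).
Proof.
  intros H. rewrite <- ln_1. apply ln_increasing; [lra|].
  rewrite S_INR. pose proof (INR_ge_1 n H). lra.
Qed.

Lemma cone_at_1_to_0 f : cone f -> cont01 f -> is_lim_seq (fun n => P1n n f 1) 0.
Proof.
  intros Hc Hf.
  apply is_lim_seq_le_le_loc with (fun _ => 0) (fun n => RInt f 0 1 / ln (INR (S n))).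
  - exists 1%nat. intros n Hn. split; [apply P1n_at_1_nonneg; auto|].
    pose proof (ln_S_pos n Hn). apply Rmult_le_reg_r with (ln (INR (S n))); [lra|].
    pose proof (cone_decay_at_1 f n Hc Hf). field_simplify; lra.
  - apply is_lim_seq_const.
  - apply is_lim_seq_inv_ln_S.
Qed.

Lemma bsum_sum_f_R0 u n : bsum u (S n) = sum_f_R0 u n.
Proof. induction n as [|n IH]; [simpl; ring|]. simpl in *. rewrite IH. reflexivity. Qed.

Lemma cesaro_bsum u (l : R) : is_lim_seq u l -> is_lim_seq (fun n => bsum u (S n) / INR (S n)) l.
Proof.
  intros H. apply is_lim_seq_Reals in H. apply Cesaro_1 in H.
  apply is_lim_seq_Reals in H. apply is_lim_seq_incr_1 in H.
  eapply is_lim_seq_ext; [|exact H]. intros n. simpl pred. rewrite bsum_sum_f_R0. reflexivity.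
Qed.

Lemma cont01_bounded f : cont01 f -> exists M, 0 <= M /\ forall x, 0 <= x <= 1 -> f x <= M.
Proof.
  intros Hf.
  destruct (continuity_ab_maj f 0 1 ltac:(lra)) as [z [Hz _]].
  { intros c Hc. apply continuity_pt_filterlim. exact (Hf c Hc). }
  exists (Rmax 0 (f z)). split; [apply Rmax_l|]. intros x Hx.
  eapply Rle_trans; [apply Hz, Hx | apply Rmax_r].
Qed.

Lemma low_mass_to_0 f : cone f -> cont01 f -> is_lim_seq (fun i => low_mass f 0 (S i)) 0.
Proof.
  intros Hc Hf. destruct (cont01_bounded f Hf) as [M [HM HfM]].
  apply is_lim_seq_le_le with (fun _ => 0) (fun n => M / INR (S n)).
  - intros i. split; [apply low_mass_nonneg; auto; lia|].
    pose proof (inv_INR_range (S i) ltac:(lia)) as Hr. unfold low_mass.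
    replace (M / INR (S i)) with (RInt (fun _ => M) 0 (/ INR (S i))).
    + apply RInt_le; [lra | apply cont01_ex_RInt; auto; lra | apply ex_RInt_const |].
      intros x Hx. apply HfM. lra.
    + rewrite RInt_const. unfold scal; simpl; unfold mult; simpl.
      unfold Rdiv. ring.
  - apply is_lim_seq_const.
  - apply is_lim_seq_inv_S.
Qed.

(** The upper bound is [cone_decay_at_1]. The two losses in the lower bound vanish: one is the
    initial mass near 0, the other the Cesaro mean of a sequence tending to 0. *)
Lemma cone_asymptotic_at_1 f : cone f -> cont01 f ->
  is_lim_seq (fun n => ln (INR (S n)) * P1n n f 1) (RInt f 0 1).
Proof.
  intros Hc Hf. apply is_lim_seq_incr_1.
  set (J := RInt f 0 1).
  apply is_lim_seq_le_le with
    (fun N => J - low_mass f 0 (S (2 * N + 2)) - bsum (fun m => P1n m f 1) (S N) / INR (S N))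
    (fun _ => J).
  - intros N. pose proof (cone_growth_at_1 f (S N) Hc Hf ltac:(lia)) as K.
    pose proof (cone_decay_at_1 f (S N) Hc Hf) as K'. fold J in K, K'.
    replace (2 * S N + 1)%nat with (S (2 * N + 2)) in K by lia. lra.
  - replace (Finite J) with (Rbar_minus (Rbar_minus J 0) 0) by (simpl; f_equal; ring).
    apply is_lim_seq_minus'; [apply is_lim_seq_minus'|].
    + apply is_lim_seq_const.
    + apply (is_lim_seq_subseq (fun i => low_mass f 0 (S i)) 0 (fun N => (2 * N + 2)%nat)).
      * apply eventually_subseq. intros; lia.
      * apply low_mass_to_0; auto.
    + apply cesaro_bsum. apply cone_at_1_to_0; auto.
  - apply is_lim_seq_const.
Qed.

(** * From the point 1 to the unit fractions *)

Lemma log_asymptotic_shift s (J : R) :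
  is_lim_seq (fun n => ln (INR (S n)) * s n) J ->
  is_lim_seq (fun n => ln (INR (S n)) * s (S n)) J.
Proof.
  intros H.
  assert (H0 : is_lim_seq (fun n => J / ln (INR (S n))) 0) by apply is_lim_seq_inv_ln_S.
  assert (Hs : is_lim_seq s 0).
  { replace (Finite 0) with (Rbar_mult J 0) by (simpl; f_equal; ring).
    apply is_lim_seq_ext_loc with (fun n => ln (INR (S n)) * s n * (/ ln (INR (S n)))).
    - exists 1%nat. intros n Hn. pose proof (ln_S_pos n Hn). field. lra.
    - apply is_lim_seq_mult'; auto.
      apply (is_lim_seq_inv _ p_infty); [apply is_lim_seq_ln_S | easy]. }
  apply is_lim_seq_incr_1 in H. apply is_lim_seq_incr_1 in Hs.
  apply is_lim_seq_ext with
    (fun n => ln (INR (S (S n))) * s (S n) - (ln (INR (S (S n))) - ln (INR (S n))) * s (S n)).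
  { intros; ring. }
  replace (Finite J) with (Rbar_minus J (Rbar_mult 0 0)) by (simpl; f_equal; ring).
  apply is_lim_seq_minus'; [exact H|]. apply is_lim_seq_mult'; [|exact Hs].
  apply is_lim_seq_le_le with (fun _ => 0) (fun n => 1 / INR (S n)).
  - intros n. pose proof (ln_S_step (S n) ltac:(lia)). unfold Rdiv. lra.
  - apply is_lim_seq_const.
  - apply is_lim_seq_inv_S.
Qed.

(** The preimages of [1 / j] are [1 / (j + 1)] and [j / (j + 1)]. After normalisation the
    coefficients [j / (j + 1)] and [1 / (j + 1)] add up to 1, so equal limits propagate. *)
Lemma P1n_unit_fraction_rec n f j : (1 <= j)%nat ->
  P1n (S n) f (1 / INR j) / INR j =
    INR j / INR (S j) * (P1n n f (1 / INR (S j)) / INR (S j))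
    + / INR (S j) * (INR j / INR (S j) * P1n n f (INR j / INR (S j))).
Proof.
  intros Hj. pose proof (INR_ge_1 j Hj).
  assert (0 < 1 / INR j) by (apply Rdiv_lt_0_compat; lra).
  rewrite P1n_S, P1_eq by lra.
  replace (f10 (1 / INR j)) with (1 / INR (S j)) by (unfold f10; rewrite S_INR; field; lra).
  replace (f11 (1 / INR j)) with (INR j / INR (S j)) by (unfold f11; rewrite S_INR; field; lra).
  rewrite S_INR. field. lra.
Qed.

(** Induction on [j], solving the recursion for the value at [1 / (j + 1)]: the value at
    [j / (j + 1)], in the upper half, is squeezed between two consecutive values at 1. *)
Lemma cone_asymptotic_unit_fraction f j : cone f -> cont01 f -> (1 <= j)%nat ->
  is_lim_seq (fun n => ln (INR (S n)) * (P1n n f (1 / INR j) / INR j)) (RInt f 0 1).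
Proof.
  intros Hc Hf. set (J := RInt f 0 1 : R).
  pose proof (cone_asymptotic_at_1 f Hc Hf) as H1. fold J in H1.
  destruct j as [|j]; [lia|]. intros _. induction j as [|j IH].
  - eapply is_lim_seq_ext; [|exact H1]. intros n. simpl. f_equal.
    replace (1 / 1) with 1 by field. field.
  - set (i := S j) in *. assert (Hi : (1 <= i)%nat) by (unfold i; lia).
    pose proof (INR_ge_1 i Hi) as Hp. pose proof (S_INR i) as HS.
    pose proof (top_point_range i Hi) as Hr.
    assert (H2 : is_lim_seq
      (fun n => ln (INR (S n)) * (INR i / INR (S i) * P1n n f (INR i / INR (S i)))) J).
    { apply is_lim_seq_le_le with (fun n => ln (INR (S n)) * P1n (S n) f 1)
        (fun n => ln (INR (S n)) * P1n n f 1);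
        [|apply (log_asymptotic_shift (fun n => P1n n f 1)); exact H1 | exact H1].
      intros n. pose proof (cone_upper_half n f _ Hc Hr).
      assert (0 <= ln (INR (S n))).
      { rewrite <- ln_1. apply ln_le; [lra|]. apply INR_ge_1. lia. }
      split; apply Rmult_le_compat_l; lra. }
    apply (log_asymptotic_shift (fun n => P1n n f (1 / INR i) / INR i)) in IH.
    apply is_lim_seq_ext with (fun n =>
      INR (S i) / INR i * (ln (INR (S n)) * (P1n (S n) f (1 / INR i) / INR i))
      - / INR i * (ln (INR (S n)) * (INR i / INR (S i) * P1n n f (INR i / INR (S i))))).
    + intros n. rewrite P1n_unit_fraction_rec by assumption. rewrite HS. field. lra.
    + replace (Finite J) with
        (Finite (INR (S i) / INR i * J - / INR i * J))
        by (f_equal; rewrite HS; field; lra).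
      apply is_lim_seq_minus'; apply is_lim_seq_mult'; auto using is_lim_seq_const.
Qed.

(* [min 1 (A / B) <= (1 + A) / (1 + B)]: both bounds of a cone function in one. *)
Lemma cone_decay_uniform f n x : cone f -> cont01 f -> 0 < x <= 1 -> f 1 <= 1 ->
  P1n n f x <= (1 + RInt f 0 1) / (x * (1 + ln (INR (S n)))).
Proof.
  intros Hc Hf Hx H1.
  assert (0 <= ln (INR (S n))).
  { rewrite <- ln_1. apply ln_le; [lra|]. apply INR_ge_1. lia. }
  pose proof (cone_decay_at_1 f n Hc Hf). pose proof (cone_le_at_1 n f x Hc Hx).
  pose proof (cone_at_1_decr 0 n f Hc ltac:(lia)) as K. change (P1n 0 f 1) with (f 1) in K.
  apply Rmult_le_reg_r with (x * (1 + ln (INR (S n)))); [apply Rmult_lt_0_compat; lra|].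
  set (J := RInt f 0 1 : R) in *.
  replace ((1 + J) / (x * (1 + ln (INR (S n)))) * (x * (1 + ln (INR (S n)))))
    with (1 + J) by (field; lra).
  nra.
Qed.

(** * Derivative criteria and monotonicity of powers *)

Lemma mvt (g g' : R -> R) a b : a <= b ->
  (forall x, a <= x <= b -> is_derive g x (g' x)) ->
  exists c, a <= c <= b /\ g b - g a = g' c * (b - a).
Proof.
  intros Hab Hd.
  destruct (MVT_gen g a b g') as [c [Hc E]].
  - intros x Hx. rewrite Rmin_left, Rmax_right in Hx by lra. apply Hd. lra.
  - intros x Hx. rewrite Rmin_left, Rmax_right in Hx by lra.
    apply continuity_pt_filterlim. apply (ex_derive_continuous g). exists (g' x). apply Hd. lra.
  - rewrite Rmin_left, Rmax_right in Hc by lra. exists c. auto.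
Qed.

Lemma incr01_derive (g g' : R -> R) :
  (forall x, 0 <= x <= 1 -> is_derive g x (g' x)) ->
  (forall x, 0 <= x <= 1 -> 0 <= g' x) -> incr01 g.
Proof.
  intros Hd Hp x y H0 H1 H2.
  destruct (mvt g g' x y H1) as [c [Hc E]]; [intros; apply Hd; lra|].
  pose proof (Hp c ltac:(lra)). nra.
Qed.

Lemma concave01_derive (g g' : R -> R) :
  (forall x, 0 <= x <= 1 -> is_derive g x (g' x)) ->
  (forall x y, 0 <= x -> x <= y -> y <= 1 -> g' y <= g' x) -> concave01 g.
Proof.
  intros Hd Hm.
  assert (K : forall x y t, 0 <= x -> x <= y -> y <= 1 -> 0 <= t <= 1 ->
    t * g x + (1 - t) * g y <= g (t * x + (1 - t) * y)).
  { intros x y t H0 H1 H2 Ht. set (z := t * x + (1 - t) * y).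
    assert (x <= z <= y) by (unfold z; split; nra).
    destruct (mvt g g' x z ltac:(lra)) as [c1 [Hc1 E1]]; [intros; apply Hd; lra|].
    destruct (mvt g g' z y ltac:(lra)) as [c2 [Hc2 E2]]; [intros; apply Hd; lra|].
    pose proof (Hm c1 c2 ltac:(lra) ltac:(lra) ltac:(lra)) as M.
    replace (z - x) with ((1 - t) * (y - x)) in E1 by (unfold z; ring).
    replace (y - z) with (t * (y - x)) in E2 by (unfold z; ring).
    assert (0 <= t * (1 - t) * (y - x) * (g' c1 - g' c2))
      by (repeat apply Rmult_le_pos; lra).
    nra. }
  intros x y t Hx Hy Ht. destruct (Rle_dec x y).
  - apply K; lra.
  - pose proof (K y x (1 - t) ltac:(lra) ltac:(lra) ltac:(lra) ltac:(lra)) as E.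
    replace (1 - (1 - t)) with t in E by ring.
    replace (t * x + (1 - t) * y) with ((1 - t) * y + t * x) by ring. lra.
Qed.

Lemma Rpower_pos x p : 0 < Rpower x p.
Proof. apply exp_pos. Qed.

Lemma Rpower_antitone x y p : 0 < x -> x <= y -> p <= 0 -> Rpower y p <= Rpower x p.
Proof.
  intros Hx Hy Hp. unfold Rpower.
  pose proof (ln_le x y Hx Hy).
  destruct (Rle_lt_or_eq_dec (p * ln y) (p * ln x) ltac:(nra)) as [H'|H'].
  - left. apply exp_increasing. exact H'.
  - rewrite H'. lra.
Qed.

Lemma Rpower_monotone x y p : 0 < x -> x <= y -> 0 <= p -> Rpower x p <= Rpower y p.
Proof. intros. apply Rle_Rpower_l; lra. Qed.

(** * Members of the cone *)

Lemma cone_const : cone (fun _ => 1).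
Proof.
  split.
  - intros x y; lra.
  - intros x y t _ _ _. lra.
Qed.

Lemma cont01_const : cont01 (fun _ => 1).
Proof. intros x _. apply continuous_const. Qed.

Lemma RInt_one : RInt (fun _ => 1) 0 1 = 1.
Proof. rewrite RInt_const. unfold scal; simpl; unfold mult; simpl. ring. Qed.

Lemma const_decay n x : 0 < x <= 1 ->
  P1n n (fun _ => 1) x <= 2 / (x * (1 + ln (INR (S n)))).
Proof.
  intros Hx.
  pose proof (cone_decay_uniform (fun _ => 1) n x cone_const cont01_const Hx (Rle_refl 1)) as H.
  rewrite RInt_one in H. replace (1 + 1) with 2 in H by ring. exact H.
Qed.

(** Majorant for the pieces split off while the orbit is in the upper half. Its mass grows only like
    [- ln c] as [c] tends to 0. *)
Lemma cone_hyperbola c : 0 < c -> cone (fun x => / (x + c)).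
Proof.
  intros Hc.
  assert (D : forall x, 0 <= x <= 1 -> is_derive (fun x => x * / (x + c)) x (c * / (x + c) ^ 2)).
  { intros x Hx. auto_derive; [lra|]. field. lra. }
  assert (P : forall x, 0 <= x <= 1 -> 0 < (x + c) ^ 2) by (intros; apply pow_lt; lra).
  split.
  - apply incr01_derive with (1 := D). intros x Hx.
    apply Rmult_le_pos; [lra|]. apply Rlt_le, Rinv_0_lt_compat, P, Hx.
  - apply concave01_derive with (1 := D). intros x y H0 H1 H2.
    apply Rmult_le_compat_l; [lra|]. apply Rinv_le_contravar; [apply P; lra|].
    apply pow_incr. lra.
Qed.

Lemma cont01_hyperbola c : 0 < c -> cont01 (fun x => / (x + c)).
Proof.
  intros Hc x Hx. apply (ex_derive_continuous (fun x => / (x + c))). auto_derive. lra.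
Qed.

Lemma RInt_hyperbola c : 0 < c -> RInt (fun x => / (x + c)) 0 1 = ln (1 + c) - ln c.
Proof.
  intros Hc. apply is_RInt_unique.
  replace (ln (1 + c) - ln c) with (minus (ln (1 + c)) (ln (0 + c)))
    by (rewrite Rplus_0_l; reflexivity).
  apply (is_RInt_derive (fun x => ln (x + c)) (fun x => / (x + c))).
  - intros x Hx. rewrite Rmin_left, Rmax_right in Hx by lra.
    auto_derive; [lra|]. field. lra.
  - intros x Hx. rewrite Rmin_left, Rmax_right in Hx by lra. apply cont01_hyperbola; auto.
Qed.

Lemma hyperbola_decay c n x : 0 < c <= 1 -> 0 < x <= 1 ->
  P1n n (fun z => / (z + c)) x <= (2 - ln c) / (x * (1 + ln (INR (S n)))).
Proof.
  intros Hc Hx.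
  assert (H1 : / (1 + c) <= 1) by (rewrite <- Rinv_1; apply Rinv_le_contravar; lra).
  pose proof (cone_decay_uniform _ n x (cone_hyperbola c ltac:(lra))
                (cont01_hyperbola c ltac:(lra)) Hx H1) as H.
  rewrite RInt_hyperbola in H by lra.
  assert (0 <= ln (INR (S n))) by (rewrite <- ln_1; apply ln_le; [lra | apply INR_ge_1; lia]).
  eapply Rle_trans; [exact H|]. apply Rmult_le_compat_r.
  - apply Rlt_le, Rinv_0_lt_compat, Rmult_lt_0_compat; lra.
  - pose proof (exp_ineq1_le c) as K. apply ln_le in K; [|lra]. rewrite ln_exp in K. lra.
Qed.

Lemma Rpower_shift_derive e p x : 0 < x + e ->
  is_derive (fun y => Rpower (y + e) p) x (p * Rpower (x + e) (p - 1)).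
Proof.
  intros H. unfold Rpower. auto_derive; [exact H|].
  replace ((p - 1) * ln (x + e)) with (p * ln (x + e) + - ln (x + e)) by ring.
  rewrite exp_plus, exp_Ropp, exp_ln by assumption. field. lra.
Qed.

(** Majorant for the pieces split off while the orbit is in the lower half. The singularity sits at
    [- e], just outside the interval, and since [al < 1] the mass is bounded independently of
    [e]. *)
Lemma cone_shifted_power al e : 0 < al < 1 -> 0 < e -> cone (fun x => Rpower (x + e) (- al)).
Proof.
  intros Ha He.
  assert (D : forall x, 0 <= x <= 1 -> is_derive (fun x => x * Rpower (x + e) (- al)) x
     ((1 - al) * Rpower (x + e) (- al) + al * e * Rpower (x + e) (- al - 1))).
  { intros x Hx.
    pose proof (is_derive_mult (fun x => x) _ x 1 _ (is_derive_id x)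
                  (Rpower_shift_derive e (- al) x ltac:(lra)) (fun a b => Rmult_comm a b)) as E.
    unfold plus, mult in E; simpl in E.
    assert (F : Rpower (x + e) (- al) = (x + e) * Rpower (x + e) (- al - 1)).
    { rewrite <- (Rpower_1 (x + e)) at 2 by lra. rewrite <- Rpower_plus. f_equal; ring. }
    rewrite F in E |- *.
    match type of E with is_derive _ _ ?l =>
      match goal with |- is_derive _ _ ?r => replace r with l by ring end end.
    exact E. }
  split.
  - apply incr01_derive with (1 := D). intros x Hx.
    pose proof (Rpower_pos (x + e) (- al)). pose proof (Rpower_pos (x + e) (- al - 1)).
    apply Rplus_le_le_0_compat; repeat apply Rmult_le_pos; lra.
  - apply concave01_derive with (1 := D). intros x y H0 H1 H2.
    apply Rplus_le_compat; apply Rmult_le_compat_l; try lra; try nra;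
      apply Rpower_antitone; lra.
Qed.

Lemma cont01_shifted_power p e : 0 < e -> cont01 (fun x => Rpower (x + e) p).
Proof.
  intros He x Hx. apply (ex_derive_continuous (fun x => Rpower (x + e) p)).
  eexists. apply Rpower_shift_derive. lra.
Qed.

Lemma RInt_shifted_power al e : 0 < al < 1 -> 0 < e <= 1 ->
  RInt (fun x => Rpower (x + e) (- al)) 0 1 <= 2 / (1 - al).
Proof.
  intros Ha He.
  assert (E : is_RInt (fun x => Rpower (x + e) (- al)) 0 1
     (minus (/ (1 - al) * Rpower (1 + e) (1 - al)) (/ (1 - al) * Rpower (0 + e) (1 - al)))).
  { apply (is_RInt_derive (fun x => / (1 - al) * Rpower (x + e) (1 - al))).
    - intros x Hx. rewrite Rmin_left, Rmax_right in Hx by lra.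
      pose proof (is_derive_scal _ x (/ (1 - al)) _ (Rpower_shift_derive e (1 - al) x ltac:(lra))) as D.
      replace (Rpower (x + e) (- al)) with
        (/ (1 - al) * ((1 - al) * Rpower (x + e) (1 - al - 1))); [exact D|].
      replace (1 - al - 1) with (- al) by ring. field. lra.
    - intros x Hx. rewrite Rmin_left, Rmax_right in Hx by lra.
      apply cont01_shifted_power; lra. }
  rewrite (is_RInt_unique _ _ _ _ E). unfold minus, plus, opp; simpl.
  assert (0 < / (1 - al)) by (apply Rinv_0_lt_compat; lra).
  pose proof (Rpower_pos (0 + e) (1 - al)).
  assert (Rpower (1 + e) (1 - al) <= 2).
  { apply Rle_trans with (Rpower 2 (1 - al)); [apply Rpower_monotone; lra|].
    rewrite <- (Rpower_1 2) at 2 by lra. apply Rle_Rpower; lra. }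
  unfold Rdiv. nra.
Qed.

Lemma shifted_power_decay al e n x : 0 < al < 1 -> 0 < e <= 1 -> 0 < x <= 1 ->
  P1n n (fun z => Rpower (z + e) (- al)) x
  <= (1 + 2 / (1 - al)) / (x * (1 + ln (INR (S n)))).
Proof.
  intros Ha He Hx.
  assert (H1 : Rpower (1 + e) (- al) <= 1).
  { apply Rle_trans with (Rpower (1 + e) 0); [apply Rle_Rpower; lra|].
    rewrite Rpower_O by lra. lra. }
  pose proof (cone_decay_uniform _ n x (cone_shifted_power al e Ha ltac:(lra))
                (cont01_shifted_power (- al) e ltac:(lra)) Hx H1) as H.
  assert (0 <= ln (INR (S n))) by (rewrite <- ln_1; apply ln_le; [lra | apply INR_ge_1; lia]).
  eapply Rle_trans; [exact H|]. apply Rmult_le_compat_r.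
  - apply Rlt_le, Rinv_0_lt_compat, Rmult_lt_0_compat; lra.
  - pose proof (RInt_shifted_power al e Ha He). lra.
Qed.

(** * The regularised singularity *)

Definition vreg (beta alpha delta x : R) : R :=
  Rpower ((x - beta) ^ 2 + delta) (- (alpha / 2)).

Lemma vreg_base_pos b d x : 0 < d -> 0 < (x - b) ^ 2 + d.
Proof. intros. pose proof (pow2_ge_0 (x - b)). lra. Qed.

Lemma quad_power_derive b d p x : 0 < d ->
  is_derive (fun y => Rpower ((y - b) ^ 2 + d) p) x
    (2 * p * (x - b) * Rpower ((x - b) ^ 2 + d) (p - 1)).
Proof.
  intros Hd. pose proof (vreg_base_pos b d x Hd) as Hp.
  unfold Rpower. auto_derive.
  - replace ((x + - b) * ((x + - b) * 1) + d) with ((x - b) ^ 2 + d) by ring. exact Hp.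
  - replace ((p - 1) * ln ((x - b) ^ 2 + d))
      with (p * ln ((x - b) ^ 2 + d) + - ln ((x - b) ^ 2 + d)) by ring.
    rewrite exp_plus, exp_Ropp, exp_ln by assumption.
    replace ((x + - b) * ((x + - b) * 1) + d) with ((x - b) ^ 2 + d) by ring.
    field. lra.
Qed.

Lemma quad_power_continuous b d p x : 0 < d ->
  continuous (fun y => Rpower ((y - b) ^ 2 + d) p) x.
Proof.
  intros Hd. apply (ex_derive_continuous (fun y => Rpower ((y - b) ^ 2 + d) p)).
  eexists. apply quad_power_derive, Hd.
Qed.

(** [x * vreg] is twice continuously differentiable on [[0, 1]]. The correction [x * K (2 - x / 2)]
    has derivative [K (2 - x) >= K] and second derivative [- K], so a large [K] repairs both
    monotonicity and concavity. *)
Lemma vreg_cone b al d : 0 < d ->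
  exists K, 0 <= K /\ cone (fun x => vreg b al d x + K * (2 - x / 2))
                 /\ cone (fun x => K * (2 - x / 2)).
Proof.
  intros Hd. set (p := - (al / 2)).
  set (r := fun s x => Rpower ((x - b) ^ 2 + d) s).
  (* [G1] and [G2] are the first and second derivatives of [x * vreg]. Below, [K1] bounds [- G1] for
     monotonicity and [K2] bounds [G2] for concavity. *)
  set (G1 := fun x => r p x + x * (2 * p * (x - b) * r (p - 1) x)).
  set (G2 := fun x => 2 * p * (x - b) * r (p - 1) x + (2 * p * (2 * x - b) * r (p - 1) x
              + 2 * p * (x * (x - b)) * (2 * (p - 1) * (x - b) * r (p - 1 - 1) x))).
  assert (Dr : forall s x, is_derive (r s) x (2 * s * (x - b) * r (s - 1) x))
    by (intros; apply quad_power_derive, Hd).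
  assert (D1 : forall x, is_derive (fun x => x * vreg b al d x) x (G1 x)).
  { intros x.
    pose proof (is_derive_mult (fun x => x) _ x 1 _ (is_derive_id x)
                  (Dr p x) (fun a b => Rmult_comm a b)) as E.
    unfold plus, mult in E; simpl in E. rewrite Rmult_1_l in E. exact E. }
  assert (D2 : forall x, is_derive G1 x (G2 x)).
  { intros x. unfold G1, G2.
    apply (is_derive_plus (r p) (fun x => x * (2 * p * (x - b) * r (p - 1) x))); [apply Dr|].
    assert (E0 : is_derive (fun x => 2 * p * (x * (x - b))) x (2 * p * (2 * x - b)))
      by (auto_derive; [trivial | ring]).
    pose proof (is_derive_mult _ _ x _ _ E0 (Dr (p - 1) x) (fun a b => Rmult_comm a b)) as E.
    unfold plus, mult in E; simpl in E.
    apply is_derive_ext with (fun x => 2 * p * (x * (x - b)) * r (p - 1) x); [|exact E].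
    intros t. simpl. ring. }
  assert (Cr : forall s x, continuous (r s) x) by (intros; apply quad_power_continuous, Hd).
  assert (Cp : forall (g : R -> R) s, (forall x, ex_derive g x) ->
    forall x, continuous (fun x => g x * r s x) x).
  { intros g s Hg x. apply (continuous_mult g (r s)); [|apply Cr].
    apply (ex_derive_continuous g), Hg. }
  destruct (cont01_bounded (fun x => - G1 x)) as [K1 [HK1 B1]].
  { intros x _. apply (continuous_opp G1). apply (ex_derive_continuous G1).
    eexists; apply D2. }
  destruct (cont01_bounded G2) as [K2 [HK2 B2]].
  { intros x _. unfold G2. apply (continuous_plus (fun x => 2 * p * (x - b) * r (p - 1) x)).
    - apply (Cp (fun x => 2 * p * (x - b))). intros; auto_derive; trivial.
    - apply (continuous_plus (fun x => 2 * p * (2 * x - b) * r (p - 1) x)).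
      + apply (Cp (fun x => 2 * p * (2 * x - b))). intros; auto_derive; trivial.
      + apply continuous_ext with
          (fun x => 2 * p * (x * (x - b)) * (2 * (p - 1) * (x - b)) * r (p - 1 - 1) x).
        { intros t. apply Rmult_assoc. }
        apply (Cp (fun x => 2 * p * (x * (x - b)) * (2 * (p - 1) * (x - b)))).
        intros; auto_derive; trivial. }
  exists (K1 + K2). set (K := K1 + K2). assert (HK : 0 <= K) by (unfold K; lra).
  assert (DE : forall x, is_derive (fun x => x * (K * (2 - x / 2))) x (K * (2 - x)))
    by (intros; auto_derive; [trivial | field]).
  split; [exact HK|]. split; split.
  - apply incr01_derive with (fun x => G1 x + K * (2 - x)).
    + intros x _.
      apply is_derive_ext with (fun x => x * vreg b al d x + x * (K * (2 - x / 2))).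
      { intros t. simpl. ring. }
      apply (is_derive_plus (fun x => x * vreg b al d x)); [apply D1 | apply DE].
    + intros x Hx. pose proof (B1 x Hx). simpl in *. unfold K in *. nra.
  - apply concave01_derive with (fun x => G1 x + K * (2 - x)).
    + intros x _.
      apply is_derive_ext with (fun x => x * vreg b al d x + x * (K * (2 - x / 2))).
      { intros t. simpl. ring. }
      apply (is_derive_plus (fun x => x * vreg b al d x)); [apply D1 | apply DE].
    + intros x y H0 H1 H2.
      destruct (mvt G1 G2 x y H1) as [c [Hc E]]; [intros; apply D2|].
      pose proof (B2 c ltac:(lra)). unfold K. nra.
  - apply incr01_derive with (1 := fun x _ => DE x). intros x Hx. nra.
  - apply concave01_derive with (1 := fun x _ => DE x). intros; nra.
Qed.

Lemma vreg_cont b al d : 0 < d -> cont01 (vreg b al d).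
Proof. intros Hd x _. apply quad_power_continuous, Hd. Qed.

(** The asymptotics of two cone functions are subtracted, so the auxiliary [K (2 - x / 2)]
    disappears from the limit; the last two lines pass from [ln (n + 1)] to [ln n]. *)
Lemma vreg_asymptotic b al d k : 0 < d -> (1 <= k)%nat ->
  is_lim_seq (fun n => ln (INR n) * P1n n (vreg b al d) (1 / INR k))
             (INR k * RInt (vreg b al d) 0 1).
Proof.
  intros Hd Hk. destruct (vreg_cone b al d Hd) as [K [HK [C1 C2]]].
  pose proof (vreg_cont b al d Hd) as Cv.
  assert (Cl : cont01 (fun x => K * (2 - x / 2))).
  { intros x _. apply (ex_derive_continuous (fun x => K * (2 - x / 2))). auto_derive. trivial. }
  assert (Cs : cont01 (fun x => vreg b al d x + K * (2 - x / 2))).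
  { intros x Hx. apply (continuous_plus (vreg b al d)); auto. }
  pose proof (cone_asymptotic_unit_fraction _ k C1 Cs Hk) as L1.
  pose proof (cone_asymptotic_unit_fraction _ k C2 Cl Hk) as L2.
  pose proof (is_lim_seq_minus' _ _ _ _ L1 L2) as L.
  assert (E : RInt (fun x => vreg b al d x + K * (2 - x / 2)) 0 1
    = RInt (vreg b al d) 0 1 + RInt (fun x => K * (2 - x / 2)) 0 1).
  { apply (RInt_plus (vreg b al d)); apply cont01_ex_RInt; auto; lra. }
  rewrite E in L. clear E.
  set (J := RInt (vreg b al d) 0 1 : R) in *.
  set (J' := RInt (fun x => K * (2 - x / 2)) 0 1 : R) in *.
  replace (J + J' - J') with J in L by ring.
  assert (L' : is_lim_seq (fun n => ln (INR (S n)) * P1n n (vreg b al d) (1 / INR k)) (INR k * J)).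
  { apply is_lim_seq_scal_l with (a := INR k) in L. cbn [Rbar_mult Rbar_mult'] in L.
    eapply is_lim_seq_ext; [|exact L]. intros n. cbv beta.
    rewrite (P1n_plus n (vreg b al d) (fun x => K * (2 - x / 2))).
    pose proof (INR_ge_1 k Hk). field. lra. }
  apply is_lim_seq_incr_1.
  exact (log_asymptotic_shift (fun n => P1n n (vreg b al d) (1 / INR k)) _ L').
Qed.

(** * Comparison of [v] with its regularisation *)

Lemma Rpower_sq x p : 0 < x -> Rpower (x ^ 2) p = Rpower x (2 * p).
Proof.
  intros Hx. unfold Rpower. f_equal.
  replace (x ^ 2) with (x * x) by ring. rewrite ln_mult by assumption. ring.
Qed.

Lemma v_as_square b al x : x <> b -> v b al x = Rpower ((x - b) ^ 2) (- (al / 2)).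
Proof.
  intros Hx. unfold v.
  assert (0 < Rabs (b - x)) by (apply Rabs_pos_lt; lra).
  replace (- al) with (2 * - (al / 2)) by field.
  rewrite <- Rpower_sq by assumption. f_equal.
  rewrite pow2_abs. ring.
Qed.

Lemma sq_pos x b : x <> b -> 0 < (x - b) ^ 2.
Proof. intros H. assert (x - b <> 0) by lra. nra. Qed.

Lemma vreg_pos b al d x : 0 < vreg b al d x.
Proof. apply Rpower_pos. Qed.

(** At [x = b] this fails for [d < 1]: [Rpower] with base 0 returns 1, while [vreg] exceeds 1. Hence
    the point [b] is excluded in the comparisons along branches. *)
Lemma vreg_le_v b al d x : 0 < al -> 0 < d -> x <> b -> vreg b al d x <= v b al x.
Proof.
  intros Ha Hd Hx. rewrite v_as_square by assumption. unfold vreg.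
  pose proof (sq_pos x b Hx). apply Rpower_antitone; lra.
Qed.

Lemma vreg_le_sup b al d x : 0 < al -> 0 < d -> vreg b al d x <= Rpower d (- (al / 2)).
Proof.
  intros Ha Hd. unfold vreg. pose proof (pow2_ge_0 (x - b)). apply Rpower_antitone; lra.
Qed.

(** With [s = (x - b)^2], the quotient [vreg / v] is [(1 + d / s)^(- al / 2) >= 1 - d / s]. The
    error is linear in [d], at the price of two more powers in the singularity. *)
Lemma v_le_vreg b al d x : 0 < al < 1 -> 0 < d -> x <> b ->
  v b al x <= vreg b al d x + d * v b (al + 2) x.
Proof.
  intros Ha Hd Hx. rewrite !v_as_square by assumption. unfold vreg.
  pose proof (sq_pos x b Hx) as Hp. set (s := (x - b) ^ 2) in *.
  assert (Hr : 0 < d / s) by (apply Rdiv_lt_0_compat; lra).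
  replace (s + d) with (s * (1 + d / s)) by (field; lra).
  rewrite <- Rpower_mult_distr by lra.
  replace (- ((al + 2) / 2)) with (- (al / 2) + Ropp 1) by field.
  rewrite Rpower_plus, (Rpower_Ropp s 1), Rpower_1 by lra.
  pose proof (Rpower_pos s (- (al / 2))).
  assert (1 - d / s <= Rpower (1 + d / s) (- (al / 2))).
  { unfold Rpower.
    pose proof (exp_ineq1_le (- (al / 2) * ln (1 + d / s))).
    pose proof (exp_ineq1_le (d / s)) as K. apply ln_le in K; [|lra]. rewrite ln_exp in K.
    assert (0 <= ln (1 + d / s)) by (rewrite <- ln_1; apply ln_le; lra). nra. }
  replace (d * (Rpower s (- (al / 2)) * / s)) with (Rpower s (- (al / 2)) * (d / s))
    by (unfold Rdiv; ring).
  nra.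
Qed.

Lemma RInt_vreg_split b al d eps : 0 < d -> 0 < eps -> eps < b -> b + eps < 1 ->
  RInt (vreg b al d) 0 1 = RInt (vreg b al d) 0 (b - eps)
    + RInt (vreg b al d) (b - eps) (b + eps) + RInt (vreg b al d) (b + eps) 1.
Proof.
  intros Hd He H0 H1. pose proof (vreg_cont b al d Hd) as C.
  pose proof (RInt_Chasles (vreg b al d) 0 (b - eps) 1) as E1.
  pose proof (RInt_Chasles (vreg b al d) (b - eps) (b + eps) 1) as E2.
  unfold plus in E1, E2; simpl in E1, E2.
  rewrite <- E1, <- E2 by (apply cont01_ex_RInt; auto; lra). symmetry. apply Rplus_assoc.
Qed.

Lemma RInt_vreg_le al b I d : 0 < al < 1 -> 0 < b < 1 -> 0 < d ->
  improper_int01 (v b al) b I -> RInt (vreg b al d) 0 1 <= I.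
Proof.
  intros Ha Hb Hd HI. pose proof (vreg_cont b al d Hd) as C.
  apply le_epsilon. intros e He.
  destruct (HI (e / 2) ltac:(lra)) as [d0 [Hd0 H]].
  set (M := Rpower d (- (al / 2))). assert (HM : 0 < M) by apply Rpower_pos.
  (* The last entry keeps the window of length [2 eps], where only [vreg <= M] is available, below
     [e / 2]; the other half of [e] goes to the improper integral. *)
  set (eps := Rmin (d0 / 2) (Rmin (b / 2) (Rmin ((1 - b) / 2) (e / (4 * M))))).
  assert (HeM : 0 < e / (4 * M)) by (apply Rdiv_lt_0_compat; lra).
  assert (Heps : 0 < eps) by (unfold eps; repeat apply Rmin_glb_lt; lra).
  assert (eps <= d0 / 2) by apply Rmin_l.
  assert (eps <= b / 2) by (eapply Rle_trans; [apply Rmin_r|]; apply Rmin_l).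
  assert (eps <= (1 - b) / 2)
    by (eapply Rle_trans; [apply Rmin_r|]; eapply Rle_trans; [apply Rmin_r|]; apply Rmin_l).
  assert (eps <= e / (4 * M))
    by (eapply Rle_trans; [apply Rmin_r|]; eapply Rle_trans; [apply Rmin_r|]; apply Rmin_r).
  destruct (H eps ltac:(lra)) as [pr1 [pr2 Hpr]].
  rewrite <- !RInt_Reals in Hpr. apply Rabs_def2 in Hpr.
  assert (X1 : RInt (vreg b al d) 0 (b - eps) <= RInt (v b al) 0 (b - eps)).
  { apply RInt_le; [lra | apply cont01_ex_RInt; auto; lra | apply ex_RInt_Reals_1; auto |].
    intros x Hx. apply vreg_le_v; lra. }
  assert (X2 : RInt (vreg b al d) (b + eps) 1 <= RInt (v b al) (b + eps) 1).
  { apply RInt_le; [lra | apply cont01_ex_RInt; auto; lra | apply ex_RInt_Reals_1; auto |].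
    intros x Hx. apply vreg_le_v; lra. }
  assert (X3 : RInt (vreg b al d) (b - eps) (b + eps) <= RInt (fun _ => M) (b - eps) (b + eps)).
  { apply RInt_le; [lra | apply cont01_ex_RInt; auto; lra | apply ex_RInt_const |].
    intros x Hx. apply vreg_le_sup; lra. }
  rewrite RInt_const in X3. unfold scal in X3; simpl in X3; unfold mult in X3; simpl in X3.
  assert (eps * M <= e / 4).
  { apply Rle_trans with (e / (4 * M) * M); [apply Rmult_le_compat_r; lra|].
    right; field; lra. }
  rewrite (RInt_vreg_split b al d eps) by lra. lra.
Qed.

(** The window around [b] is fixed first; outside it the error in [v_le_vreg] is at most [d * M]
    with [M = eps^(- (al + 2))], and [d] is chosen afterwards. The mass of [vreg] inside the window
    is nonnegative and is dropped. *)
Lemma RInt_vreg_ge al b I e : 0 < al < 1 -> 0 < b < 1 -> 0 < e ->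
  improper_int01 (v b al) b I ->
  exists d0, 0 < d0 /\ forall d, 0 < d <= d0 -> I - e <= RInt (vreg b al d) 0 1.
Proof.
  intros Ha Hb He HI.
  destruct (HI (e / 2) ltac:(lra)) as [d1 [Hd1 H]].
  set (eps := Rmin (d1 / 2) (Rmin (b / 2) ((1 - b) / 2))).
  assert (Heps : 0 < eps) by (unfold eps; repeat apply Rmin_glb_lt; lra).
  assert (eps <= d1 / 2) by apply Rmin_l.
  assert (eps <= b / 2) by (eapply Rle_trans; [apply Rmin_r|]; apply Rmin_l).
  assert (eps <= (1 - b) / 2) by (eapply Rle_trans; [apply Rmin_r|]; apply Rmin_r).
  destruct (H eps ltac:(lra)) as [pr1 [pr2 Hpr]].
  rewrite <- !RInt_Reals in Hpr. apply Rabs_def2 in Hpr.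
  set (M := Rpower eps (- (al + 2))). assert (HM : 0 < M) by apply Rpower_pos.
  exists (e / (2 * M)). split; [apply Rdiv_lt_0_compat; lra|].
  intros d Hd. pose proof (vreg_cont b al d ltac:(lra)) as C.
  assert (HdM : d * M <= e / 2).
  { apply Rle_trans with (e / (2 * M) * M); [apply Rmult_le_compat_r; lra|].
    right; field; lra. }
  assert (B : forall x, eps <= Rabs (b - x) -> v b al x <= vreg b al d x + d * M).
  { intros x Hx. assert (x <> b).
    { intros ->. rewrite Rminus_diag_eq, Rabs_R0 in Hx by reflexivity. lra. }
    eapply Rle_trans; [apply (v_le_vreg b al d x); lra|].
    apply Rplus_le_compat_l, Rmult_le_compat_l; [lra|].
    unfold v, M. apply Rpower_antitone; lra. }
  assert (Int : forall u w, 0 <= u -> u <= w -> w <= 1 ->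
    (forall x, u < x < w -> eps <= Rabs (b - x)) -> ex_RInt (v b al) u w ->
    RInt (v b al) u w <= RInt (vreg b al d) u w + d * M * (w - u)).
  { intros u w Hu Huw Hw Hx Hex.
    assert (Ev : ex_RInt (vreg b al d) u w) by (apply cont01_ex_RInt; auto; lra).
    assert (Ec : ex_RInt (fun _ : R => d * M) u w) by apply ex_RInt_const.
    pose proof (RInt_plus (vreg b al d) (fun _ => d * M) u w Ev Ec) as E.
    rewrite RInt_const in E.
    unfold plus, scal in E; simpl in E; unfold mult in E; simpl in E.
    rewrite (Rmult_comm (d * M)), <- E.
    apply RInt_le; auto. apply (ex_RInt_plus (vreg b al d) (fun _ => d * M)); auto. }
  assert (X1 := Int 0 (b - eps) ltac:(lra) ltac:(lra) ltac:(lra)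
     ltac:(intros; rewrite Rabs_right; lra) (ex_RInt_Reals_1 _ _ _ pr1)).
  assert (X2 := Int (b + eps) 1 ltac:(lra) ltac:(lra) ltac:(lra)
     ltac:(intros; rewrite Rabs_left; lra) (ex_RInt_Reals_1 _ _ _ pr2)).
  assert (X3 : 0 <= RInt (vreg b al d) (b - eps) (b + eps)).
  { apply RInt_ge_0; [lra | apply cont01_ex_RInt; auto; lra |].
    intros x _. apply Rlt_le, vreg_pos. }
  rewrite (RInt_vreg_split b al d eps) by lra.
  assert (0 <= d * M) by nra. nra.
Qed.

(** * The Farey orbit of [beta] and its cylinders *)

(** Phrased as an integer relation so that it passes through the fractional linear maps [T1] and
    [1 / z - n] by rewriting the integers alone. *)
Definition irr (z : R) : Prop := forall p r : Z, z * IZR r = IZR p -> r = 0%Z.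

Lemma irr_of_not_fraction b :
  (forall (p : Z) (r : nat), (0 < r)%nat -> b <> IZR p / INR r) -> irr b.
Proof.
  intros H.
  assert (K : forall p r, (0 < r)%Z -> b * IZR r = IZR p -> False).
  { intros p r Hr E. apply (H p (Z.to_nat r)); [lia|].
    rewrite INR_IZR_INZ, Z2Nat.id by lia. rewrite <- E. field.
    apply not_0_IZR. lia. }
  intros p r E. destruct (Z_lt_le_dec 0 r) as [Hr|Hr]; [exfalso; eauto|].
  destruct (Z_lt_le_dec r 0) as [Hr'|Hr']; [|lia].
  exfalso. apply (K (- p)%Z (- r)%Z); [lia|]. rewrite !opp_IZR. nra.
Qed.

Lemma irr_neq z p r : irr z -> (r <> 0)%Z -> z <> IZR p / IZR r.
Proof.
  intros H Hr E. apply Hr, (H p). rewrite E. field. apply not_0_IZR, Hr.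
Qed.

Lemma irr_half z : irr z -> z <> 1 / 2.
Proof. intros H. apply (irr_neq z 1 2 H). lia. Qed.

Lemma irr_unit z k : irr z -> (1 <= k)%nat -> z <> 1 / INR k.
Proof. intros H Hk. rewrite INR_IZR_INZ. apply (irr_neq z 1 (Z.of_nat k) H). lia. Qed.

Definition orbit (beta : R) (m : nat) : R := Nat.iter m T1 beta.

Lemma T1_irr y : 0 < y < 1 -> irr y -> 0 < T1 y < 1 /\ irr (T1 y).
Proof.
  intros Hy Hi. pose proof (irr_half y Hi). unfold T1. destruct Rle_dec as [Hl|Hl].
  - split.
    + split; [apply Rdiv_lt_0_compat; lra|].
      apply Rmult_lt_reg_r with (1 - y); [lra|]. field_simplify; lra.
    + intros p r E.
      assert (E' : y * IZR (p + r) = IZR p).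
      { rewrite plus_IZR, <- E. field. lra. }
      pose proof (Hi _ _ E') as Z. rewrite Z, Rmult_0_r in E'.
      apply (eq_IZR 0) in E'. lia.
  - split.
    + split; [apply Rdiv_lt_0_compat; lra|].
      apply Rmult_lt_reg_r with y; [lra|]. field_simplify; lra.
    + intros p r E.
      assert (E' : y * IZR (p + r) = IZR r).
      { rewrite plus_IZR, <- E. field. lra. }
      pose proof (Hi _ _ E') as Z. rewrite Z, Rmult_0_r in E'.
      apply (eq_IZR 0) in E'. lia.
Qed.

Lemma orbit_irr b m : 0 < b < 1 -> irr b -> 0 < orbit b m < 1 /\ irr (orbit b m).
Proof.
  intros Hb Hi. induction m as [|m IH]; [split; assumption|].
  apply (T1_irr (orbit b m)); apply IH.
Qed.

(** The inverse branch whose range contains [y], so that [near y (T1 y) = y] on [(0, 1]]; [far] is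
    the other branch. *)
Definition near (y x : R) : R := if Rle_dec y (1 / 2) then f10 x else f11 x.
Definition far (y x : R) : R := if Rle_dec y (1 / 2) then f11 x else f10 x.

(* [along b w m] is the summand of [P1n m w] for the inverse branch of [T1^m] sending
   [orbit b m] to [b]; [aside b w m] is the one for its sibling at level [m + 1]. *)
Fixpoint along (b : R) (w : R -> R) (m : nat) : R -> R :=
  match m with
  | O => w
  | S m' => fun x => / (1 + x) ^ 2 * along b w m' (near (orbit b m') x)
  end.
Definition aside (b : R) (w : R -> R) (m : nat) (x : R) : R :=
  / (1 + x) ^ 2 * along b w m (far (orbit b m) x).

Lemma P1_along b w m x : 0 < x -> P1 (along b w m) x = along b w (S m) x + aside b w m x.
Proof.
  intros Hx. rewrite P1_eq by lra. unfold aside. cbn [along].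
  unfold near, far. destruct Rle_dec; ring.
Qed.

(** One application of [P1] carries the branch summand to the next level and splits off its sibling,
    which the full operator then transports for the steps left. The starting level is free because
    the induction peels the innermost application. *)
Lemma P1n_along b w N : forall m x, 0 < x <= 1 ->
  P1n N (along b w m) x
  = along b w (m + N) x + bsum (fun i => P1n (N - 1 - i) (aside b w (m + i)) x) N.
Proof.
  induction N as [|N IH]; intros m x Hx.
  - rewrite Nat.add_0_r. unfold P1n. simpl. ring.
  - rewrite P1n_S_in.
    rewrite (P1n_ext N _ (fun x => along b w (S m) x + aside b w m x))
      by (auto; intros; apply P1_along; lra).
    rewrite (P1n_plus N (along b w (S m)) (aside b w m)), IH by assumption.
    pose proof (bsum_split (fun i => P1n (S N - 1 - i) (aside b w (m + i)) x) 1 N) as E.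
    change (1 + N)%nat with (S N) in E. rewrite E. cbn [bsum]. clear E.
    replace (m + S N)%nat with (S m + N)%nat by lia.
    rewrite Nat.add_0_r.
    rewrite (bsum_ext (fun i => P1n (S N - 1 - (1 + i)) (aside b w (m + (1 + i))) x)
                      (fun i => P1n (N - 1 - i) (aside b w (S m + i)) x)).
    + replace (S N - 1 - 0)%nat with N by lia. ring.
    + intros i Hi. replace (m + (1 + i))%nat with (S m + i)%nat by lia.
      replace (S N - 1 - (1 + i))%nat with (N - 1 - i)%nat by lia. reflexivity.
Qed.

Lemma P1n_decomposition b w n x : 0 < x <= 1 ->
  P1n n w x = along b w n x + bsum (fun m => P1n (n - 1 - m) (aside b w m) x) n.
Proof. intros Hx. exact (P1n_along b w n 0 x Hx). Qed.

Lemma near_range y x : 0 < x <= 1 -> 0 < near y x <= 1.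
Proof. intros Hx. unfold near. destruct Rle_dec; [apply f10_range | apply f11_range]; auto. Qed.

Lemma far_range y x : 0 < x <= 1 -> 0 < far y x <= 1.
Proof. intros Hx. unfold far. destruct Rle_dec; [apply f11_range | apply f10_range]; auto. Qed.

Lemma near_neq y x : 0 < y < 1 -> 0 < x -> x <> T1 y -> near y x <> y.
Proof.
  intros Hy Hx Hne E. apply Hne. unfold near, T1, f10, f11 in *.
  destruct Rle_dec; rewrite <- E; field; lra.
Qed.

Lemma far_neq y x : 0 < y < 1 -> irr y -> 0 < x <= 1 -> far y x <> y.
Proof.
  intros Hy Hi Hx E. pose proof (irr_half y Hi). pose proof (f10_half x ltac:(lra)).
  unfold far in E. destruct Rle_dec; [rewrite f11_f10 in E by lra|]; lra.
Qed.

(** Two summands on the right serve both plain comparison, with [w3] zero, and the splitting of [v]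
    into [vreg] plus an error. The branch sends only [orbit b m] to [b], so avoiding that point
    keeps the argument off the singularity. *)
Lemma along_le b w1 w2 w3 m : 0 < b < 1 -> irr b ->
  (forall z, 0 < z <= 1 -> z <> b -> w1 z <= w2 z + w3 z) ->
  forall x, 0 < x <= 1 -> x <> orbit b m -> along b w1 m x <= along b w2 m x + along b w3 m x.
Proof.
  intros Hb Hi Hw. induction m as [|m IH]; intros x Hx Hne; [apply Hw; auto|].
  cbn [along]. rewrite <- Rmult_plus_distr_l. apply Rmult_le_compat_l.
  - apply Rlt_le, Rinv_0_lt_compat, pow_lt; lra.
  - apply IH; [apply near_range; auto|].
    apply near_neq; [apply orbit_irr; auto | lra | exact Hne].
Qed.

Lemma along_scal b c w m : forall x, along b (fun z => c * w z) m x = c * along b w m x.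
Proof. induction m as [|m IH]; intros x; [reflexivity|]. cbn [along]. rewrite IH. ring. Qed.

Lemma aside_le b w1 w2 w3 m : 0 < b < 1 -> irr b ->
  (forall z, 0 < z <= 1 -> z <> b -> w1 z <= w2 z + w3 z) ->
  forall x, 0 < x <= 1 -> aside b w1 m x <= aside b w2 m x + aside b w3 m x.
Proof.
  intros Hb Hi Hw x Hx. unfold aside.
  rewrite <- Rmult_plus_distr_l. apply Rmult_le_compat_l.
  - apply Rlt_le, Rinv_0_lt_compat, pow_lt; lra.
  - apply along_le; auto; [apply far_range; auto|].
    destruct (orbit_irr b m Hb Hi). apply far_neq; auto.
Qed.

Lemma aside_scal b c w m x : aside b (fun z => c * w z) m x = c * aside b w m x.
Proof. unfold aside. rewrite along_scal. ring. Qed.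

Lemma along_nonneg b w m : (forall z, 0 < z <= 1 -> 0 <= w z) ->
  forall x, 0 < x <= 1 -> 0 <= along b w m x.
Proof.
  intros Hw. induction m as [|m IH]; intros x Hx; [apply Hw; auto|].
  cbn [along]. apply Rmult_le_pos.
  - apply Rlt_le, Rinv_0_lt_compat, pow_lt; lra.
  - apply IH, near_range, Hx.
Qed.

Lemma aside_nonneg b w m x : (forall z, 0 < z <= 1 -> 0 <= w z) ->
  0 < x <= 1 -> 0 <= aside b w m x.
Proof.
  intros Hw Hx. apply Rmult_le_pos.
  - apply Rlt_le, Rinv_0_lt_compat, pow_lt; lra.
  - apply along_nonneg; auto. apply far_range, Hx.
Qed.

(* [x -> 1 / (c x + d) ^ 2] is the derivative of the branch, with [(c, d) = denoms b m]. *)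
Fixpoint denoms (b : R) (m : nat) : R * R :=
  match m with
  | O => (0, 1)
  | S m' => let (c, d) := denoms b m' in
            if Rle_dec (orbit b m') (1 / 2) then (c + d, d) else (d, c + d)
  end.
Definition dc b m := fst (denoms b m).
Definition dd b m := snd (denoms b m).

Lemma denoms_small b m : orbit b m <= 1 / 2 ->
  dc b (S m) = dc b m + dd b m /\ dd b (S m) = dd b m.
Proof.
  intros H. unfold dc, dd. cbn [denoms]. destruct (denoms b m).
  destruct Rle_dec; [split; reflexivity | contradiction].
Qed.

Lemma denoms_large b m : 1 / 2 < orbit b m ->
  dc b (S m) = dd b m /\ dd b (S m) = dc b m + dd b m.
Proof.
  intros H. unfold dc, dd. cbn [denoms]. destruct (denoms b m).
  destruct Rle_dec; [lra | split; reflexivity].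
Qed.

(** In either case the sum of the two denominators grows by [dd b m >= 1]. *)
Lemma denoms_bounds b m : 0 <= dc b m /\ 1 <= dd b m /\ INR (S m) <= dc b m + dd b m.
Proof.
  induction m as [|m IH]; [unfold dc, dd; simpl; lra|].
  rewrite S_INR. destruct (Rle_dec (orbit b m) (1 / 2)) as [H|H].
  - destruct (denoms_small b m H) as [-> ->]. lra.
  - destruct (denoms_large b m ltac:(lra)) as [-> ->]. lra.
Qed.

(** The exponents of [p] add up to [- 2 - (al - 2) + al = 0], those of [s] to [- al + al = 0]. In
    use, [p = 1 + x] is the denominator created at [x] by one more branch, and [s] the one created
    at the orbit point, or 1. *)
Lemma branch_power_cancel al A B E p s : 0 < A -> 0 < B -> 0 < E -> 0 < p -> 0 < s ->
  / p ^ 2 * (Rpower (A / p) (al - 2) * Rpower (B / s) al * Rpower (E / (p * s)) (- al))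
  = Rpower A (al - 2) * Rpower B al * Rpower E (- al).
Proof.
  intros HA HB HE Hp Hs.
  assert (0 < p * s) by (apply Rmult_lt_0_compat; lra).
  replace (/ p ^ 2) with (exp (- (2 * ln p))).
  - unfold Rpower. rewrite !ln_div, ln_mult by assumption. rewrite <- !exp_plus.
    f_equal. ring.
  - rewrite exp_Ropp. f_equal. replace (2 * ln p) with (ln p + ln p) by ring.
    rewrite exp_plus, exp_ln by assumption. ring.
Qed.

Lemma Rabs_div_pos A p : 0 < p -> Rabs (A / p) = Rabs A / p.
Proof.
  intros Hp. unfold Rdiv. rewrite Rabs_mult, (Rabs_right (/ p)); [reflexivity|].
  apply Rle_ge, Rlt_le, Rinv_0_lt_compat, Hp.
Qed.

(** A fractional linear branch [g] with [g' = 1 / (c x + d)^2] satisfies [|g x - g y| = |x - y| /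
    ((c x + d) (c y + d))]. Take [y = orbit b m], for which [g y = b]. No restriction on [al] is
    made: the exponents 0 and [alpha + 2] are used as well. *)
Lemma along_v b al m : 0 < b < 1 -> irr b ->
  forall x, 0 < x <= 1 -> x <> orbit b m ->
  along b (v b al) m x
  = Rpower (dc b m * x + dd b m) (al - 2) * Rpower (dc b m * orbit b m + dd b m) al
    * Rpower (Rabs (x - orbit b m)) (- al).
Proof.
  intros Hb Hi. induction m as [|m IH]; intros x Hx Hne.
  - unfold dc, dd. simpl. rewrite !Rmult_0_l, !Rplus_0_l.
    replace (Rpower 1 (al - 2)) with 1 by (unfold Rpower; rewrite ln_1, Rmult_0_r, exp_0; auto).
    replace (Rpower 1 al) with 1 by (unfold Rpower; rewrite ln_1, Rmult_0_r, exp_0; auto).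
    unfold v, orbit. simpl. rewrite Rabs_minus_sym. ring.
  - destruct (orbit_irr b m Hb Hi) as [Ho Hio].
    destruct (orbit_irr b (S m) Hb Hi) as [Ho' _].
    destruct (denoms_bounds b m) as [Hc [Hd _]].
    cbn [along]. rewrite IH.
    2: apply near_range, Hx.
    2: apply near_neq; [exact Ho | lra | exact Hne].
    set (y' := orbit b (S m)) in *. set (y := orbit b m) in *.
    assert (Ey : y = near y y').
    { change y' with (T1 y). unfold near, T1, f10, f11.
      pose proof (irr_half y Hio). destruct Rle_dec; field; lra. }
    assert (HE : 0 < Rabs (x - y')) by (apply Rabs_pos_lt; lra).
    set (c := dc b m) in *. set (d := dd b m) in *.
    assert (0 <= c * x) by (apply Rmult_le_pos; lra).
    assert (0 <= c * y') by (apply Rmult_le_pos; lra).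
    assert (0 < d * x) by (apply Rmult_lt_0_compat; lra).
    assert (0 < d * y') by (apply Rmult_lt_0_compat; lra).
    assert (0 < (1 + x) * (1 + y')) by (apply Rmult_lt_0_compat; lra).
    destruct (Rle_dec y (1 / 2)) as [Hle|Hgt].
    + destruct (denoms_small b m Hle) as [-> ->]. fold c d.
      etransitivity; [|apply (branch_power_cancel al _ _ _ (1 + x) (1 + y')); lra].
      unfold near in Ey |- *. destruct (Rle_dec y (1 / 2)); [|lra].
      rewrite <- Rabs_div_pos by assumption.
      unfold f10 in *. f_equal; f_equal; [f_equal|]; f_equal.
      * field. lra.
      * rewrite Ey. field. lra.
      * f_equal. rewrite Ey. field. lra.
    + destruct (denoms_large b m ltac:(unfold y in Hgt; lra)) as [-> ->]. fold c d.
      etransitivity; [|apply (branch_power_cancel al _ _ _ (1 + x) (1 + y')); lra].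
      unfold near in Ey |- *. destruct (Rle_dec y (1 / 2)); [lra|].
      rewrite <- Rabs_div_pos by assumption. rewrite (Rabs_minus_sym _ y).
      unfold f11 in *. f_equal; f_equal; [f_equal|]; f_equal.
      * field. lra.
      * rewrite Ey. field. lra.
      * f_equal. rewrite Ey. field. lra.
Qed.

(** With [y = orbit b m], the distance of the sibling point to the orbit factors as [f11 x - y = (1
    - y) (1 - T1 y * x) / (1 + x)], which is small only for [x] near 1 with [T1 y] near 1. *)
Lemma aside_v_small b al m : 0 < b < 1 -> irr b -> orbit b m <= 1 / 2 ->
  forall x, 0 < x <= 1 ->
  aside b (v b al) m x
  = Rpower (dd b m * x + (dc b m + dd b m)) (al - 2)
    * Rpower (dc b m * orbit b m + dd b m) al
    * Rpower ((1 - orbit b m) * (1 - orbit b (S m) * x)) (- al).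
Proof.
  intros Hb Hi Hs x Hx. unfold aside.
  destruct (orbit_irr b m Hb Hi) as [Ho Hio].
  destruct (orbit_irr b (S m) Hb Hi) as [Ho' _].
  destruct (denoms_bounds b m) as [Hc [Hd _]].
  rewrite along_v by (auto using far_range, far_neq).
  change (orbit b (S m)) with (T1 (orbit b m)) in *.
  set (y := orbit b m) in *. set (c := dc b m) in *. set (d := dd b m) in *.
  assert (0 <= c * y) by (apply Rmult_le_pos; lra).
  assert (0 < d * x) by (apply Rmult_lt_0_compat; lra).
  assert (T1 y * x < 1) by nra.
  etransitivity; [|apply (branch_power_cancel al _ _ _ (1 + x) 1); nra].
  unfold far, T1 in *. destruct (Rle_dec y (1 / 2)); [|lra].
  unfold f11. f_equal; f_equal; [f_equal|]; f_equal.
  - field. lra.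
  - field.
  - rewrite Rabs_right.
    + field. lra.
    + apply Rle_ge. replace (1 / (1 + x) - y) with ((1 - y) * (1 - y / (1 - y) * x) / (1 + x))
        by (field; lra).
      apply Rmult_le_pos; [apply Rmult_le_pos; lra|]. apply Rlt_le, Rinv_0_lt_compat; lra.
Qed.

Lemma aside_v_large b al m : 0 < b < 1 -> irr b -> 1 / 2 < orbit b m ->
  forall x, 0 < x <= 1 ->
  aside b (v b al) m x
  = Rpower ((dc b m + dd b m) * x + dd b m) (al - 2)
    * Rpower (dc b m * orbit b m + dd b m) al
    * Rpower (orbit b m * (1 - orbit b (S m) * x)) (- al).
Proof.
  intros Hb Hi Hs x Hx. unfold aside.
  destruct (orbit_irr b m Hb Hi) as [Ho Hio].
  destruct (orbit_irr b (S m) Hb Hi) as [Ho' _].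
  destruct (denoms_bounds b m) as [Hc [Hd _]].
  rewrite along_v by (auto using far_range, far_neq).
  change (orbit b (S m)) with (T1 (orbit b m)) in *.
  set (y := orbit b m) in *. set (c := dc b m) in *. set (d := dd b m) in *.
  assert (0 <= c * y) by (apply Rmult_le_pos; lra).
  assert (0 <= c * x) by (apply Rmult_le_pos; lra).
  assert (0 < d * x) by (apply Rmult_lt_0_compat; lra).
  assert (T1 y * x < 1) by nra.
  etransitivity; [|apply (branch_power_cancel al _ _ _ (1 + x) 1); nra].
  unfold far, T1 in *. destruct (Rle_dec y (1 / 2)); [lra|].
  unfold f10. f_equal; f_equal; [f_equal|]; f_equal.
  - field. lra.
  - field.
  - rewrite Rabs_left1.
    + field. lra.
    + replace (x / (1 + x) - y) with (- (y * (1 - (1 - y) / y * x) / (1 + x)))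
        by (field; lra).
      apply Rge_le, Ropp_0_le_ge_contravar.
      apply Rmult_le_pos; [apply Rmult_le_pos; lra|]. apply Rlt_le, Rinv_0_lt_compat; lra.
Qed.

(** * Continued fraction digits *)

(** Gauss map iterates along the digits: [theta b a n] is [[0; a_(n+1), a_(n+2), ...]], justified by
    [theta_spec]. *)
Fixpoint theta (b : R) (a : nat -> nat) (n : nat) : R :=
  match n with O => b | S n' => / theta b a n' - INR (a (S n')) end.

(** The number of Farey steps consumed by the first [n] digits. *)
Fixpoint ssum (a : nat -> nat) (n : nat) : nat :=
  match n with O => 0%nat | S n' => (ssum a n' + a (S n'))%nat end.

Record cf_expansion (b : R) (a : nat -> nat) : Prop := {
  cf_range : 0 < b < 1;
  cf_irr : irr b;
  cf_digit : forall n, (1 <= n)%nat -> (1 <= a n)%nat;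
  cf_cv : Un_cv (fun m => cf_fin (digits a 1 m)) b }.

Lemma cf_fin_range a s m : (forall n, (s <= n)%nat -> (1 <= a n)%nat) ->
  0 <= cf_fin (digits a s m) <= 1.
Proof.
  revert s. induction m as [|m IH]; intros s Ha; [simpl; lra|].
  change (cf_fin (digits a s (S m))) with (1 / (INR (a s) + cf_fin (digits a (S s) m))).
  specialize (IH (S s) ltac:(intros; apply Ha; lia)).
  pose proof (INR_ge_1 (a s) (Ha s (Nat.le_refl s))).
  split.
  - apply Rlt_le, Rdiv_lt_0_compat; lra.
  - apply Rmult_le_reg_r with (INR (a s) + cf_fin (digits a (S s) m)); [lra|].
    field_simplify; lra.
Qed.

Lemma irr_inv_sub z n : 0 < z -> irr z -> irr (/ z - INR n).
Proof.
  intros Hz Hi p r E. rewrite INR_IZR_INZ in E.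
  assert (E' : z * IZR (p + Z.of_nat n * r) = IZR r).
  { rewrite plus_IZR, mult_IZR, <- E. field. lra. }
  pose proof (Hi _ _ E') as Z. rewrite Z, Rmult_0_r in E'. symmetry. apply eq_IZR. exact E'.
Qed.

(** Inverting and subtracting the leading digit turns convergence of one tail into convergence of
    the next. The limit lies in [[0, 1]], and irrationality excludes the endpoints. *)
Lemma theta_spec b a n : cf_expansion b a ->
  Un_cv (fun m => cf_fin (digits a (S n) m)) (theta b a n)
  /\ 0 < theta b a n < 1 /\ irr (theta b a n).
Proof.
  intros Hcf. induction n as [|n [IHc [IHr IHi]]].
  - destruct Hcf. repeat split; try assumption; apply cf_range0.
  - assert (Hc : Un_cv (fun m => cf_fin (digits a (S (S n)) m)) (theta b a (S n))).
    { apply is_lim_seq_Reals. apply is_lim_seq_Reals in IHc.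
      apply is_lim_seq_ext with (fun m => / cf_fin (digits a (S n) (S m)) - INR (a (S n))).
      - intros m.
        change (cf_fin (digits a (S n) (S m)))
          with (1 / (INR (a (S n)) + cf_fin (digits a (S (S n)) m))).
        pose proof (cf_fin_range a (S (S n)) m ltac:(intros; apply (cf_digit b a Hcf); lia)).
        pose proof (INR_ge_1 (a (S n)) (cf_digit b a Hcf (S n) ltac:(lia))).
        field. lra.
      - change (Finite (theta b a (S n))) with (Finite (/ theta b a n - INR (a (S n)))).
        apply is_lim_seq_minus'; [|apply is_lim_seq_const].
        apply (is_lim_seq_inv _ (theta b a n)).
        + apply (is_lim_seq_incr_1 (fun m => cf_fin (digits a (S n) m))). exact IHc.
        + intros E. apply Rbar_finite_eq in E. lra. }
    assert (Hi : irr (theta b a (S n))).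
    { apply (irr_inv_sub (theta b a n) (a (S n))); [apply IHr | exact IHi]. }
    assert (Hr : 0 <= theta b a (S n) <= 1).
    { apply is_lim_seq_Reals in Hc.
      pose proof (fun m => cf_fin_range a (S (S n)) m
                    ltac:(intros; apply (cf_digit b a Hcf); lia)) as B.
      split.
      - apply (is_lim_seq_le (fun _ => 0) (fun m => cf_fin (digits a (S (S n)) m)) 0 (theta b a (S n)));
          [intros; apply B | apply is_lim_seq_const | exact Hc].
      - apply (is_lim_seq_le (fun m => cf_fin (digits a (S (S n)) m)) (fun _ => 1) (theta b a (S n)) 1);
          [intros; apply B | exact Hc | apply is_lim_seq_const]. }
    pose proof (irr_neq _ 0 1 Hi ltac:(lia)). pose proof (irr_neq _ 1 1 Hi ltac:(lia)).
    split; [exact Hc|]. split; [|exact Hi]. lra.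
Qed.

Lemma theta_range b a n : cf_expansion b a -> 0 < theta b a n < 1.
Proof. intros H. apply (theta_spec b a n H). Qed.

Lemma theta_step b a n : cf_expansion b a ->
  theta b a n = 1 / (INR (a (S n)) + theta b a (S n)).
Proof.
  intros H. pose proof (theta_range b a n H). simpl. field. lra.
Qed.

Lemma theta_bounds b a n : cf_expansion b a ->
  1 / (2 * INR (a (S n))) <= theta b a n <= 1 / INR (a (S n)).
Proof.
  intros H. rewrite theta_step by assumption. pose proof (theta_range b a (S n) H).
  pose proof (INR_ge_1 (a (S n)) (cf_digit b a H (S n) ltac:(lia))).
  split; apply Rmult_le_compat_l; try lra; apply Rinv_le_contravar; lra.
Qed.

(** While the leading digit is at least 2 the orbit is below 1/2, and a Farey step lowers that digit
    by one and adds [q a n] to [dc]. *)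
Lemma orbit_block_aux b a n : cf_expansion b a ->
  orbit b (ssum a n) = theta b a n ->
  dc b (ssum a n) = INR (fst (qpair a n)) -> dd b (ssum a n) = INR (snd (qpair a n)) ->
  forall i, (i < a (S n))%nat ->
  orbit b (ssum a n + i) = 1 / (INR (a (S n) - i) + theta b a (S n))
  /\ dc b (ssum a n + i) = INR (fst (qpair a n)) + INR i * INR (q a n)
  /\ dd b (ssum a n + i) = INR (q a n).
Proof.
  intros Hcf H0 Hc Hd. induction i as [|i IH]; intros Hi.
  - rewrite Nat.add_0_r, Nat.sub_0_r. rewrite H0, Hc, Hd. simpl (INR 0).
    split; [apply theta_step, Hcf|]. split; [ring | reflexivity].
  - destruct (IH ltac:(lia)) as [E1 [E2 E3]]. rewrite Nat.add_succ_r.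
    pose proof (theta_range b a (S n) Hcf) as Ht.
    replace (a (S n) - i)%nat with (S (a (S n) - S i)) in E1 by lia.
    pose proof (INR_ge_1 (a (S n) - S i) ltac:(lia)) as HD.
    rewrite S_INR in E1. set (D := INR (a (S n) - S i)) in *.
    assert (Hs : orbit b (ssum a n + i) <= 1 / 2).
    { rewrite E1. apply Rmult_le_compat_l; [lra|]. apply Rinv_le_contravar; lra. }
    destruct (denoms_small b _ Hs) as [F1 F2].
    rewrite F1, F2, E2, E3, S_INR. split; [|split; ring].
    change (orbit b (S (ssum a n + i))) with (T1 (orbit b (ssum a n + i))).
    unfold T1. destruct Rle_dec; [|contradiction]. rewrite E1. field. lra.
Qed.

Lemma orbit_ssum b a n : cf_expansion b a ->
  orbit b (ssum a n) = theta b a n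
  /\ dc b (ssum a n) = INR (fst (qpair a n)) /\ dd b (ssum a n) = INR (snd (qpair a n)).
Proof.
  intros Hcf. induction n as [|n [I1 [I2 I3]]].
  - unfold dc, dd. simpl. auto.
  - pose proof (cf_digit b a Hcf (S n) ltac:(lia)) as Ha.
    destruct (orbit_block_aux b a n Hcf I1 I2 I3 (a (S n) - 1) ltac:(lia)) as [E1 [E2 E3]].
    replace (a (S n) - (a (S n) - 1))%nat with 1%nat in E1 by lia. simpl (INR 1) in E1.
    pose proof (theta_range b a (S n) Hcf) as Ht.
    cbn [ssum]. replace (ssum a n + a (S n))%nat with (S (ssum a n + (a (S n) - 1))) by lia.
    (* The leading digit has come down to 1: this step uses the other branch, starts the next block
       and shifts the pair of denominators. *)
    assert (Hs : 1 / 2 < orbit b (ssum a n + (a (S n) - 1))).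
    { rewrite E1. apply Rmult_lt_compat_l; [lra|]. apply Rinv_lt_contravar; lra. }
    destruct (denoms_large b _ Hs) as [F1 F2].
    rewrite F1, F2, E2, E3. unfold q. cbn [qpair]. destruct (qpair a n) as [qm1 qm] eqn:Q.
    cbn [fst snd]. split; [|split].
    + match goal with |- orbit b (S ?m) = _ => change (orbit b (S m)) with (T1 (orbit b m)) end.
      unfold T1. destruct Rle_dec; [lra|]. rewrite E1. field. lra.
    + reflexivity.
    + rewrite plus_INR, mult_INR, minus_INR by lia. simpl (INR 1). ring.
Qed.

Lemma orbit_block b a n i : cf_expansion b a -> (i < a (S n))%nat ->
  orbit b (ssum a n + i) = 1 / (INR (a (S n) - i) + theta b a (S n))
  /\ dc b (ssum a n + i) = INR (fst (qpair a n)) + INR i * INR (q a n)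
  /\ dd b (ssum a n + i) = INR (q a n).
Proof.
  intros H Hi. destruct (orbit_ssum b a n H) as [E1 [E2 E3]].
  apply orbit_block_aux; assumption.
Qed.

Lemma block_exists a m : (forall n, (1 <= n)%nat -> (1 <= a n)%nat) ->
  exists n i, (i < a (S n))%nat /\ m = (ssum a n + i)%nat.
Proof.
  intros Ha. induction m as [|m [n [i [Hi E]]]].
  - exists 0%nat, 0%nat. split; [apply Ha; lia | reflexivity].
  - destruct (Nat.eq_dec (S i) (a (S n))) as [F|F].
    + exists (S n), 0%nat. split; [apply Ha; lia|]. cbn [ssum]. lia.
    + exists n, (S i). split; lia.
Qed.

Lemma ssum_ge a n : (forall n, (1 <= n)%nat -> (1 <= a n)%nat) -> (n <= ssum a n)%nat.
Proof.
  intros Ha. induction n as [|n IH]; [simpl; lia|]. cbn [ssum].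
  pose proof (Ha (S n) ltac:(lia)). lia.
Qed.

Lemma ssum_mono a n m : (n <= m)%nat -> (ssum a n <= ssum a m)%nat.
Proof. induction 1; [lia|]. cbn [ssum]. lia. Qed.

Lemma block_index_large a N : exists M, forall n i, (i < a (S n))%nat ->
  (M <= ssum a n + i)%nat -> (N <= n)%nat.
Proof.
  exists (ssum a N). intros n i Hi HM.
  destruct (le_lt_dec N n) as [H|H]; [exact H|].
  pose proof (ssum_mono a (S n) N ltac:(lia)) as K. cbn [ssum] in K. lia.
Qed.

Lemma finite_min (u : nat -> R) m p : (forall i, 0 < u i) ->
  exists e, 0 < e /\ forall i, (i < p)%nat -> e <= u (m + i)%nat.
Proof.
  intros Hu. induction p as [|p [e [He H]]].
  - exists 1. split; [lra|]. intros; lia.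
  - exists (Rmin e (u (m + p)%nat)). split; [apply Rmin_glb_lt; auto|].
    intros i Hi. destruct (Nat.eq_dec i p) as [->|Hne]; [apply Rmin_r|].
    eapply Rle_trans; [apply Rmin_l|]. apply H. lia.
Qed.

Lemma orbit_add b m i : orbit b (m + i) = Nat.iter i T1 (orbit b m).
Proof.
  unfold orbit. rewrite Nat.add_comm. symmetry.
  induction i as [|i IH]; [reflexivity|]. simpl. rewrite IH. reflexivity.
Qed.

(* A repetition would make the orbit eventually periodic, hence bounded away from 0. *)
Lemma orbit_injective b a m1 m2 : cf_expansion b a ->
  (forall M : nat, exists N, forall n, (N <= n)%nat -> (M <= a n)%nat) ->
  orbit b m1 = orbit b m2 -> m1 = m2.
Proof.
  intros Hcf Hinf.
  enough (K : forall m1 m2, (m1 < m2)%nat -> orbit b m1 = orbit b m2 -> False).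
  { intros E. destruct (Nat.lt_total m1 m2) as [H|[H|H]]; auto; exfalso; eauto. }
  clear m1 m2. intros m1 m2 Hlt E.
  assert (Hpos : forall i, 0 < orbit b i).
  { intros i. apply (orbit_irr b i (cf_range b a Hcf) (cf_irr b a Hcf)). }
  destruct (finite_min (orbit b) m1 (m2 - m1) Hpos) as [e [He Hmin]].
  assert (Hall : forall i, e <= orbit b (m1 + i)).
  { intros i. induction i as [i IH] using lt_wf_ind.
    destruct (le_lt_dec (m2 - m1) i) as [H|H]; [|apply Hmin, H].
    replace (m1 + i)%nat with (m2 + (i - (m2 - m1)))%nat by lia.
    rewrite orbit_add, <- E, <- orbit_add. apply IH. lia. }
  destruct (INR_unbounded (/ e)) as [M HM].
  destruct (Hinf M) as [N HN].
  set (n := (N + m1)%nat).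
  pose proof (ssum_ge a n (cf_digit b a Hcf)) as Hn.
  pose proof (Hall (ssum a n - m1)%nat) as B.
  replace (m1 + (ssum a n - m1))%nat with (ssum a n) in B by (unfold n in *; lia).
  destruct (orbit_ssum b a n Hcf) as [-> _] in B.
  pose proof (theta_bounds b a n Hcf) as [_ T].
  assert (INR M <= INR (a (S n))) by (apply le_INR, HN; unfold n; lia).
  assert (0 < / e) by (apply Rinv_0_lt_compat, He).
  assert (1 / INR (a (S n)) < e); [|lra].
  unfold Rdiv. rewrite Rmult_1_l, <- (Rinv_inv e).
  apply Rinv_lt_contravar; [apply Rmult_lt_0_compat; lra | lra].
Qed.

(** The value [[0; k, a_(j+2), ...]] is reached inside the block of [a (S j)] once that digit has
    been lowered to [k]; injectivity of the orbit makes this the only time. *)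
Lemma time_of_digit b a k j n : cf_expansion b a ->
  (forall M : nat, exists N, forall n, (N <= n)%nat -> (M <= a n)%nat) ->
  (1 <= k)%nat -> (k <= a (S j))%nat ->
  Un_cv (fun m => cf_fin (k :: digits a (S (S j)) m)) (Nat.iter n T1 b) ->
  n = (ssum a j + (a (S j) - k))%nat.
Proof.
  intros Hcf Hinf Hk Hka Hcv. apply (orbit_injective b a); auto.
  destruct (orbit_block b a j (a (S j) - k) Hcf ltac:(lia)) as [-> _].
  replace (a (S j) - (a (S j) - k))%nat with k by lia.
  apply (UL_sequence _ _ _ Hcv).
  destruct (theta_spec b a (S j) Hcf) as [T [Tr _]].
  pose proof (INR_ge_1 k Hk).
  apply is_lim_seq_Reals. apply is_lim_seq_Reals in T.
  change (is_lim_seq (fun m => 1 * / (INR k + cf_fin (digits a (S (S j)) m)))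
                     (1 * / (INR k + theta b a (S j)))).
  apply is_lim_seq_mult'; [apply is_lim_seq_const|].
  apply (is_lim_seq_inv _ (INR k + theta b a (S j))).
  - apply is_lim_seq_plus'; [apply is_lim_seq_const | exact T].
  - intros F. apply Rbar_finite_eq in F. lra.
Qed.

(** * Summability of intermediate denominators *)

Definition cf_tail (l : list nat) (x : R) : R := fold_right (fun b x => 1 / (INR b + x)) x l.

Lemma q_ge_1 a m : (forall n, (1 <= n)%nat -> (1 <= a n)%nat) -> (1 <= q a m)%nat.
Proof.
  intros Ha. unfold q. induction m as [|m IHm]; [simpl; lia|].
  cbn [qpair]. destruct (qpair a m) as [u w]. cbn [snd] in *.
  pose proof (Ha (S m) ltac:(lia)). nia.
Qed.

Lemma cf_tail_mobius a m : (forall n, (1 <= n)%nat -> (1 <= a n)%nat) ->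
  exists p0 p1 : Z, forall x, 0 <= x ->
  cf_tail (digits a 1 m) x
  = (IZR p1 + IZR p0 * x) / (INR (q a m) + INR (fst (qpair a m)) * x).
Proof.
  intros Ha. induction m as [|m [p0 [p1 IH]]].
  - exists 1%Z, 0%Z. intros x _. unfold q. simpl. field.
  - exists p1, (p1 * Z.of_nat (a (S m)) + p0)%Z. intros x Hx.
    unfold digits. rewrite seq_S, map_app. unfold cf_tail. rewrite fold_right_app.
    cbn [map fold_right Nat.add].
    pose proof (INR_ge_1 (a (S m)) (Ha (S m) ltac:(lia))) as Hp.
    change (cf_tail (digits a 1 m) (1 / (INR (a (S m)) + x)) =
      (IZR (p1 * Z.of_nat (a (S m)) + p0) + IZR p1 * x)
      / (INR (q a (S m)) + INR (fst (qpair a (S m))) * x)).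
    rewrite IH by (apply Rlt_le, Rdiv_lt_0_compat; lra).
    pose proof (q_ge_1 a m Ha) as Hq.
    rewrite plus_IZR, mult_IZR, <- INR_IZR_INZ. unfold q in *. cbn [qpair].
    destruct (qpair a m) as [u w]. cbn [fst snd] in *.
    rewrite plus_INR, mult_INR. pose proof (INR_ge_1 w Hq). pose proof (pos_INR u).
    field. split; [|lra].
    assert (0 <= INR w * x) by (apply Rmult_le_pos; lra).
    assert (0 < INR (a (S m)) * INR w) by (apply Rmult_lt_0_compat; lra).
    try split; lra.
Qed.

(** The fractional linear form at [1 / j] exhibits the value as a fraction with denominator
    [q_(m-1) + j q_m]; minimality of [t] concludes. *)
Lemma lowest_denom_le a m j t : (forall n, (1 <= n)%nat -> (1 <= a n)%nat) -> (1 <= j)%nat ->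
  is_lowest_denom (cf_fin (digits a 1 m ++ [j])) t ->
  (t <= fst (qpair a m) + j * q a m)%nat.
Proof.
  intros Ha Hj [_ [_ Hmin]].
  destruct (cf_tail_mobius a m Ha) as [p0 [p1 H]].
  pose proof (q_ge_1 a m Ha) as Hq.
  pose proof (INR_ge_1 _ Hq). pose proof (INR_ge_1 j Hj). pose proof (pos_INR (fst (qpair a m))).
  apply Hmin; [nia|]. exists (p1 * Z.of_nat j + p0)%Z.
  unfold cf_fin. rewrite fold_right_app. cbn [fold_right].
  change (cf_tail (digits a 1 m) (1 / (INR j + 0)) =
    IZR (p1 * Z.of_nat j + p0) / INR (fst (qpair a m) + j * q a m)).
  rewrite Rplus_0_r. rewrite H by (apply Rlt_le, Rdiv_lt_0_compat; lra).
  rewrite plus_IZR, mult_IZR, <- INR_IZR_INZ, plus_INR, mult_INR.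
  assert (0 < INR j * INR (q a m)) by (apply Rmult_lt_0_compat; lra).
  field. repeat split; lra.
Qed.

Lemma sum_f_1_bsum f N : (1 <= N)%nat -> sum_f 1 N f = bsum (fun i => f (S i)) N.
Proof.
  intros HN. unfold sum_f. replace N with (S (N - 1)) at 2 by lia.
  rewrite bsum_sum_f_R0. apply sum_eq. intros i _. f_equal. lia.
Qed.

Lemma bsum_blocks a f N :
  bsum f (ssum a N) = bsum (fun n => bsum (fun i => f (ssum a n + i)%nat) (a (S n))) N.
Proof.
  induction N as [|N IH]; [reflexivity|]. cbn [ssum bsum]. rewrite bsum_split, IH. reflexivity.
Qed.

Lemma bsum_le_limit f L :
  (forall n, 0 <= f n) -> Un_cv (fun N => bsum f N) L -> forall N, bsum f N <= L.
Proof.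
  intros Hf Hcv N. apply (growing_ineq (fun N => bsum f N)); [|exact Hcv].
  intros n. cbn [bsum]. pose proof (Hf n). lra.
Qed.

(** Denominator of the branch at [x = 1]. At step [i] of the block of [a (S n)] it equals
    [q_(n-1) + (i + 1) q_n], the intermediate denominator attached to [j = i + 1]. *)
Definition tden (b : R) (m : nat) : R := dc b m + dd b m.

Lemma tden_ge b m : INR (S m) <= tden b m.
Proof. apply denoms_bounds. Qed.

Lemma tden_ge_1 b m : 1 <= tden b m.
Proof. eapply Rle_trans; [|apply tden_ge]. apply INR_ge_1. lia. Qed.

Lemma tden_summable b a al : cf_expansion b a -> 0 < al < 1 -> intermediate_type a al ->
  exists eps B, 0 < eps <= 1 - al
    /\ forall M, bsum (fun m => Rpower (tden b m) (- 2 * (1 - al) + eps)) M <= B.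
Proof.
  intros Hcf Ha [e0 [He0 [t [Ht [L HL]]]]].
  (* The cap keeps the exponent negative, so replacing [t] by the possibly larger [tden] decreases
     the summands. *)
  set (eps := Rmin e0 (1 - al)).
  assert (0 < eps) by (apply Rmin_glb_lt; lra).
  assert (eps <= e0) by apply Rmin_l. assert (eps <= 1 - al) by apply Rmin_r.
  exists eps, L. split; [lra|].
  set (e := - 2 * (1 - al) + e0) in *. set (e' := - 2 * (1 - al) + eps).
  set (g := fun n => sum_f 1 (a n) (fun j => Rpower (INR (t n j)) e)) in *.
  assert (Hdig := cf_digit b a Hcf).
  assert (Eg : forall n, g (S n) = bsum (fun i => Rpower (INR (t (S n) (S i))) e) (a (S n))).
  { intros n. unfold g. apply sum_f_1_bsum. apply Hdig. lia. }
  assert (Hg : forall n, 0 <= g (S n)).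
  { intros n. rewrite Eg. apply bsum_nonneg. intros; apply Rlt_le, Rpower_pos. }
  assert (HL' : Un_cv (fun N => bsum (fun n => g (S n)) N) L).
  { intros d Hd. destruct (HL d Hd) as [N0 HN]. exists (S N0). intros n Hn.
    rewrite <- sum_f_1_bsum by lia. apply HN. lia. }
  intros M. apply Rle_trans with (bsum (fun m => Rpower (tden b m) e') (ssum a M)).
  { apply bsum_mono_r; [intros; apply Rlt_le, Rpower_pos | apply ssum_ge, Hdig]. }
  apply Rle_trans with (bsum (fun n => g (S n)) M); [|apply bsum_le_limit; auto].
  rewrite bsum_blocks. apply bsum_le. intros n Hn. rewrite Eg. apply bsum_le. intros i Hi.
  destruct (orbit_block b a n i Hcf Hi) as [_ [E1 E2]].
  pose proof (Ht (S n) (S i) ltac:(lia) ltac:(lia)) as Hlow.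
  replace (S n - 1)%nat with n in Hlow by lia.
  pose proof (lowest_denom_le a n (S i) _ Hdig ltac:(lia) Hlow) as Hle.
  destruct Hlow as [Hpos _].
  pose proof (INR_ge_1 (t (S n) (S i)) Hpos).
  apply Rle_trans with (Rpower (INR (t (S n) (S i))) e').
  - apply Rpower_antitone; [lra | | unfold e'; lra].
    apply le_INR in Hle. rewrite plus_INR, mult_INR, S_INR in Hle.
    unfold tden. rewrite E1, E2. lra.
  - apply Rle_Rpower; [lra|]. unfold e, e'. lra.
Qed.

Lemma dden_summable b s B : (forall M, bsum (fun m => Rpower (tden b m) s) M <= B) ->
  forall M, bsum (fun m => if Rle_dec (orbit b m) (1 / 2) then 0 else Rpower (dd b m) s) M <= 1 + B.
Proof.
  intros HB M.
  (* [dd] is constant between two visits to the large half, where it is replaced by [tden]. *)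
  enough (K : bsum (fun m => if Rle_dec (orbit b m) (1 / 2) then 0 else Rpower (dd b m) s) M
       + Rpower (dd b M) s <= 1 + bsum (fun m => Rpower (tden b m) s) M).
  { pose proof (Rpower_pos (dd b M) s). specialize (HB M). lra. }
  clear HB. induction M as [|M IH].
  - unfold dd. simpl. unfold Rpower. rewrite ln_1, Rmult_0_r, exp_0. lra.
  - cbn [bsum]. pose proof (Rpower_pos (tden b M) s).
    destruct Rle_dec as [Hs|Hs].
    + destruct (denoms_small b M Hs) as [_ ->]. lra.
    + destruct (denoms_large b M ltac:(lra)) as [_ ->]. fold (tden b M). lra.
Qed.

(** * Uniform bounds on the pieces of the decomposition *)

Lemma ln_INR_0 : ln (INR 0) = 0.
Proof.
  simpl. unfold ln. destruct (Rlt_dec 0 0) as [H|H]; [exfalso; lra | reflexivity].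
Qed.

Lemma ln_nonneg_INR n : 0 <= ln (INR n).
Proof.
  destruct n as [|n].
  - rewrite ln_INR_0. lra.
  - rewrite <- ln_1. apply ln_le; [lra | apply INR_ge_1; lia].
Qed.

(** From [n <= (m + 2) (N + 1)]: the factor [ln n] separates into a part in the level [m] and a part
    cancelled by the decay over the [N] steps left. *)
Lemma ln_time_bound m N n : (n <= m + 2 + N)%nat ->
  ln (INR n) <= (2 + ln (INR (S m))) * (1 + ln (INR (S N))).
Proof.
  intros H. pose proof (ln_nonneg_INR (S m)). pose proof (ln_nonneg_INR (S N)).
  destruct n as [|n].
  - rewrite ln_INR_0. nra.
  - assert (ln (INR (S n)) <= ln (INR (S (S m) * S N))).
    { apply ln_le; [pose proof (INR_ge_1 (S n) ltac:(lia)); lra|]. apply le_INR. nia. }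
    pose proof (INR_ge_1 (S (S m)) ltac:(lia)). pose proof (INR_ge_1 (S N) ltac:(lia)).
    rewrite mult_INR, ln_mult in H2 by lra.
    pose proof (ln_S_step (S m) ltac:(lia)) as K.
    pose proof (inv_INR_range (S m) ltac:(lia)). nra.
Qed.

(** Square of [t^(eps / 2) >= 1 + (eps / 2) ln t]. *)
Lemma ln_sq_bound eps t : 0 < eps -> 1 <= t ->
  (2 + ln t) ^ 2 <= (2 + 2 / eps) ^ 2 * Rpower t eps.
Proof.
  intros He Ht.
  assert (Hl : 0 <= ln t) by (rewrite <- ln_1; apply ln_le; lra).
  assert (Hs : Rpower t eps = Rpower t (eps / 2) ^ 2).
  { replace eps with (eps / 2 + eps / 2) at 1 by field. rewrite Rpower_plus. ring. }
  assert (K : 1 + eps / 2 * ln t <= Rpower t (eps / 2)) by apply exp_ineq1_le.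
  rewrite Hs, <- Rpow_mult_distr. apply pow_incr. split; [lra|].
  assert (0 < 2 / eps) by (apply Rdiv_lt_0_compat; lra).
  apply Rle_trans with ((2 + 2 / eps) * (1 + eps / 2 * ln t)).
  - assert (E : 2 / eps * (eps / 2 * ln t) = ln t) by (field; lra).
    assert (0 <= eps / 2 * ln t) by (apply Rmult_le_pos; lra). nra.
  - apply Rmult_le_compat_l; lra.
Qed.

Lemma Rpower_le_base x y p : 0 < x -> x <= y -> 0 <= p <= 1 -> 1 <= y -> Rpower x p <= y.
Proof.
  intros Hx Hxy Hp Hy. apply Rle_trans with (Rpower y p).
  - apply Rpower_monotone; lra.
  - rewrite <- (Rpower_1 y) at 2 by lra. apply Rle_Rpower; lra.
Qed.

Lemma Rpower_neg_le x y p : 0 < y -> / y <= x -> 0 <= p <= 1 -> 1 <= y -> Rpower x (- p) <= y.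
Proof.
  intros Hy Hx Hp H1.
  assert (0 < / y) by (apply Rinv_0_lt_compat; lra).
  apply Rle_trans with (Rpower (/ y) (- p)); [apply Rpower_antitone; lra|].
  replace (Rpower (/ y) (- p)) with (Rpower y p).
  - apply Rpower_le_base; lra.
  - unfold Rpower. f_equal. rewrite ln_Rinv by lra. ring.
Qed.

Lemma tden_pow b al m : Rpower (tden b m) (al - 2) * Rpower (tden b m) al
  = Rpower (tden b m) (- 2 * (1 - al)).
Proof. rewrite <- Rpower_plus. f_equal. ring. Qed.

Lemma branch_mid_bound b al m : 0 < b < 1 -> irr b -> 0 <= al ->
  0 < dc b m * orbit b m + dd b m /\ Rpower (dc b m * orbit b m + dd b m) al <= Rpower (tden b m) al.
Proof.
  intros Hb Hi Ha. destruct (denoms_bounds b m) as [Hc [Hd _]].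
  destruct (orbit_irr b m Hb Hi) as [Ho _].
  assert (0 <= dc b m * orbit b m) by (apply Rmult_le_pos; lra).
  split; [lra|]. apply Rpower_monotone; [lra| |lra]. unfold tden. nra.
Qed.

Lemma aside_small_bound b al m x : 0 < b < 1 -> irr b -> 0 < al < 1 ->
  orbit b m <= 1 / 2 -> 0 < x <= 1 ->
  aside b (v b al) m x
  <= 2 * Rpower (tden b m) (- 2 * (1 - al)) * Rpower (1 - orbit b (S m) * x) (- al).
Proof.
  intros Hb Hi Ha Hs Hx. rewrite aside_v_small by assumption.
  destruct (denoms_bounds b m) as [Hc [Hd _]].
  destruct (orbit_irr b m Hb Hi) as [Ho _].
  destruct (orbit_irr b (S m) Hb Hi) as [Ho' _].
  assert (Hpos : 0 < 1 - orbit b (S m) * x) by nra.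
  rewrite <- Rpower_mult_distr by lra.
  rewrite <- tden_pow.
  assert (B1 : Rpower (dd b m * x + (dc b m + dd b m)) (al - 2) <= Rpower (tden b m) (al - 2)).
  { pose proof (tden_ge_1 b m). unfold tden in *. apply Rpower_antitone; nra. }
  destruct (branch_mid_bound b al m Hb Hi ltac:(lra)) as [_ B2].
  assert (B3 : Rpower (1 - orbit b m) (- al) <= 2) by (apply Rpower_neg_le; lra).
  pose proof (Rpower_pos (dd b m * x + (dc b m + dd b m)) (al - 2)).
  pose proof (Rpower_pos (dc b m * orbit b m + dd b m) al).
  pose proof (Rpower_pos (1 - orbit b m) (- al)).
  pose proof (Rpower_pos (1 - orbit b (S m) * x) (- al)).
  rewrite <- Rmult_assoc. apply Rmult_le_compat_r; [lra|].
  rewrite (Rmult_comm 2). apply Rmult_le_compat; try lra; [apply Rmult_le_pos; lra|].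
  apply Rmult_le_compat; lra.
Qed.

(** The factor [(x + d / t)^(al - 2)], with [t = tden b m] and [d = dd b m], decays too fast for the
    cone. Lowering it to [1 / (x + d / t)] costs [(d / t)^(al - 1)], whence the power of [dd]. The
    hypothesis on the next orbit point keeps the remaining factor at most [(1 / 4)^(- al) <= 4]. *)
Lemma aside_large_bound b al m x : 0 < b < 1 -> irr b -> 0 < al < 1 ->
  1 / 2 < orbit b m -> orbit b (S m) <= 1 / 2 -> 0 < x <= 1 ->
  aside b (v b al) m x
  <= 4 * (Rpower (tden b m) (al - 1) * Rpower (dd b m) (al - 1)) * / (x + dd b m / tden b m).
Proof.
  intros Hb Hi Ha Hs Hs' Hx. rewrite aside_v_large by assumption.
  destruct (denoms_bounds b m) as [Hc [Hd _]].
  destruct (orbit_irr b m Hb Hi) as [Ho _].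
  destruct (orbit_irr b (S m) Hb Hi) as [Ho' _].
  destruct (branch_mid_bound b al m Hb Hi ltac:(lra)) as [_ B2].
  pose proof (tden_ge_1 b m) as Ht. fold (tden b m). set (t := tden b m) in *.
  set (d := dd b m) in *.
  assert (Hcd : 0 < d / t) by (apply Rdiv_lt_0_compat; lra).
  assert (B3 : Rpower (orbit b m * (1 - orbit b (S m) * x)) (- al) <= 4).
  { assert (1 / 2 <= 1 - orbit b (S m) * x) by nra.
    assert (1 / 2 * (1 / 2) <= orbit b m * (1 - orbit b (S m) * x))
      by (apply Rmult_le_compat; lra).
    apply Rpower_neg_le; lra. }
  assert (E1 : Rpower (t * x + d) (al - 2)
     <= Rpower t (al - 2) * (Rpower (d / t) (al - 1) * / (x + d / t))).
  { replace (t * x + d) with (t * (x + d / t)) by (field; lra).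
    rewrite <- Rpower_mult_distr by lra.
    apply Rmult_le_compat_l; [apply Rlt_le, Rpower_pos|].
    replace (al - 2) with (al - 1 + Ropp 1) by ring.
    rewrite Rpower_plus, (Rpower_Ropp _ 1), Rpower_1 by lra.
    apply Rmult_le_compat_r; [apply Rlt_le, Rinv_0_lt_compat; lra|].
    apply Rpower_antitone; lra. }
  assert (E2 : Rpower t (al - 2) * Rpower t al * Rpower (d / t) (al - 1)
     = Rpower t (al - 1) * Rpower d (al - 1)).
  { unfold Rpower. rewrite ln_div by lra. rewrite <- !exp_plus. f_equal. ring. }
  rewrite <- E2.
  assert (0 < / (x + d / t)) by (apply Rinv_0_lt_compat; lra).
  pose proof (Rpower_pos (t * x + d) (al - 2)).
  pose proof (Rpower_pos (dc b m * orbit b m + d) al).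
  pose proof (Rpower_pos (orbit b m * (1 - orbit b (S m) * x)) (- al)).
  apply Rle_trans with
    (Rpower t (al - 2) * (Rpower (d / t) (al - 1) * / (x + d / t)) * Rpower t al * 4).
  - apply Rmult_le_compat; try lra; [apply Rmult_le_pos; lra|].
    apply Rmult_le_compat; lra.
  - right. ring.
Qed.

(** A near-singularity at 1 is outside the reach of the cone, but one application of [P1] carries it
    to 0: [1 - y * f11 z = (z + 1 - y) / (1 + z)]. The other summand is at most 2 and is absorbed as
    [4 * (1 / 2)], since the right-hand power is at least 1/2. *)
Lemma P1_edge_singularity al y z : 0 < al < 1 -> 0 < y < 1 -> 0 < z <= 1 ->
  P1 (fun x => Rpower (1 - y * x) (- al)) z <= 6 * Rpower (z + (1 - y)) (- al).
Proof.
  intros Ha Hy Hz. rewrite P1_eq by lra.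
  pose proof (f10_half z ltac:(lra)) as H0.
  assert (A1 : Rpower (1 - y * f10 z) (- al) <= 2).
  { assert (1 / 2 <= 1 - y * f10 z) by nra. apply Rpower_neg_le; lra. }
  assert (A2 : 1 / 2 <= Rpower (z + (1 - y)) (- al)).
  { apply Rle_trans with (Rpower 2 (- al)).
    - rewrite Rpower_Ropp. unfold Rdiv. rewrite Rmult_1_l.
      apply Rinv_le_contravar; [apply Rpower_pos|]. apply Rpower_le_base; lra.
    - apply Rpower_antitone; lra. }
  assert (A3 : Rpower (1 - y * f11 z) (- al) <= 2 * Rpower (z + (1 - y)) (- al)).
  { apply Rle_trans with (Rpower (/ 2 * (z + (1 - y))) (- al)).
    - apply Rpower_antitone; try lra. unfold f11.
      replace (1 - y * (1 / (1 + z))) with (/ (1 + z) * (z + (1 - y))) by (field; lra).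
      apply Rmult_le_compat_r; [lra|]. apply Rinv_le_contravar; lra.
    - rewrite <- Rpower_mult_distr by lra. apply Rmult_le_compat_r; [lra|].
      apply Rpower_neg_le; lra. }
  assert (A4 : / (1 + z) ^ 2 <= 1).
  { rewrite <- Rinv_1. apply Rinv_le_contravar; [lra|]. nra. }
  assert (0 < / (1 + z) ^ 2) by (apply Rinv_0_lt_compat, pow_lt; lra).
  pose proof (Rpower_pos (1 - y * f10 z) (- al)). pose proof (Rpower_pos (1 - y * f11 z) (- al)).
  nra.
Qed.

Lemma unit_range k : (1 <= k)%nat -> 0 < 1 / INR k <= 1.
Proof. intros H. pose proof (inv_INR_range k H). unfold Rdiv. lra. Qed.

Lemma P1n_aside_nonneg b w m N x : (forall z, 0 < z <= 1 -> 0 <= w z) -> 0 < x <= 1 ->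
  0 <= P1n N (aside b w m) x.
Proof.
  intros Hw Hx.
  assert (Z : P1n N (fun _ => 0 * 1) x <= P1n N (aside b w m) x).
  { apply P1n_le; [|exact Hx]. intros z Hz. rewrite Rmult_0_l. apply aside_nonneg; auto. }
  rewrite (P1n_scal N 0 (fun _ => 1)) in Z. lra.
Qed.

(** One step is spent on moving the singularity from 1 to 0; the other [N] give the decay of the
    shifted power. *)
Lemma P1n_aside_small b al m N k : 0 < b < 1 -> irr b -> 0 < al < 1 ->
  orbit b m <= 1 / 2 -> (1 <= k)%nat ->
  ln (INR (m + 2 + N)) * P1n (S N) (aside b (v b al) m) (1 / INR k)
  <= 12 * (1 + 2 / (1 - al)) * INR k * Rpower (tden b m) (- 2 * (1 - al)) * (2 + ln (tden b m)).
Proof.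
  intros Hb Hi Ha Hs Hk. pose proof (unit_range k Hk) as Hx.
  pose proof (INR_ge_1 k Hk) as HK.
  destruct (orbit_irr b (S m) Hb Hi) as [Ho' _].
  set (y := orbit b (S m)) in *. set (t := tden b m). set (A := Rpower t (- 2 * (1 - al))).
  assert (HA : 0 < A) by apply Rpower_pos.
  assert (B : P1n (S N) (aside b (v b al) m) (1 / INR k)
     <= 12 * A * P1n N (fun z => Rpower (z + (1 - y)) (- al)) (1 / INR k)).
  { apply Rle_trans with
      (P1n (S N) (fun x => (2 * A) * Rpower (1 - y * x) (- al)) (1 / INR k)).
    - apply P1n_le; [|exact Hx]. intros x Hx'. apply aside_small_bound; auto.
    - rewrite (P1n_scal (S N) (2 * A) (fun x => Rpower (1 - y * x) (- al))).
      rewrite P1n_S_in.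
      replace (12 * A * P1n N (fun z => Rpower (z + (1 - y)) (- al)) (1 / INR k))
        with (2 * A * (6 * P1n N (fun z => Rpower (z + (1 - y)) (- al)) (1 / INR k))) by ring.
      rewrite <- (P1n_scal N 6).
      apply Rmult_le_compat_l; [lra|].
      apply P1n_le; [|exact Hx]. intros x Hx'. apply P1_edge_singularity; auto. }
  pose proof (shifted_power_decay al (1 - y) N (1 / INR k) Ha ltac:(lra) Hx) as D.
  pose proof (ln_time_bound m N (m + 2 + N) ltac:(lia)) as T.
  pose proof (ln_nonneg_INR (m + 2 + N)). pose proof (ln_nonneg_INR (S N)) as HN.
  pose proof (ln_nonneg_INR (S m)) as Hm.
  assert (Ht : ln (INR (S m)) <= ln t).
  { apply ln_le; [pose proof (INR_ge_1 (S m) ltac:(lia)); lra | apply tden_ge]. }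
  set (c := 1 + 2 / (1 - al)) in *.
  assert (Hc : 0 < c).
  { assert (0 < 2 / (1 - al)) by (apply Rdiv_lt_0_compat; lra). unfold c; lra. }
  set (l := 1 + ln (INR (S N))) in *. assert (Hl : 1 <= l) by (unfold l; lra).
  replace (c / (1 / INR k * l)) with (c * INR k / l) in D by (field; lra).
  apply Rle_trans with (((2 + ln t) * l) * (12 * A * (c * INR k / l))).
  - apply Rmult_le_compat; [lra | | |].
    + apply P1n_aside_nonneg; auto. intros; apply Rlt_le, Rpower_pos.
    + eapply Rle_trans; [exact T|]. apply Rmult_le_compat_r; lra.
    + eapply Rle_trans; [exact B|]. apply Rmult_le_compat_l; lra.
  - right. field. lra.
Qed.

(** The mass of the hyperbola contributes [- ln (d / t) <= ln t], hence a second logarithm; no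
    preliminary step is used, so [N = 0] is covered. *)
Lemma P1n_aside_large b al m N k : 0 < b < 1 -> irr b -> 0 < al < 1 ->
  1 / 2 < orbit b m -> orbit b (S m) <= 1 / 2 -> (1 <= k)%nat ->
  ln (INR (m + 1 + N)) * P1n N (aside b (v b al) m) (1 / INR k)
  <= 4 * INR k * (Rpower (tden b m) (al - 1) * Rpower (dd b m) (al - 1)) * (2 + ln (tden b m)) ^ 2.
Proof.
  intros Hb Hi Ha Hs Hs' Hk. pose proof (unit_range k Hk) as Hx.
  pose proof (INR_ge_1 k Hk) as HK.
  destruct (denoms_bounds b m) as [Hc [Hd _]]. pose proof (tden_ge_1 b m) as Ht1.
  assert (Htd : dd b m <= tden b m) by (unfold tden; lra).
  set (A := Rpower (tden b m) (al - 1) * Rpower (dd b m) (al - 1)).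
  assert (HA : 0 < A) by (apply Rmult_lt_0_compat; apply Rpower_pos).
  set (t := tden b m) in *. set (d := dd b m) in *.
  assert (Hcd : 0 < d / t <= 1).
  { split; [apply Rdiv_lt_0_compat; lra|].
    apply Rmult_le_reg_r with t; [lra|]. field_simplify; lra. }
  assert (B : P1n N (aside b (v b al) m) (1 / INR k)
     <= 4 * A * P1n N (fun z => / (z + d / t)) (1 / INR k)).
  { rewrite <- (P1n_scal N (4 * A)). apply P1n_le; [|exact Hx]. intros x Hx'.
    apply aside_large_bound; auto. }
  pose proof (hyperbola_decay (d / t) N (1 / INR k) Hcd Hx) as D.
  pose proof (ln_time_bound m N (m + 1 + N) ltac:(lia)) as T.
  pose proof (ln_nonneg_INR (m + 1 + N)). pose proof (ln_nonneg_INR (S N)) as HN.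
  pose proof (ln_nonneg_INR (S m)) as Hm.
  assert (Ht : ln (INR (S m)) <= ln t).
  { apply ln_le; [pose proof (INR_ge_1 (S m) ltac:(lia)); lra | apply tden_ge]. }
  assert (Hld : 0 <= ln d) by (rewrite <- ln_1; apply ln_le; lra).
  assert (Hlc : - ln (d / t) <= ln t) by (rewrite ln_div by lra; lra).
  set (l := 1 + ln (INR (S N))) in *. assert (Hl : 1 <= l) by (unfold l; lra).
  replace ((2 - ln (d / t)) / (1 / INR k * l)) with ((2 - ln (d / t)) * (INR k / l)) in D
    by (field; lra).
  assert (Hkl : 0 < INR k / l) by (apply Rdiv_lt_0_compat; lra).
  apply Rle_trans with (((2 + ln t) * l) * (4 * A * ((2 + ln t) * (INR k / l)))).
  - apply Rmult_le_compat; [lra | | |].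
    + apply P1n_aside_nonneg; auto. intros; apply Rlt_le, Rpower_pos.
    + eapply Rle_trans; [exact T|]. apply Rmult_le_compat_r; lra.
    + eapply Rle_trans; [exact B|]. apply Rmult_le_compat_l; [lra|].
      eapply Rle_trans; [exact D|]. apply Rmult_le_compat_r; lra.
  - right. field. lra.
Qed.

(* [resonance b al k n] is large exactly when the inverse branch of [T1^n] around [b]
   brings [1 / k] abnormally close to [b]. *)
Definition resonance (b al : R) (k n : nat) : R :=
  Rpower (tden b n) (- 2 * (1 - al)) * Rpower (Rabs (1 / INR k - orbit b n)) (- al).

Lemma resonance_nonneg b al k n : 0 <= resonance b al k n.
Proof. apply Rmult_le_pos; apply Rlt_le, Rpower_pos. Qed.

Lemma along_bound b al k n : 0 < b < 1 -> irr b -> 0 < al < 1 -> (1 <= k)%nat ->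
  along b (v b al) n (1 / INR k) <= INR k ^ 2 * resonance b al k n.
Proof.
  intros Hb Hi Ha Hk. pose proof (unit_range k Hk) as Hx. pose proof (INR_ge_1 k Hk) as HK.
  destruct (orbit_irr b n Hb Hi) as [Ho Hio].
  rewrite along_v by (auto; intros E; apply (irr_unit _ k Hio Hk); auto).
  unfold resonance. rewrite <- tden_pow.
  destruct (denoms_bounds b n) as [Hc [Hd _]].
  destruct (branch_mid_bound b al n Hb Hi ltac:(lra)) as [_ B2].
  pose proof (tden_ge_1 b n) as Ht.
  assert (B1 : Rpower (dc b n * (1 / INR k) + dd b n) (al - 2)
     <= INR k ^ 2 * Rpower (tden b n) (al - 2)).
  { apply Rle_trans with (Rpower (/ INR k * tden b n) (al - 2)).
    - apply Rpower_antitone; [|unfold tden, Rdiv in *; nra|lra].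
      apply Rmult_lt_0_compat; [apply Rinv_0_lt_compat; lra | lra].
    - rewrite <- Rpower_mult_distr by (try apply Rinv_0_lt_compat; lra).
      apply Rmult_le_compat_r; [apply Rlt_le, Rpower_pos|].
      replace (Rpower (/ INR k) (al - 2)) with (Rpower (INR k) (2 - al)).
      + rewrite <- Rpower_pow by lra. apply Rle_Rpower; simpl; lra.
      + unfold Rpower. f_equal. rewrite ln_Rinv by lra. ring. }
  pose proof (Rpower_pos (dc b n * (1 / INR k) + dd b n) (al - 2)).
  pose proof (Rpower_pos (dc b n * orbit b n + dd b n) al).
  pose proof (Rpower_pos (Rabs (1 / INR k - orbit b n)) (- al)).
  rewrite <- !Rmult_assoc. apply Rmult_le_compat_r; [lra|].
  apply Rmult_le_compat; lra.
Qed.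

(** With no step left the singularity at 1 is still in place. It is harmless for [k >= 2], as
    [1 - y / k >= 1 / 2]; for [k = 1] the factor [1 - y] is the distance in [resonance] at level
    [m + 1], and [tden b (S m) <= 2 * tden b m] gives the constant 8. *)
Lemma aside_now_bound b al m k : 0 < b < 1 -> irr b -> 0 < al < 1 ->
  orbit b m <= 1 / 2 -> (1 <= k)%nat ->
  aside b (v b al) m (1 / INR k)
  <= 4 * Rpower (tden b m) (- 2 * (1 - al)) + 8 * resonance b al k (S m).
Proof.
  intros Hb Hi Ha Hs Hk. pose proof (unit_range k Hk) as Hx. pose proof (INR_ge_1 k Hk) as HK.
  eapply Rle_trans; [apply aside_small_bound; auto|].
  destruct (orbit_irr b (S m) Hb Hi) as [Ho' _].
  destruct (denoms_bounds b m) as [Hc [Hd _]]. pose proof (tden_ge_1 b m) as Ht.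
  unfold resonance. set (y := orbit b (S m)) in *.
  set (A := Rpower (tden b m) (- 2 * (1 - al))).
  set (A' := Rpower (tden b (S m)) (- 2 * (1 - al))).
  assert (HA : A <= 4 * A').
  { apply Rle_trans with (Rpower (/ 2 * tden b (S m)) (- 2 * (1 - al))).
    - apply Rpower_antitone; [pose proof (tden_ge_1 b (S m)); lra | | lra].
      unfold tden. destruct (denoms_small b m Hs) as [-> ->]. lra.
    - rewrite <- Rpower_mult_distr by (pose proof (tden_ge_1 b (S m)); lra).
      apply Rmult_le_compat_r; [apply Rlt_le, Rpower_pos|].
      replace (Rpower (/ 2) (- 2 * (1 - al))) with (Rpower 2 (2 * (1 - al))).
      + replace 4 with (Rpower 2 2).
        * apply Rle_Rpower; lra.
        * replace 2 with (INR 2) at 2 by (simpl; ring). rewrite Rpower_pow by lra. ring.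
      + unfold Rpower. f_equal. rewrite ln_Rinv by lra. ring. }
  assert (PA : 0 < A) by apply Rpower_pos. assert (PA' : 0 < A') by apply Rpower_pos.
  pose proof (Rpower_pos (Rabs (1 / INR k - y)) (- al)) as PR.
  set (R := Rpower (Rabs (1 / INR k - y)) (- al)) in *.
  destruct (Nat.eq_dec k 1) as [->|Hk1].
  - replace (1 - y * (1 / INR 1)) with (Rabs (1 / INR 1 - y)).
    + fold R. nra.
    + simpl (INR 1). rewrite Rabs_right by lra. field.
  - assert (1 / INR k <= 1 / 2).
    { apply Rmult_le_compat_l; [lra|]. apply Rinv_le_contravar; [lra|].
      apply (le_INR 2). lia. }
    assert (1 / 2 <= 1 - y * (1 / INR k)) by nra.
    assert (Rpower (1 - y * (1 / INR k)) (- al) <= 2) by (apply Rpower_neg_le; lra).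
    nra.
Qed.

(** * Domination by a summable sequence *)

(** The second summand enters only in the upper half, where the majorant is governed by [dd] and not
    by [tden]. *)
Definition weight (b s : R) (m : nat) : R :=
  Rpower (tden b m) s + (if Rle_dec (orbit b m) (1 / 2) then 0 else Rpower (dd b m) s).

Lemma weight_pos b s m : 0 < weight b s m.
Proof.
  unfold weight. pose proof (Rpower_pos (tden b m) s). pose proof (Rpower_pos (dd b m) s).
  destruct Rle_dec; lra.
Qed.

(** Sum of the constants of the three kinds of pieces (lower half with steps left, lower half with
    none, upper half), times the constant of [ln_sq_bound]. *)
Definition tail_const (al eps : R) (k : nat) : R :=
  (12 * (1 + 2 / (1 - al)) * INR k + 4 + 4 * INR k) * (2 + 2 / eps) ^ 2.

Lemma tail_const_parts al eps k : 0 < al < 1 -> 0 < eps ->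
  let L := (2 + 2 / eps) ^ 2 in
  0 < L /\ 12 * (1 + 2 / (1 - al)) * INR k * L <= tail_const al eps k
  /\ 4 * L <= tail_const al eps k /\ 4 * INR k * L <= tail_const al eps k.
Proof.
  intros Ha He L.
  assert (0 < 2 / eps) by (apply Rdiv_lt_0_compat; lra).
  assert (HL : 0 < L) by (apply pow_lt; lra).
  pose proof (pos_INR k).
  assert (0 < 2 / (1 - al)) by (apply Rdiv_lt_0_compat; lra).
  assert (0 <= 12 * (1 + 2 / (1 - al)) * INR k) by (apply Rmult_le_pos; lra).
  unfold tail_const. fold L. split; [exact HL|].
  split; [|split]; apply Rmult_le_compat_r; lra.
Qed.

Lemma ln_tden_nonneg b m : 0 <= ln (tden b m).
Proof. rewrite <- ln_1. apply ln_le; [lra | apply tden_ge_1]. Qed.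

Lemma tden_log_absorb b al eps m : 0 < eps ->
  Rpower (tden b m) (- 2 * (1 - al)) * (2 + ln (tden b m)) ^ 2
  <= (2 + 2 / eps) ^ 2 * Rpower (tden b m) (- 2 * (1 - al) + eps).
Proof.
  intros He. pose proof (ln_sq_bound eps (tden b m) He (tden_ge_1 b m)).
  rewrite Rpower_plus. pose proof (Rpower_pos (tden b m) (- 2 * (1 - al))). nra.
Qed.

Lemma piece_bound_large b al eps k m N :
  0 < b < 1 -> irr b -> 0 < al < 1 -> 0 < eps <= 1 - al -> (1 <= k)%nat ->
  1 / 2 < orbit b m -> orbit b (S m) <= 1 / 2 ->
  ln (INR (m + 1 + N)) * P1n N (aside b (v b al) m) (1 / INR k)
  <= tail_const al eps k * weight b (- 2 * (1 - al) + eps) m.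
Proof.
  intros Hb Hi Ha He Hk Hs Hs'.
  destruct (tail_const_parts al eps k Ha ltac:(lra)) as [HL [_ [_ C3]]].
  pose proof (ln_tden_nonneg b m) as Hln. pose proof (tden_ge_1 b m) as Ht.
  pose proof (INR_ge_1 k Hk) as HK.
  set (L := (2 + 2 / eps) ^ 2) in *. set (C := tail_const al eps k) in *.
  eapply Rle_trans; [apply P1n_aside_large; auto|].
  pose proof (ln_sq_bound eps (tden b m) ltac:(lra) Ht) as A. fold L in A.
  destruct (denoms_bounds b m) as [Hc [Hd _]].
  assert (Htd : dd b m <= tden b m) by (unfold tden; lra).
  set (t := tden b m) in *. set (d := dd b m) in *.
  assert (B : Rpower t (al - 1) * Rpower d (al - 1) * (2 + ln t) ^ 2
    <= L * Rpower d (- 2 * (1 - al) + eps)).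
  { pose proof (Rpower_pos t (al - 1)). pose proof (Rpower_pos d (al - 1)).
    apply Rle_trans with (Rpower t (al - 1) * Rpower d (al - 1) * (L * Rpower t eps)).
    - apply Rmult_le_compat_l; [apply Rmult_le_pos; lra | exact A].
    - replace (Rpower t (al - 1) * Rpower d (al - 1) * (L * Rpower t eps))
        with (L * (Rpower t (al - 1 + eps) * Rpower d (al - 1)))
        by (rewrite Rpower_plus; ring).
      replace (- 2 * (1 - al) + eps) with ((al - 1 + eps) + (al - 1)) by ring.
      rewrite (Rpower_plus (al - 1 + eps) (al - 1) d). apply Rmult_le_compat_l; [lra|].
      (* Here [eps <= 1 - al] is used: the exponent [al - 1 + eps] is nonpositive, so [t] may be
         replaced by the smaller [d]. *)
      apply Rmult_le_compat_r; [lra|]. apply Rpower_antitone; lra. }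
  unfold weight. destruct Rle_dec; [lra|].
  fold t d. pose proof (Rpower_pos d (- 2 * (1 - al) + eps)) as Pd.
  pose proof (Rpower_pos t (- 2 * (1 - al) + eps)) as Pt.
  rewrite Rmult_assoc.
  apply Rle_trans with (4 * INR k * (L * Rpower d (- 2 * (1 - al) + eps)));
    [apply Rmult_le_compat_l; lra|].
  rewrite <- Rmult_assoc.
  apply Rle_trans with (C * Rpower d (- 2 * (1 - al) + eps));
    [apply Rmult_le_compat_r; lra|].
  apply Rmult_le_compat_l; nra.
Qed.

Lemma piece_bound_later b al eps k m N :
  0 < b < 1 -> irr b -> 0 < al < 1 -> 0 < eps <= 1 - al -> (1 <= k)%nat ->
  (1 / 2 < orbit b m -> orbit b (S m) <= 1 / 2) -> (1 <= N)%nat ->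
  ln (INR (m + 1 + N)) * P1n N (aside b (v b al) m) (1 / INR k)
  <= tail_const al eps k * weight b (- 2 * (1 - al) + eps) m.
Proof.
  intros Hb Hi Ha He Hk Hm HN.
  destruct (tail_const_parts al eps k Ha ltac:(lra)) as [HL [C1 [_ C3]]].
  pose proof (ln_tden_nonneg b m) as Hln. pose proof (tden_ge_1 b m) as Ht.
  pose proof (INR_ge_1 k Hk) as HK.
  set (L := (2 + 2 / eps) ^ 2) in *. set (C := tail_const al eps k) in *.
  unfold weight. destruct Rle_dec as [Hs|Hs].
  - destruct N as [|N]; [lia|].
    replace (m + 1 + S N)%nat with (m + 2 + N)%nat by lia.
    eapply Rle_trans; [apply P1n_aside_small; auto|].
    pose proof (tden_log_absorb b al eps m ltac:(lra)) as A. fold L in A.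
    set (X := Rpower (tden b m) (- 2 * (1 - al))) in *.
    set (Y := Rpower (tden b m) (- 2 * (1 - al) + eps)) in *.
    assert (0 < X) by apply Rpower_pos. assert (0 < Y) by apply Rpower_pos.
    assert (A' : X * (2 + ln (tden b m)) <= L * Y).
    { eapply Rle_trans; [|exact A]. apply Rmult_le_compat_l; [lra|]. nra. }
    assert (0 < 2 / (1 - al)) by (apply Rdiv_lt_0_compat; lra).
    assert (0 <= 12 * (1 + 2 / (1 - al)) * INR k) by (apply Rmult_le_pos; lra).
    set (c := 12 * (1 + 2 / (1 - al)) * INR k) in *.
    rewrite Rplus_0_r, Rmult_assoc.
    apply Rle_trans with (c * (L * Y)); [apply Rmult_le_compat_l; lra|].
    rewrite <- Rmult_assoc. apply Rmult_le_compat_r; lra.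
  - apply Rnot_le_lt in Hs.
    pose proof (piece_bound_large b al eps k m N Hb Hi Ha He Hk Hs (Hm Hs)) as B.
    unfold weight in B. destruct Rle_dec in B; [lra | exact B].
Qed.

Lemma piece_bound_now b al eps k m :
  0 < b < 1 -> irr b -> 0 < al < 1 -> 0 < eps <= 1 - al -> (1 <= k)%nat ->
  (1 / 2 < orbit b m -> orbit b (S m) <= 1 / 2) ->
  ln (INR (S m)) * aside b (v b al) m (1 / INR k)
  <= tail_const al eps k * weight b (- 2 * (1 - al) + eps) m
     + 8 * (ln (INR (S m)) * resonance b al k (S m)).
Proof.
  intros Hb Hi Ha He Hk Hm.
  destruct (tail_const_parts al eps k Ha ltac:(lra)) as [HL [_ [C2 C3]]].
  pose proof (ln_tden_nonneg b m) as Hln. pose proof (tden_ge_1 b m) as Ht.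
  pose proof (INR_ge_1 k Hk) as HK. pose proof (ln_nonneg_INR (S m)) as Hl0.
  pose proof (resonance_nonneg b al k (S m)) as HR.
  assert (0 <= ln (INR (S m)) * resonance b al k (S m)) by (apply Rmult_le_pos; lra).
  destruct (Rle_dec (orbit b m) (1 / 2)) as [Hs|Hs].
  - eapply Rle_trans.
    { apply Rmult_le_compat_l; [exact Hl0|]. apply aside_now_bound; auto. }
    pose proof (tden_log_absorb b al eps m ltac:(lra)) as A.
    assert (Hlt : ln (INR (S m)) <= ln (tden b m)).
    { apply ln_le; [pose proof (INR_ge_1 (S m) ltac:(lia)); lra | apply tden_ge]. }
    unfold weight. destruct Rle_dec; [|contradiction].
    set (L := (2 + 2 / eps) ^ 2) in *. set (C := tail_const al eps k) in *.
    set (X := Rpower (tden b m) (- 2 * (1 - al))) in *.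
    set (Y := Rpower (tden b m) (- 2 * (1 - al) + eps)) in *.
    assert (0 < X) by apply Rpower_pos. assert (0 < Y) by apply Rpower_pos.
    assert (A' : ln (INR (S m)) * X <= L * Y).
    { eapply Rle_trans; [|exact A]. rewrite Rmult_comm. apply Rmult_le_compat_l; [lra|]. nra. }
    rewrite Rplus_0_r. nra.
  - apply Rnot_le_lt in Hs.
    enough (ln (INR (m + 1 + 0)) * P1n 0 (aside b (v b al) m) (1 / INR k)
      <= tail_const al eps k * weight b (- 2 * (1 - al) + eps) m) as K.
    { change (P1n 0 (aside b (v b al) m) (1 / INR k)) with (aside b (v b al) m (1 / INR k)) in K.
      replace (m + 1 + 0)%nat with (S m) in K by lia. lra. }
    apply piece_bound_large; auto.
Qed.

Lemma bsum_tail_small f B e : (forall n, 0 <= f n) -> (forall n, bsum f n <= B) -> 0 < e ->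
  exists m0, forall n m, (m0 <= m)%nat -> bsum f n - bsum f m <= e.
Proof.
  intros Hf HB He.
  destruct (growing_cv (fun n => bsum f n)) as [L HL].
  - intros n. cbn [bsum]. pose proof (Hf n). lra.
  - exists B. intros x [n ->]. apply HB.
  - destruct (HL e He) as [m0 Hm0]. exists m0. intros n m Hm.
    pose proof (bsum_le_limit f L Hf HL n). specialize (Hm0 m Hm).
    unfold Rdist in Hm0. apply Rabs_def2 in Hm0. lra.
Qed.

Lemma weight_summable b a al : cf_expansion b a -> 0 < al < 1 -> intermediate_type a al ->
  exists eps B, 0 < eps <= 1 - al
    /\ forall M, bsum (weight b (- 2 * (1 - al) + eps)) M <= B.
Proof.
  intros Hcf Ha Hint. destruct (tden_summable b a al Hcf Ha Hint) as [eps [B [He HB]]].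
  exists eps, (B + (1 + B)). split; [exact He|]. intros M. unfold weight. rewrite bsum_plus.
  apply Rplus_le_compat; [apply HB | apply dden_summable, HB].
Qed.

(** The sibling cylinder stays at positive distance from [b], so even the exponent [alpha + 2] of
    the error in [v_le_vreg] gives a bounded piece, with a bound depending on the level. *)
Lemma aside_v_bounded b al m : 0 < b < 1 -> irr b -> 2 <= al ->
  exists K, 0 <= K /\ forall x, 0 < x <= 1 -> aside b (v b al) m x <= K.
Proof.
  intros Hb Hi Ha.
  destruct (denoms_bounds b m) as [Hc [Hd _]].
  destruct (orbit_irr b m Hb Hi) as [Ho _].
  destruct (orbit_irr b (S m) Hb Hi) as [Ho' _].
  set (y := orbit b m) in *. set (y' := orbit b (S m)) in *.
  set (B := Rpower (dc b m * y + dd b m) al).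
  assert (HB : 0 < B) by apply Rpower_pos.
  assert (E : forall A s x, 0 < s < 1 -> 0 < x <= 1 -> 0 < A <= 2 * tden b m ->
    Rpower A (al - 2) * B * Rpower (s * (1 - y' * x)) (- al)
    <= Rpower (2 * tden b m) (al - 2) * B * Rpower (s * (1 - y')) (- al)).
  { intros A s x Hs Hx HA.
    assert (1 - y' <= 1 - y' * x) by nra.
    pose proof (Rpower_pos A (al - 2)).
    pose proof (Rpower_pos (s * (1 - y' * x)) (- al)).
    apply Rmult_le_compat; [apply Rmult_le_pos; lra | lra | |].
    - apply Rmult_le_compat_r; [lra|]. apply Rpower_monotone; lra.
    - apply Rpower_antitone; [apply Rmult_lt_0_compat; lra | | lra].
      apply Rmult_le_compat_l; lra. }
  assert (P : forall s, 0 <= Rpower (2 * tden b m) (al - 2) * B * Rpower (s * (1 - y')) (- al)).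
  { intros s. repeat apply Rmult_le_pos; try lra; apply Rlt_le, Rpower_pos. }
  assert (Hr : forall x, 0 < x <= 1 -> 0 < dd b m * x + (dc b m + dd b m) <= 2 * tden b m
     /\ 0 < (dc b m + dd b m) * x + dd b m <= 2 * tden b m).
  { intros x Hx. unfold tden. split; nra. }
  destruct (Rle_dec y (1 / 2)) as [Hs|Hs].
  - eexists. split; [apply (P (1 - y))|]. intros x Hx. rewrite aside_v_small by auto.
    apply E; try lra. apply Hr, Hx.
  - eexists. split; [apply (P y)|]. intros x Hx.
    rewrite aside_v_large by (auto; unfold y in Hs; lra).
    apply E; try lra. apply Hr, Hx.
Qed.

(** Each piece of the error is below [d * K] times a constant function, whose images decay like the
    inverse logarithm. The resulting [H] depends on [m0] but on neither [d] nor [n]. *)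
Lemma head_bound b al k m0 : 0 < b < 1 -> irr b -> 0 < al < 1 -> (1 <= k)%nat ->
  exists H, 0 <= H /\ forall d n, 0 < d -> (m0 <= n)%nat ->
  bsum (fun m => ln (INR n) * (P1n (n - 1 - m) (aside b (v b al) m) (1 / INR k)
                   - P1n (n - 1 - m) (aside b (vreg b al d) m) (1 / INR k))) m0 <= d * H.
Proof.
  intros Hb Hi Ha Hk. pose proof (unit_range k Hk) as Hx. pose proof (INR_ge_1 k Hk) as HK.
  induction m0 as [|m0 [H [HH IH]]].
  - exists 0. split; [lra|]. intros. simpl. lra.
  - destruct (aside_v_bounded b (al + 2) m0 Hb Hi ltac:(lra)) as [K [HK0 HKb]].
    set (c := K * (2 * INR k) * (2 + ln (INR (S m0)))).
    pose proof (ln_nonneg_INR (S m0)) as Hm.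
    assert (Hc : 0 <= c) by (unfold c; repeat apply Rmult_le_pos; lra).
    exists (H + c). split; [lra|]. intros d n Hd Hn. cbn [bsum].
    rewrite Rmult_plus_distr_l. apply Rplus_le_compat; [apply IH; auto; lia|].
    set (N := (n - 1 - m0)%nat).
    rewrite <- (P1n_minus N (aside b (v b al) m0) (aside b (vreg b al d) m0)).
    assert (B : P1n N (fun z => aside b (v b al) m0 z - aside b (vreg b al d) m0 z) (1 / INR k)
       <= d * K * P1n N (fun _ => 1) (1 / INR k)).
    { rewrite <- (P1n_scal N (d * K) (fun _ => 1)). apply P1n_le; [|exact Hx].
      intros x Hx'.
      pose proof (aside_le b (v b al) (vreg b al d) (fun z => d * v b (al + 2) z) m0 Hb Hi) as A.
      specialize (A (fun z _ Hz => v_le_vreg b al d z Ha Hd Hz) x Hx').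
      rewrite (aside_scal b d (v b (al + 2))) in A.
      pose proof (HKb x Hx'). nra. }
    pose proof (const_decay N (1 / INR k) Hx) as D.
    pose proof (ln_time_bound m0 N n ltac:(unfold N; lia)) as T.
    pose proof (ln_nonneg_INR n) as Hln. pose proof (ln_nonneg_INR (S N)) as HN.
    set (l := 1 + ln (INR (S N))) in *. assert (Hl : 1 <= l) by (unfold l; lra).
    replace (2 / (1 / INR k * l)) with (2 * INR k / l) in D by (field; lra).
    assert (Hkl : 0 < 2 * INR k / l) by (apply Rdiv_lt_0_compat; lra).
    assert (HdK : 0 <= d * K) by (apply Rmult_le_pos; lra).
    apply Rle_trans with (ln (INR n) * (d * K * (2 * INR k / l))).
    { apply Rmult_le_compat_l; [lra|]. eapply Rle_trans; [exact B|].
      apply Rmult_le_compat_l; lra. }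
    apply Rle_trans with (((2 + ln (INR (S m0))) * l) * (d * K * (2 * INR k / l))).
    { apply Rmult_le_compat_r; [apply Rmult_le_pos; lra | exact T]. }
    right. unfold c. field. lra.
Qed.

(** A point above 1/2 has leading digit 1, so its image starts with the next digit, eventually at
    least 2. *)
Lemma eventually_after_large_small b a : cf_expansion b a ->
  (forall M : nat, exists N, forall n, (N <= n)%nat -> (M <= a n)%nat) ->
  exists M1, forall m, (M1 <= m)%nat -> 1 / 2 < orbit b m -> orbit b (S m) <= 1 / 2.
Proof.
  intros Hcf Hinf. destruct (Hinf 2%nat) as [N HN].
  destruct (block_index_large a N) as [M1 HM]. exists M1. intros m Hm Hl.
  destruct (block_exists a m (cf_digit b a Hcf)) as [n [i [Hi ->]]].
  specialize (HM n i Hi Hm).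
  destruct (orbit_block b a n i Hcf Hi) as [E _].
  pose proof (theta_range b a (S n) Hcf) as Ht.
  destruct (Nat.eq_dec (S i) (a (S n))) as [F|F].
  - replace (S (ssum a n + i)) with (ssum a (S n)) by (cbn [ssum]; lia).
    destruct (orbit_ssum b a (S n) Hcf) as [-> _].
    pose proof (theta_bounds b a (S n) Hcf) as [_ T].
    eapply Rle_trans; [exact T|]. apply Rmult_le_compat_l; [lra|].
    apply Rinv_le_contravar; [lra|]. apply (le_INR 2). apply HN. lia.
  - exfalso. rewrite E in Hl.
    assert (2 <= INR (a (S n) - i)) by (apply (le_INR 2); lia).
    assert (1 / (INR (a (S n) - i) + theta b a (S n)) <= 1 / 2); [|lra].
    apply Rmult_le_compat_l; [lra|]. apply Rinv_le_contravar; lra.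
Qed.

(** * Two-sided bounds for [ln n * P1n n v (1 / k)] *)

Lemma v_nonneg b al z : 0 <= v b al z.
Proof. apply Rlt_le, Rpower_pos. Qed.

Lemma vreg_nonneg b al d z : 0 <= vreg b al d z.
Proof. apply Rlt_le, Rpower_pos. Qed.

(** Order of the choices: [m0] from the tail of the weights, then [H] from the first [m0] levels,
    then [d] with [d * H <= e / 3], and only then the time from which the asymptotics of this one
    [vreg] hold. *)
Lemma P1n_v_upper b a al k I e : cf_expansion b a -> 0 < al < 1 -> intermediate_type a al ->
  (forall M : nat, exists N, forall n, (N <= n)%nat -> (M <= a n)%nat) ->
  (1 <= k)%nat -> improper_int01 (v b al) b I -> 0 < e ->
  exists N0, forall n, (N0 <= n)%nat ->
  ln (INR n) * P1n n (v b al) (1 / INR k)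
  <= INR k * I + e + (INR k ^ 2 + 8) * (ln (INR n) * resonance b al k n).
Proof.
  intros Hcf Ha Hint Hinf Hk HI He.
  pose proof (cf_range b a Hcf) as Hb. pose proof (cf_irr b a Hcf) as Hi.
  pose proof (unit_range k Hk) as Hx. pose proof (INR_ge_1 k Hk) as HK.
  destruct (weight_summable b a al Hcf Ha Hint) as [eps [B [Heps HB]]].
  set (W := weight b (- 2 * (1 - al) + eps)) in *.
  assert (HW : forall m, 0 <= W m) by (intros; apply Rlt_le, weight_pos).
  destruct (tail_const_parts al eps k Ha ltac:(lra)) as [HL [_ [C2 _]]].
  set (C := tail_const al eps k) in *.
  assert (HC : 0 < C) by lra.
  destruct (bsum_tail_small W B (e / (3 * C)) HW HB) as [m1 Hm1];
    [apply Rdiv_lt_0_compat; lra|].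
  destruct (eventually_after_large_small b a Hcf Hinf) as [M1 HM1].
  set (m0 := Nat.max m1 M1).
  destruct (head_bound b al k m0 Hb Hi Ha Hk) as [H [HH Hhead]].
  set (d := e / (3 * (H + 1))).
  assert (Hd : 0 < d) by (apply Rdiv_lt_0_compat; lra).
  assert (HdH : d * H <= e / 3).
  { apply Rle_trans with (d * (H + 1)); [apply Rmult_le_compat_l; lra|].
    unfold d. right. field. lra. }
  pose proof (vreg_asymptotic b al d k Hd Hk) as Lim.
  pose proof (RInt_vreg_le al b I d Ha Hb Hd HI) as HR.
  apply is_lim_seq_Reals in Lim. destruct (Lim (e / 3) ltac:(lra)) as [N1 HN1].
  exists (S (Nat.max N1 m0)). intros n Hn.
  specialize (HN1 n ltac:(lia)). unfold Rdist in HN1. apply Rabs_def2 in HN1.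
  set (J := RInt (vreg b al d) 0 1 : R) in *.
  assert (HJ : INR k * J <= INR k * I) by (apply Rmult_le_compat_l; lra).
  pose proof (ln_nonneg_INR n) as Hln.
  set (x := 1 / INR k) in *.
  pose proof (P1n_decomposition b (v b al) n x Hx) as D1.
  pose proof (P1n_decomposition b (vreg b al d) n x Hx) as D2.
  set (g := fun m => ln (INR n) * (P1n (n - 1 - m) (aside b (v b al) m) x
                 - P1n (n - 1 - m) (aside b (vreg b al d) m) x)).
  assert (Split : ln (INR n) * P1n n (v b al) x = ln (INR n) * P1n n (vreg b al d) x
     + ln (INR n) * (along b (v b al) n x - along b (vreg b al d) n x) + bsum g n).
  { unfold g. rewrite bsum_scal.
    rewrite (bsum_ext _ (fun m => P1n (n - 1 - m) (aside b (v b al) m) x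
       + (-1) * P1n (n - 1 - m) (aside b (vreg b al d) m) x)) by (intros; ring).
    rewrite bsum_plus, bsum_scal, D1, D2. ring. }
  rewrite Split.
  assert (Along : along b (v b al) n x - along b (vreg b al d) n x
     <= INR k ^ 2 * resonance b al k n).
  { pose proof (along_bound b al k n Hb Hi Ha Hk).
    pose proof (along_nonneg b (vreg b al d) n (fun z _ => vreg_nonneg b al d z) x Hx).
    fold x in H0. lra. }
  assert (Along' : ln (INR n) * (along b (v b al) n x - along b (vreg b al d) n x)
     <= INR k ^ 2 * (ln (INR n) * resonance b al k n)).
  { apply Rle_trans with (ln (INR n) * (INR k ^ 2 * resonance b al k n)).
    - apply Rmult_le_compat_l; lra.
    - right; ring. }
  assert (Hg : forall m, g m <= ln (INR n) * P1n (n - 1 - m) (aside b (v b al) m) x).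
  { intros m. unfold g. apply Rmult_le_compat_l; [lra|].
    pose proof (P1n_aside_nonneg b (vreg b al d) m (n - 1 - m) x
                  (fun z _ => vreg_nonneg b al d z) Hx). lra. }
  (* Levels below [m0] are the head. Level [n - 1] has no step left and gives the resonance term;
     the levels between are dominated by the weights. *)
  assert (Tail : bsum g n <= d * H + C * (bsum W n - bsum W m0)
     + 8 * (ln (INR n) * resonance b al k n)).
  { destruct n as [|n']; [lia|].
    assert (Sp : forall f, bsum f (S n') = bsum f m0 + bsum (fun m => f (m0 + m)%nat) (S (n' - m0)))
      by (intros; rewrite <- bsum_split; f_equal; lia).
    rewrite (Sp g), (Sp W).
    replace (bsum W m0 + bsum (fun m => W (m0 + m)%nat) (S (n' - m0)) - bsum W m0)
      with (bsum (fun m => W (m0 + m)%nat) (S (n' - m0))) by ring.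
    rewrite Rplus_assoc. apply Rplus_le_compat; [apply Hhead; auto; lia|].
    cbn [bsum]. rewrite Rmult_plus_distr_l, Rplus_assoc. apply Rplus_le_compat.
    - rewrite <- bsum_scal. apply bsum_le. intros m Hm.
      eapply Rle_trans; [apply Hg|].
      pose proof (piece_bound_later b al eps k (m0 + m) (S n' - 1 - (m0 + m))
        Hb Hi Ha Heps Hk (HM1 (m0 + m)%nat ltac:(unfold m0; lia)) ltac:(lia)) as P.
      replace (m0 + m + 1 + (S n' - 1 - (m0 + m)))%nat with (S n') in P by lia. exact P.
    - replace (m0 + (n' - m0))%nat with n' by lia.
      eapply Rle_trans; [apply Hg|]. replace (S n' - 1 - n')%nat with 0%nat by lia.
      apply (piece_bound_now b al eps k n' Hb Hi Ha Heps Hk). apply HM1. lia. }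
  assert (TW : C * (bsum W n - bsum W m0) <= e / 3).
  { apply Rle_trans with (C * (e / (3 * C))).
    - apply Rmult_le_compat_l; [lra|]. apply Hm1. lia.
    - right. field. lra. }
  lra.
Qed.

(** The closed form at exponent 0, where [v] is identically 1, by the convention for [Rpower] also
    at [b]. *)
Lemma along_const b n x : 0 < b < 1 -> irr b -> 0 < x <= 1 -> x <> orbit b n ->
  along b (fun _ => 1) n x = / (dc b n * x + dd b n) ^ 2.
Proof.
  intros Hb Hi Hx Hne. pose proof (along_v b 0 n Hb Hi x Hx Hne) as E.
  assert (F : forall m z, along b (v b 0) m z = along b (fun _ => 1) m z).
  { induction m as [|m IH]; intros z; cbn [along].
    - unfold v, Rpower. rewrite Ropp_0, Rmult_0_l. apply exp_0.
    - rewrite IH. reflexivity. }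
  rewrite <- F, E. destruct (denoms_bounds b n) as [Hc [Hd _]].
  assert (0 <= dc b n * x) by (apply Rmult_le_pos; lra).
  unfold Rpower at 2 3. rewrite Ropp_0, !Rmult_0_l, exp_0, !Rmult_1_r.
  replace (0 - 2) with (- INR 2) by (simpl; ring).
  rewrite Rpower_Ropp, Rpower_pow by lra. reflexivity.
Qed.

(** [vreg] is bounded and the derivative of the branch is of order [1 / tden^2], while
    [ln n <= tden]. *)
Lemma along_vreg_small b al d k n : 0 < b < 1 -> irr b -> 0 < al -> 0 < d -> (1 <= k)%nat ->
  ln (INR n) * along b (vreg b al d) n (1 / INR k)
  <= Rpower d (- (al / 2)) * INR k ^ 2 / INR (S n).
Proof.
  intros Hb Hi Ha Hd Hk. pose proof (unit_range k Hk) as Hx. pose proof (INR_ge_1 k Hk) as HK.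
  destruct (orbit_irr b n Hb Hi) as [Ho Hio].
  assert (Hne : 1 / INR k <> orbit b n) by (intros E; apply (irr_unit _ k Hio Hk); auto).
  set (M := Rpower d (- (al / 2))). assert (HM : 0 < M) by apply Rpower_pos.
  pose proof (along_le b (vreg b al d) (fun _ => M * 1) (fun _ => 0 * 1) n Hb Hi) as A.
  specialize (A ltac:(intros z _ _; pose proof (vreg_le_sup b al d z Ha Hd); unfold M in *; lra)
                _ Hx Hne).
  rewrite (along_scal b M (fun _ => 1)), (along_scal b 0 (fun _ => 1)), along_const in A by auto.
  destruct (denoms_bounds b n) as [Hc [Hd1 Ht]].
  fold (tden b n) in Ht. pose proof (INR_ge_1 (S n) ltac:(lia)) as HS.
  assert (B : / INR k * tden b n <= dc b n * (1 / INR k) + dd b n).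
  { pose proof (inv_INR_range k Hk). unfold tden, Rdiv. nra. }
  assert (0 < / INR k) by (apply Rinv_0_lt_compat; lra).
  assert (P0 : 0 < / INR k * tden b n) by (apply Rmult_lt_0_compat; lra).
  assert (Q : / (dc b n * (1 / INR k) + dd b n) ^ 2 <= INR k ^ 2 / tden b n ^ 2).
  { apply Rle_trans with (/ (/ INR k * tden b n) ^ 2).
    - apply Rinv_le_contravar; [apply pow_lt, P0 | apply pow_incr; lra].
    - right. field. lra. }
  assert (Hl : ln (INR n) <= tden b n).
  { destruct n as [|n]; [rewrite ln_INR_0; lra|].
    pose proof (exp_ineq1_le (ln (INR (S n)))) as X.
    rewrite exp_ln in X by (pose proof (INR_ge_1 (S n) ltac:(lia)); lra).
    rewrite (S_INR (S n)) in Ht. lra. }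
  pose proof (ln_nonneg_INR n) as Hl0.
  apply Rle_trans with (tden b n * (M * (INR k ^ 2 / tden b n ^ 2))).
  - apply Rmult_le_compat; [exact Hl0 | | exact Hl |].
    + apply along_nonneg; auto. intros; apply vreg_nonneg.
    + eapply Rle_trans; [exact A|]. rewrite Rmult_0_l, Rplus_0_r.
      apply Rmult_le_compat_l; lra.
  - replace (tden b n * (M * (INR k ^ 2 / tden b n ^ 2))) with (M * INR k ^ 2 * / tden b n)
      by (field; lra).
    apply Rmult_le_compat_l; [apply Rmult_le_pos; [lra | apply pow2_ge_0]|].
    apply Rinv_le_contravar; lra.
Qed.

(** Siblings are compared termwise, [vreg] against [v]. The branch summand of [vreg] vanishes in the
    limit, and that of [v] is kept on the left as the gain. *)
Lemma P1n_v_lower b al k I e : 0 < b < 1 -> irr b -> 0 < al < 1 ->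
  (1 <= k)%nat -> improper_int01 (v b al) b I -> 0 < e ->
  exists N0, forall n, (N0 <= n)%nat ->
  INR k * I - e + ln (INR n) * along b (v b al) n (1 / INR k)
  <= ln (INR n) * P1n n (v b al) (1 / INR k).
Proof.
  intros Hb Hi Ha Hk HI He.
  pose proof (unit_range k Hk) as Hx. pose proof (INR_ge_1 k Hk) as HK.
  destruct (RInt_vreg_ge al b I (e / (3 * INR k)) Ha Hb) as [d [Hd HR]];
    [apply Rdiv_lt_0_compat; lra | exact HI|].
  specialize (HR d ltac:(lra)).
  pose proof (vreg_asymptotic b al d k Hd Hk) as Lim.
  apply is_lim_seq_Reals in Lim. destruct (Lim (e / 3) ltac:(lra)) as [N1 HN1].
  pose proof (is_lim_seq_inv_S (Rpower d (- (al / 2)) * INR k ^ 2)) as Lim2.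
  apply is_lim_seq_Reals in Lim2. destruct (Lim2 (e / 3) ltac:(lra)) as [N2 HN2].
  exists (Nat.max N1 N2). intros n Hn.
  specialize (HN1 n ltac:(lia)). unfold Rdist in HN1. apply Rabs_def2 in HN1.
  specialize (HN2 n ltac:(lia)). unfold Rdist in HN2. apply Rabs_def2 in HN2.
  set (J := RInt (vreg b al d) 0 1 : R) in *.
  assert (HJ : INR k * I - e / 3 <= INR k * J).
  { replace (INR k * I - e / 3) with (INR k * (I - e / (3 * INR k))) by (field; lra).
    apply Rmult_le_compat_l; lra. }
  pose proof (ln_nonneg_INR n) as Hln.
  pose proof (along_vreg_small b al d k n Hb Hi ltac:(lra) Hd Hk) as Hsm.
  set (x := 1 / INR k) in *.
  pose proof (P1n_decomposition b (v b al) n x Hx) as D1.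
  pose proof (P1n_decomposition b (vreg b al d) n x Hx) as D2.
  assert (Cmp : bsum (fun m => P1n (n - 1 - m) (aside b (vreg b al d) m) x) n
             <= bsum (fun m => P1n (n - 1 - m) (aside b (v b al) m) x) n).
  { apply bsum_le. intros m _. apply P1n_le; [|exact Hx]. intros z Hz.
    pose proof (aside_le b (vreg b al d) (v b al) (fun _ => 0 * 1) m Hb Hi) as A.
    specialize (A ltac:(intros w _ Hw; pose proof (vreg_le_v b al d w ltac:(lra) Hd Hw); lra) z Hz).
    rewrite (aside_scal b 0 (fun _ => 1)) in A. lra. }
  assert (ln (INR n) * (P1n n (vreg b al d) x - along b (vreg b al d) n x + along b (v b al) n x)
     <= ln (INR n) * P1n n (v b al) x).
  { apply Rmult_le_compat_l; [lra|]. lra. }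
  nra.
Qed.

(** * Resonance in terms of the digits *)

(** When the leading digit [D] differs from [k], [theta <= 1 / 2] gives [|D + theta - k| >= 1 / 2].
    The critical case is [D = k - 1]. *)
Lemma resonance_off_digit b a al k j i : cf_expansion b a -> 0 < al < 1 -> (1 <= k)%nat ->
  (i < a (S j))%nat -> (a (S j) - i <> k)%nat -> theta b a (S j) <= 1 / 2 ->
  resonance b al k (ssum a j + i)
  <= 2 * INR k * (INR k + 1) * Rpower (tden b (ssum a j + i)) (- 2 * (1 - al)).
Proof.
  intros Hcf Ha Hk Hi Hne Ht. pose proof (INR_ge_1 k Hk) as HK.
  pose proof (theta_range b a (S j) Hcf) as Htr.
  destruct (orbit_block b a j i Hcf Hi) as [E _]. unfold resonance. rewrite E.
  set (D := (a (S j) - i)%nat) in *. pose proof (INR_ge_1 D ltac:(unfold D; lia)) as HD.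
  set (th := theta b a (S j)) in *.
  set (c := 2 * INR k * (INR k + 1)). assert (Hc : 4 <= c) by (unfold c; nra).
  rewrite Rmult_comm. apply Rmult_le_compat_r; [apply Rlt_le, Rpower_pos|].
  apply Rpower_neg_le; try lra.
  replace (1 / INR k - 1 / (INR D + th)) with ((INR D + th - INR k) / (INR k * (INR D + th)))
    by (field; lra).
  assert (HP : 0 < INR k * (INR D + th)) by (apply Rmult_lt_0_compat; lra).
  rewrite Rabs_div_pos by assumption.
  apply Rmult_le_reg_r with (c * (INR k * (INR D + th))); [apply Rmult_lt_0_compat; lra|].
  replace (/ c * (c * (INR k * (INR D + th)))) with (INR k * (INR D + th)) by (field; lra).
  replace (Rabs (INR D + th - INR k) / (INR k * (INR D + th)) * (c * (INR k * (INR D + th))))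
    with (Rabs (INR D + th - INR k) * c) by (field; lra).
  destruct (Nat.lt_total D k) as [H|[H|H]]; [|contradiction|].
  - assert (INR D + 1 <= INR k) by (rewrite <- S_INR; apply le_INR; lia).
    rewrite Rabs_left1 by lra. unfold c.
    assert (1 / 2 <= - (INR D + th - INR k)) by lra. nra.
  - assert (INR k + 1 <= INR D) by (rewrite <- S_INR; apply le_INR; lia).
    rewrite Rabs_right by lra. unfold c. nra.
Qed.

(** The quantity [S_{k,j}] without its factor [ln n_{k,j}]. *)
Definition spike (a : nat -> nat) (al : R) (j : nat) : R :=
  Rpower (INR (a (S j))) al / Rpower (INR (q a j)) (2 * (1 - al)).

Lemma q_digit b a k j : cf_expansion b a -> (1 <= k)%nat -> (k <= a (S j))%nat ->
  INR (q a (S j)) = dc b (ssum a j + (a (S j) - k)) + INR k * dd b (ssum a j + (a (S j) - k)).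
Proof.
  intros Hcf Hk Hka. destruct (orbit_block b a j (a (S j) - k) Hcf ltac:(lia)) as [_ [-> ->]].
  unfold q. cbn [qpair]. destruct (qpair a j) as [u w]. cbn [fst snd].
  rewrite plus_INR, mult_INR, minus_INR by lia. ring.
Qed.

(** The gap is [theta / (k (k + theta))], and [theta] is comparable to [1 / a_(j+2)]. *)
Lemma on_digit_gap b a k j : cf_expansion b a -> (1 <= k)%nat -> (k <= a (S j))%nat ->
  let n := (ssum a j + (a (S j) - k))%nat in
  orbit b n = 1 / (INR k + theta b a (S j))
  /\ / (4 * INR k ^ 2 * INR (a (S (S j)))) <= Rabs (1 / INR k - orbit b n)
       <= / INR (a (S (S j))).
Proof.
  intros Hcf Hk Hka n. pose proof (INR_ge_1 k Hk) as HK.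
  pose proof (theta_range b a (S j) Hcf) as Ht.
  pose proof (theta_bounds b a (S j) Hcf) as Hb.
  pose proof (INR_ge_1 (a (S (S j))) (cf_digit b a Hcf (S (S j)) ltac:(lia))) as HA.
  destruct (orbit_block b a j (a (S j) - k) Hcf ltac:(lia)) as [E _]. fold n in E.
  replace (a (S j) - (a (S j) - k))%nat with k in E by lia.
  split; [exact E|]. rewrite E.
  set (th := theta b a (S j)) in *. set (A := INR (a (S (S j)))) in *.
  assert (HP : 0 < INR k * (INR k + th)) by (apply Rmult_lt_0_compat; lra).
  replace (1 / INR k - 1 / (INR k + th)) with (th / (INR k * (INR k + th))) by (field; lra).
  assert (0 < th / (INR k * (INR k + th))) by (apply Rdiv_lt_0_compat; lra).
  rewrite Rabs_right by lra. split.
  - replace (/ (4 * INR k ^ 2 * A)) with (1 / (2 * A) * / (2 * INR k ^ 2)) by (field; lra).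
    apply Rmult_le_compat; [apply Rlt_le, Rdiv_lt_0_compat; lra | | apply Hb |].
    + apply Rlt_le, Rinv_0_lt_compat. nra.
    + apply Rinv_le_contravar; [lra|]. nra.
  - apply Rle_trans with (1 / A * 1); [|right; field; lra].
    apply Rmult_le_compat; [lra | apply Rlt_le, Rinv_0_lt_compat; lra | apply Hb |].
    rewrite <- Rinv_1. apply Rinv_le_contravar; nra.
Qed.

(** The constant is [k^2] from [tden >= q / k] times [4 k^2] from the gap. *)
Lemma resonance_on_digit b a al k j : cf_expansion b a -> 0 < al < 1 -> (1 <= k)%nat ->
  (k <= a (S j))%nat ->
  resonance b al k (ssum a j + (a (S j) - k)) <= 4 * INR k ^ 4 * spike a al (S j).
Proof.
  intros Hcf Ha Hk Hka. pose proof (INR_ge_1 k Hk) as HK.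
  pose proof (on_digit_gap b a k j Hcf Hk Hka) as [_ [G _]].
  pose proof (q_digit b a k j Hcf Hk Hka) as Q.
  set (n := (ssum a j + (a (S j) - k))%nat) in *.
  pose proof (INR_ge_1 (a (S (S j))) (cf_digit b a Hcf (S (S j)) ltac:(lia))) as HA.
  destruct (denoms_bounds b n) as [Hc [Hd _]]. pose proof (tden_ge_1 b n) as Ht.
  assert (Hq : 1 <= INR (q a (S j))) by (rewrite Q; nra).
  unfold resonance, spike. set (A := INR (a (S (S j)))) in *. set (qq := INR (q a (S j))) in *.
  assert (B1 : Rpower (tden b n) (- 2 * (1 - al)) <= INR k ^ 2 * / Rpower qq (2 * (1 - al))).
  { rewrite <- Rpower_Ropp. replace (- (2 * (1 - al))) with (- 2 * (1 - al)) by ring.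
    apply Rle_trans with (Rpower (/ INR k * qq) (- 2 * (1 - al))).
    - apply Rpower_antitone; [| |lra].
      + apply Rmult_lt_0_compat; [apply Rinv_0_lt_compat|]; lra.
      + apply Rmult_le_reg_l with (INR k); [lra|]. rewrite <- Rmult_assoc, Rinv_r by lra.
        rewrite Q. unfold tden. nra.
    - rewrite <- Rpower_mult_distr by (try apply Rinv_0_lt_compat; lra).
      apply Rmult_le_compat_r; [apply Rlt_le, Rpower_pos|].
      replace (Rpower (/ INR k) (- 2 * (1 - al))) with (Rpower (INR k) (2 * (1 - al))).
      + rewrite <- Rpower_pow by lra. apply Rle_Rpower; simpl; lra.
      + unfold Rpower. f_equal. rewrite ln_Rinv by lra. ring. }
  assert (B2 : Rpower (Rabs (1 / INR k - orbit b n)) (- al) <= 4 * INR k ^ 2 * Rpower A al).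
  { assert (0 < 4 * INR k ^ 2) by nra.
    assert (0 < 4 * INR k ^ 2 * A) by (apply Rmult_lt_0_compat; lra).
    eapply Rle_trans; [apply Rpower_antitone; [|exact G|lra]; apply Rinv_0_lt_compat; lra|].
    replace (Rpower (/ (4 * INR k ^ 2 * A)) (- al)) with (Rpower (4 * INR k ^ 2 * A) al).
    - rewrite <- Rpower_mult_distr by lra.
      apply Rmult_le_compat_r; [apply Rlt_le, Rpower_pos|]. apply Rpower_le_base; nra.
    - unfold Rpower. f_equal. rewrite ln_Rinv by lra. ring. }
  pose proof (Rpower_pos (tden b n) (- 2 * (1 - al))).
  pose proof (Rpower_pos (Rabs (1 / INR k - orbit b n)) (- al)).
  eapply Rle_trans; [apply Rmult_le_compat; [lra | lra | exact B1 | exact B2]|].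
  right. unfold Rdiv. ring.
Qed.

(** In the closed form, [c / k + d = q / k <= q], [c y + d >= q / (k + 1)] because
    [y >= 1 / (k + 1)], and the gap is at most [1 / a_(j+2)]; the exponents of [q] add up to
    [- 2 (1 - al)]. *)
Lemma along_on_digit b a al k j : cf_expansion b a -> 0 < al < 1 -> (1 <= k)%nat ->
  (k <= a (S j))%nat ->
  spike a al (S j) / (INR k + 1)
  <= along b (v b al) (ssum a j + (a (S j) - k)) (1 / INR k).
Proof.
  intros Hcf Ha Hk Hka. pose proof (INR_ge_1 k Hk) as HK.
  pose proof (unit_range k Hk) as Hx.
  pose proof (on_digit_gap b a k j Hcf Hk Hka) as [E [G0 G]].
  pose proof (q_digit b a k j Hcf Hk Hka) as Q.
  set (n := (ssum a j + (a (S j) - k))%nat) in *.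
  pose proof (INR_ge_1 (a (S (S j))) (cf_digit b a Hcf (S (S j)) ltac:(lia))) as HA.
  pose proof (theta_range b a (S j) Hcf) as Ht.
  destruct (denoms_bounds b n) as [Hc [Hd _]].
  assert (Hq : 1 <= INR (q a (S j))) by (rewrite Q; nra).
  destruct (orbit_irr b n (cf_range b a Hcf) (cf_irr b a Hcf)) as [Ho Hio].
  rewrite along_v by (try apply (cf_range b a Hcf); try apply (cf_irr b a Hcf); auto;
    intros F; apply (irr_unit _ k Hio Hk); auto).
  unfold spike. set (A := INR (a (S (S j)))) in *. set (qq := INR (q a (S j))) in *.
  set (y := orbit b n) in *.
  assert (HG : 0 < Rabs (1 / INR k - y)).
  { apply Rabs_pos_lt. intros F. apply (irr_unit _ k Hio Hk). fold y. lra. }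
  assert (B1 : Rpower qq (al - 2) <= Rpower (dc b n * (1 / INR k) + dd b n) (al - 2)).
  { apply Rpower_antitone; [nra | | lra]. rewrite Q. nra. }
  assert (B2 : Rpower qq al / (INR k + 1) <= Rpower (dc b n * y + dd b n) al).
  { assert (Hy : / (INR k + 1) <= y).
    { rewrite E. unfold Rdiv. rewrite Rmult_1_l. apply Rinv_le_contravar; lra. }
    assert (Hik : 0 < / (INR k + 1)) by (apply Rinv_0_lt_compat; lra).
    assert (Hdk : INR k * dd b n * / (INR k + 1) <= dd b n).
    { apply Rmult_le_reg_r with (INR k + 1); [lra|].
      rewrite Rmult_assoc, Rinv_l by lra. nra. }
    apply Rle_trans with (Rpower (qq * / (INR k + 1)) al).
    - rewrite <- Rpower_mult_distr by lra.
      apply Rmult_le_compat_l; [apply Rlt_le, Rpower_pos|].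
      replace (Rpower (/ (INR k + 1)) al) with (/ Rpower (INR k + 1) al).
      + apply Rinv_le_contravar; [apply Rpower_pos|]. apply Rpower_le_base; lra.
      + rewrite <- Rpower_Ropp. unfold Rpower. f_equal. rewrite ln_Rinv by lra. ring.
    - apply Rpower_monotone; [apply Rmult_lt_0_compat; lra | | lra].
      rewrite Q, Rmult_plus_distr_r. nra. }
  assert (B3 : Rpower A al <= Rpower (Rabs (1 / INR k - y)) (- al)).
  { replace (Rpower A al) with (Rpower (/ A) (- al)).
    - apply Rpower_antitone; lra.
    - unfold Rpower. f_equal. rewrite ln_Rinv by lra. ring. }
  replace (Rpower A al / Rpower qq (2 * (1 - al)) / (INR k + 1))
    with (Rpower qq (al - 2) * (Rpower qq al / (INR k + 1)) * Rpower A al).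
  - pose proof (Rpower_pos qq (al - 2)). pose proof (Rpower_pos qq al).
    pose proof (Rpower_pos A al).
    assert (0 < Rpower qq al / (INR k + 1)) by (apply Rdiv_lt_0_compat; lra).
    apply Rmult_le_compat; try lra; [apply Rmult_le_pos; lra|].
    apply Rmult_le_compat; lra.
  - unfold Rdiv. rewrite <- Rpower_Ropp.
    replace (- (2 * (1 - al))) with (al - 2 + al) by ring. rewrite Rpower_plus. ring.
Qed.

(** The terms of a convergent series tend to 0, and the spare [eps] in their exponent absorbs the
    logarithm. *)
Lemma log_tden_vanishes b a al c e : cf_expansion b a -> 0 < al < 1 -> intermediate_type a al ->
  0 <= c -> 0 < e -> exists N, forall n, (N <= n)%nat ->
  c * (ln (INR n) * Rpower (tden b n) (- 2 * (1 - al))) <= e.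
Proof.
  intros Hcf Ha Hint Hc He.
  destruct (tden_summable b a al Hcf Ha Hint) as [eps [B [Heps HB]]].
  set (L := (2 + 2 / eps) ^ 2).
  assert (HL : 0 <= L) by apply pow2_ge_0.
  assert (HcL : 0 < c * L + 1) by (pose proof (Rmult_le_pos c L Hc HL); lra).
  destruct (bsum_tail_small (fun m => Rpower (tden b m) (- 2 * (1 - al) + eps)) B
     (e / (c * L + 1))) as [N HN];
    [intros; apply Rlt_le, Rpower_pos | exact HB | apply Rdiv_lt_0_compat; lra |].
  exists N. intros n Hn.
  pose proof (HN (S n) n Hn) as K. cbn [bsum] in K.
  pose proof (tden_log_absorb b al eps n ltac:(lra)) as A. fold L in A.
  pose proof (ln_tden_nonneg b n) as Hl.
  assert (Hln : ln (INR n) <= ln (tden b n)).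
  { destruct n as [|n]; [rewrite ln_INR_0; exact Hl|].
    apply ln_le; [pose proof (INR_ge_1 (S n) ltac:(lia)); lra|].
    eapply Rle_trans; [|apply tden_ge]. apply le_INR. lia. }
  set (X := Rpower (tden b n) (- 2 * (1 - al))) in *.
  set (Y := Rpower (tden b n) (- 2 * (1 - al) + eps)) in *.
  assert (HX : 0 < X) by apply Rpower_pos. assert (HY : 0 < Y) by apply Rpower_pos.
  assert (M : ln (INR n) * X <= L * Y).
  { eapply Rle_trans; [|exact A]. rewrite Rmult_comm. apply Rmult_le_compat_l; [lra|]. nra. }
  assert (HY' : Y <= e / (c * L + 1)) by lra.
  apply Rle_trans with (c * (L * Y)); [apply Rmult_le_compat_l; lra|].
  apply Rle_trans with ((c * L + 1) * (e / (c * L + 1))).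
  - rewrite <- Rmult_assoc. apply Rmult_le_compat; try lra. apply Rmult_le_pos; lra.
  - right. field. lra.
Qed.

Lemma h1_unit k : (1 <= k)%nat -> h1 (1 / INR k) = INR k.
Proof. intros Hk. pose proof (INR_ge_1 k Hk). unfold h1. field. lra. Qed.

(** For a nonnegative sequence the second clause of [is_limsup] at 0 is automatic, so the first must
    fail. An infinite limsup is included. *)
Lemma not_limsup_0 u : (forall n, 0 <= u n) -> ~ is_limsup u 0 ->
  exists e, 0 < e /\ forall N, exists n, (N <= n)%nat /\ e <= u n.
Proof.
  intros Hu Hn. apply NNPP. intros Hc. apply Hn. split.
  - intros e He. apply NNPP. intros Hne. apply Hc. exists e. split; [exact He|].
    intros N. apply NNPP. intros Hno. apply Hne. exists N. intros n HN.
    destruct (Rlt_le_dec (u n) (0 + e)) as [H|H]; [exact H|].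
    exfalso. apply Hno. exists n. split; [exact HN | lra].
  - intros e He N. exists N. split; [lia|]. pose proof (Hu N). lra.
Qed.

Theorem theorem3p3
  (alpha beta : R) (a : nat -> nat) (k l : nat) (nkj : nat -> nat) (I : R)
  (Halpha : 0 < alpha < 1)
  (Hbeta : 0 < beta <= 1)
  (Hirr : forall (p : Z) (r : nat), (0 < r)%nat -> beta <> IZR p / INR r)
  (Hdig : forall n, (1 <= n)%nat -> (1 <= a n)%nat)
  (Hcf : Un_cv (fun m => cf_fin (digits a 1 m)) beta)
  (Hint : intermediate_type a alpha)
  (Hinf : forall M : nat, exists N, forall n, (N <= n)%nat -> (M <= a n)%nat)
  (Hk : (1 <= k)%nat)
  (Hl : (1 <= l)%nat /\ (forall m, (l <= m)%nat -> (k <= a m)%nat) /\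
        (forall i, (1 <= i)%nat -> (forall m, (i <= m)%nat -> (k <= a m)%nat) -> (l <= i)%nat))
  (Hnkj : forall j, (l <= j)%nat ->
     Un_cv (fun m => cf_fin (k :: digits a (S j) m)) (Nat.iter (nkj j) T1 beta))
  (HI : improper_int01 (v beta alpha) beta I) :
  let Skj := fun j : nat =>
    Rpower (INR (a (S j))) alpha * ln (INR (nkj j)) / Rpower (INR (q a j)) (2 * (1 - alpha)) in
  let F := fun n : nat => ln (INR n) * P1n n (v beta alpha) (1 / INR k) in
  (is_limsup Skj 0 -> Un_cv F (I * h1 (1 / INR k))) /\
  (~ is_limsup Skj 0 ->
     is_liminf F (I * h1 (1 / INR k)) /\
     exists c, I < c /\ forall N, exists n, (N <= n)%nat /\ c < F n).
Proof.
  intros Skj F. rewrite h1_unit by exact Hk.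
  pose proof (INR_ge_1 k Hk) as HK.
  assert (Hi : irr beta) by (apply irr_of_not_fraction, Hirr).
  assert (Hb : 0 < beta < 1).
  { pose proof (irr_neq beta 1 1 Hi ltac:(lia)). lra. }
  assert (Cf : cf_expansion beta a) by (split; assumption).
  destruct Hl as [Hl1 [Hlk _]].
  (* Index shift: the time [nkj (S j)] falls in the block of the digit [a (S j)]. As [l >= 1], every
     relevant index is a successor. *)
  assert (Htime : forall j, (l <= S j)%nat -> nkj (S j) = (ssum a j + (a (S j) - k))%nat).
  { intros j Hj. apply (time_of_digit beta a k j); auto. }
  assert (HSk : forall j, Skj j = ln (INR (nkj j)) * spike a alpha j).
  { intros j. unfold Skj, spike, Rdiv. ring. }
  assert (Hspike : forall j, 0 < spike a alpha j).
  { intros j. apply Rdiv_lt_0_compat; apply Rpower_pos. }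
  assert (HSpos : forall j, 0 <= Skj j).
  { intros j. rewrite HSk. apply Rmult_le_pos; [apply ln_nonneg_INR | apply Rlt_le, Hspike]. }
  assert (HIpos : 0 <= I).
  { eapply Rle_trans; [|apply (RInt_vreg_le alpha beta I 1); auto; lra].
    apply RInt_ge_0; [lra | apply cont01_ex_RInt; [apply vreg_cont; lra | lra | lra] |].
    intros; apply vreg_nonneg. }
  assert (Hfrac : exists N, forall j, (N <= j)%nat -> theta beta a (S j) <= 1 / 2).
  { destruct (Hinf 2%nat) as [N HN]. exists N. intros j Hj.
    pose proof (theta_bounds beta a (S j) Cf) as [_ T]. eapply Rle_trans; [exact T|].
    apply Rmult_le_compat_l; [lra|]. apply Rinv_le_contravar; [lra|].
    apply (le_INR 2), HN. lia. }
  assert (Lower : forall e, 0 < e -> exists N, forall n, (N <= n)%nat -> INR k * I - e < F n).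
  { intros e He. destruct (P1n_v_lower beta alpha k I (e / 2) Hb Hi Halpha Hk HI ltac:(lra))
      as [N HN]. exists N. intros n Hn. specialize (HN n Hn). unfold F.
    pose proof (along_nonneg beta (v beta alpha) n (fun z _ => v_nonneg beta alpha z)
                  (1 / INR k) (unit_range k Hk)) as A.
    pose proof (Rmult_le_pos _ _ (ln_nonneg_INR n) A). lra. }
  (* Away from the times [n_{k,j}], the resonance times [ln n] tends to 0. *)
  assert (Upper : forall e, 0 < e -> exists N, forall j i, (i < a (S j))%nat ->
     (N <= ssum a j + i)%nat -> (a (S j) - i <> k)%nat -> F (ssum a j + i)%nat < INR k * I + e).
  { intros e He.
    destruct (P1n_v_upper beta a alpha k I (e / 3) Cf Halpha Hint Hinf Hk HI ltac:(lra)) as [N1 HN1].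
    destruct Hfrac as [N2 HN2]. destruct (block_index_large a N2) as [N3 HN3].
    set (c := (INR k ^ 2 + 8) * (2 * INR k * (INR k + 1))).
    assert (Hc : 0 <= c) by (unfold c; apply Rmult_le_pos; nra).
    destruct (log_tden_vanishes beta a alpha c (e / 3) Cf Halpha Hint Hc ltac:(lra)) as [N4 HN4].
    exists (Nat.max N1 (Nat.max N3 N4)). intros j i Hij HN Hne.
    specialize (HN1 (ssum a j + i)%nat ltac:(lia)). specialize (HN4 (ssum a j + i)%nat ltac:(lia)).
    pose proof (resonance_off_digit beta a alpha k j i Cf Halpha Hk Hij Hne
                  (HN2 j (HN3 j i Hij ltac:(lia)))) as R0.
    unfold F. set (n := (ssum a j + i)%nat) in *.
    assert (R1 : (INR k ^ 2 + 8) * (ln (INR n) * resonance beta alpha k n) <= e / 3).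
    { eapply Rle_trans; [|exact HN4]. unfold c. rewrite Rmult_assoc.
      apply Rmult_le_compat_l; [nra|].
      rewrite <- Rmult_assoc, (Rmult_comm (2 * INR k * (INR k + 1))), Rmult_assoc.
      apply Rmult_le_compat_l; [apply ln_nonneg_INR | exact R0]. }
    lra. }
  rewrite (Rmult_comm I). split.
  - intros [Hlim _] e He.
    destruct (Lower e He) as [N1 HN1]. destruct (Upper e He) as [N2 HN2].
    destruct (P1n_v_upper beta a alpha k I (e / 2) Cf Halpha Hint Hinf Hk HI ltac:(lra)) as [N3 HN3].
    set (c := (INR k ^ 2 + 8) * (4 * INR k ^ 4)).
    assert (Hc : 0 < c).
    { assert (0 < INR k ^ 4) by (apply pow_lt; lra). unfold c. apply Rmult_lt_0_compat; nra. }
    destruct (Hlim (e / (2 * c)) ltac:(apply Rdiv_lt_0_compat; lra)) as [J HJ].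
    destruct (block_index_large a (Nat.max J l)) as [N4 HN4].
    exists (Nat.max (Nat.max N1 N2) (Nat.max N3 N4)). intros n Hn.
    assert (Up : F n < INR k * I + e).
    { destruct (block_exists a n Hdig) as [j [i [Hij En]]].
      (* If the leading digit at time [n] is [k], then [n] is [nkj (S j)], and the resonance term is
         at most a constant times [Skj (S j)]. *)
      destruct (Nat.eq_dec (a (S j) - i) k) as [Ek|Ek].
      - assert (Hj : (Nat.max J l <= j)%nat) by (apply (HN4 j i Hij); lia).
        assert (Ei : i = (a (S j) - k)%nat) by lia. subst i.
        pose proof (resonance_on_digit beta a alpha k j Cf Halpha Hk ltac:(lia)) as R0.
        rewrite <- En in R0.
        specialize (HJ (S j) ltac:(lia)). rewrite HSk, Htime, <- En in HJ by lia.
        specialize (HN3 n ltac:(lia)). unfold F.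
        assert (R1 : (INR k ^ 2 + 8) * (ln (INR n) * resonance beta alpha k n)
           <= c * (ln (INR n) * spike a alpha (S j))).
        { unfold c. rewrite (Rmult_assoc (INR k ^ 2 + 8)). apply Rmult_le_compat_l; [nra|].
          rewrite <- Rmult_assoc, (Rmult_comm (4 * INR k ^ 4)), Rmult_assoc.
          apply Rmult_le_compat_l; [apply ln_nonneg_INR | exact R0]. }
        assert (R2 : c * (ln (INR n) * spike a alpha (S j)) < c * (e / (2 * c)))
          by (apply Rmult_lt_compat_l; lra).
        replace (c * (e / (2 * c))) with (e / 2) in R2 by (field; lra). lra.
      - subst n. apply HN2; auto. lia. }
    pose proof (HN1 n ltac:(lia)). unfold Rdist. apply Rabs_def1; lra.
  - intros Hnot. split; [split|].
    + intros e He. apply Lower, He.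
    + intros e He N. destruct (Upper e He) as [N1 HN1]. destruct (Hinf (S k)) as [N2 HN2].
      set (j := Nat.max N (Nat.max N1 N2)).
      pose proof (ssum_ge a j Hdig). pose proof (HN2 (S j) ltac:(unfold j; lia)).
      (* The start of a block whose digit exceeds [k]: its leading digit is not [k]. *)
      exists (ssum a j + 0)%nat. split; [lia|]. apply HN1; lia.
    + destruct (not_limsup_0 Skj HSpos Hnot) as [e0 [He0 Hinf0]].
      set (r := e0 / (INR k + 1)). assert (Hr : 0 < r) by (apply Rdiv_lt_0_compat; lra).
      (* At the chosen times the gain is at least [r] and the error at most [r / 2], so [F] reaches
         [INR k * I + r / 2]. This witness exceeds [I] because [I >= 0] and [k >= 1]. *)
      exists (INR k * I + r / 4). split; [nra|]. intros N.
      destruct (P1n_v_lower beta alpha k I (r / 2) Hb Hi Halpha Hk HI ltac:(lra)) as [N1 HN1].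
      destruct (Hinf0 (S (Nat.max l (Nat.max N N1)))) as [j' [Hj' HS]].
      destruct j' as [|j]; [lia|].
      rewrite HSk, Htime in HS by lia.
      pose proof (along_on_digit beta a alpha k j Cf Halpha Hk (Hlk (S j) ltac:(lia))) as A.
      set (n := (ssum a j + (a (S j) - k))%nat) in *.
      assert (Hn : (Nat.max N N1 <= n)%nat).
      { pose proof (ssum_ge a j Hdig). unfold n. lia. }
      exists n. split; [lia|]. specialize (HN1 n ltac:(lia)). unfold F.
      assert (B : r <= ln (INR n) * along beta (v beta alpha) n (1 / INR k)).
      { apply Rle_trans with (ln (INR n) * (spike a alpha (S j) / (INR k + 1))).
        - unfold r, Rdiv. rewrite <- Rmult_assoc. apply Rmult_le_compat_r; [|exact HS].
          apply Rlt_le, Rinv_0_lt_compat. lra.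
        - apply Rmult_le_compat_l; [apply ln_nonneg_INR | exact A]. }
      lra.
Qed.
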